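(* Let $(K,\mathsf R)$ be a triangular Hopf $*$-algebra over $\mathbb C$ with $\mathsf R^{*\otimes *}=\mathsf R_{21}=\overline{\mathsf R}$, let $\mathsf F$ be a twist of the Hopf $*$-algebra $K$ and let $A$ be a $K$-module $*$-algebra. Then the isomorphism of $K_{\mathsf F}$-braided Lie algebras $$\mathcal D:\mathrm{Der}(A)_{\mathsf F}\to\mathrm{Der}(A_{\mathsf F}),\qquad\mathcal D(\psi)(a)=(\overline{\mathsf F}^\alpha\triangleright\psi)(\overline{\mathsf F}_\alpha\triangleright a),$$ is an isomorphism of $K_{\mathsf F}$-braided Lie $*$-algebras. It lifts to an isomorphism $\mathcal D:\mathcal U(\mathrm{Der}(A)_{\mathsf F})\to\mathcal U(\mathrm{Der}(A_{\mathsf F}))$ of $K_{\mathsf F}$-braided Hopf $*$-algebras.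
   Context: $*$-structures are antilinear involutions, antimultiplicative on algebras. Hopf $*$-algebra: $\Delta(k^* )=\Delta(k)^{*\otimes *}$. $K$-module $*$-algebra: $K$-module algebra with $(k\triangleright a)^*=S^{-1}(k^* )\triangleright a^*$. $\mathsf R=\mathsf R^\alpha\otimes\mathsf R_\alpha$ is the universal $R$-matrix ($\Delta^{cop}(k)=\mathsf R\Delta(k)\overline{\mathsf R}$, $(\Delta\otimes\mathrm{id})\mathsf R=\mathsf R_{13}\mathsf R_{23}$, $(\mathrm{id}\otimes\Delta)\mathsf R=\mathsf R_{13}\mathsf R_{12}$), $\overline{\mathsf R}=\overline{\mathsf R}^\alpha\otimes\overline{\mathsf R}_\alpha$ its inverse; triangular means $\overline{\mathsf R}=\mathsf R_{21}$. A $K$-braided Lie algebra is a $K$-module $\mathfrak g$ with bilinear bracket satisfying $k\triangleright[u,v]=[k_{(1)}\triangleright u,k_{(2)}\triangleright v]$, $[u,v]=-[\mathsf R_\alpha\triangleright v,\mathsf R^\alpha\triangleright u]$, $[u,[v,w]]=[[u,v],w]+[\mathsf R_\alpha\triangleright v,[\mathsf R^\alpha\triangleright u,w]]$. A $*$-structure on it is an antilinear involution with $(k\triangleright u)^*=S^{-1}(k^* )\triangleright u^*$ and $[u,v]^*=[v^*,u^*]$. $K$ acts on $\mathrm{Hom}(A,A)$ by $(k\triangleright\psi)(a)=k_{(1)}\triangleright\psi(S(k_{(2)})\triangleright a)$. $\mathrm{Der}(A)$ is the $K$-braided Lie algebra of braided derivations, i.e. linear maps with $\psi(aa')=\psi(a)a'+(\mathsf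 R_\alpha\triangleright a)(\mathsf R^\alpha\triangleright\psi)(a')$, with bracket $[\psi,\lambda]=\psi\circ\lambda-(\mathsf R_\alpha\triangleright\lambda)\circ(\mathsf R^\alpha\triangleright\psi)$ and $*$-structure $\psi^*(a)=-\big((\overline{\mathsf R}^\alpha\triangleright\psi)(\overline{\mathsf R}_\alpha\triangleright a^* )\big)^*$. The universal enveloping algebra $\mathcal U(\mathfrak g)$ is the tensor algebra of $\mathfrak g$ modulo $u\otimes v-(\mathsf R_\alpha\triangleright v)\otimes(\mathsf R^\alpha\triangleright u)-[u,v]$; it is a braided Hopf algebra associated with $(K,\mathsf R)$ with $\Delta(u)=u\boxtimes1+1\boxtimes u$ for $u\in\mathfrak g$, and a $*$-structure on $\mathfrak g$ extends antimultiplicatively to it. Here, for a $K$-module algebra $L$, $L\boxtimes L$ is $L\otimes L$ with product $(x\otimes y)(x'\otimes y')=x(\mathsf R_\alpha\triangleright x')\otimes(\mathsf R^\alpha\triangleright y)y'$, and $(x\boxtimes y)^*=(\mathsf R_\alpha\triangleright x^* )\boxtimes(\mathsf R^\alpha\triangleright y^* )$. A braided Hopf $*$-algebra $L$ is a braided Hopf algebra (Hopf algebra in the braided category of $K$-modules, with coproduct an algebra map $L\to L\boxtimes L$) that is a $K$-module $*$-algebra with $\Delta_L(x^* )=\Delta_L(x)^*$. A twist of a Hopf $*$-algebra is an invertible $\mathsf F=\mathsf F^\alpha\otimes\mathsf F_\alpha\in K\otimes K$, inverse $\overline{\mathsf F}=\overline{\mathsf F}^\alpha\otimes\overline{\mathsf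 F}_\alpha$, with $(\varepsilon\otimes\mathrm{id})\mathsf F=1=(\mathrm{id}\otimes\varepsilon)\mathsf F$, $(\mathsf F\otimes1)(\Delta\otimes\mathrm{id})(\mathsf F)=(1\otimes\mathsf F)(\mathrm{id}\otimes\Delta)(\mathsf F)$ and $\mathsf F^{*\otimes *}=(S\otimes S)\mathsf F_{21}$. $K_{\mathsf F}$ is the algebra $K$ with $\Delta_{\mathsf F}(k)=\mathsf F\Delta(k)\overline{\mathsf F}$, $S_{\mathsf F}(k)=\mathsf uS(k)\overline{\mathsf u}$, $\mathsf u=\mathsf F^\alpha S(\mathsf F_\alpha)$, $\overline{\mathsf u}=\mathsf u^{-1}$, $\mathsf R_{\mathsf F}=\mathsf F_{21}\mathsf R\overline{\mathsf F}$, $k^{*_{\mathsf F}}=\mathsf uk^*\overline{\mathsf u}$. $A_{\mathsf F}$ is $A$ with product $a\bullet_{\mathsf F}a'=(\overline{\mathsf F}^\alpha\triangleright a)(\overline{\mathsf F}_\alpha\triangleright a')$ and the same action and $*$. $\mathrm{Der}(A)_{\mathsf F}$ is the $K_{\mathsf F}$-module $\mathrm{Der}(A)$ with bracket $[\psi,\lambda]_{\mathsf F}=[\overline{\mathsf F}^\alpha\triangleright\psi,\overline{\mathsf F}_\alpha\triangleright\lambda]$ and the same $*$; $\mathrm{Der}(A_{\mathsf F})$ is the $K_{\mathsf F}$-braided Lie $*$-algebra of braided derivations of $A_{\mathsf F}$: writing $\Delta_{\mathsf F}(k)=k_{[1]}\otimes k_{[2]}$, $\mathsf R_{\mathsf F}=\mathsf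 R_{\mathsf F}{}^\alpha\otimes\mathsf R_{\mathsf F\,\alpha}$ and $\overline{\mathsf R}_{\mathsf F}=\overline{\mathsf R}_{\mathsf F}{}^\alpha\otimes\overline{\mathsf R}_{\mathsf F\,\alpha}$ for the inverse of $\mathsf R_{\mathsf F}$, and letting $K_{\mathsf F}$ act on $\mathrm{Hom}(A_{\mathsf F},A_{\mathsf F})$ by $(k\triangleright_{\mathsf F}\psi)(a)=k_{[1]}\triangleright\psi(S_{\mathsf F}(k_{[2]})\triangleright a)$, it consists of the linear maps $\psi:A_{\mathsf F}\to A_{\mathsf F}$ with $\psi(a\bullet_{\mathsf F}a')=\psi(a)\bullet_{\mathsf F}a'+(\mathsf R_{\mathsf F\,\alpha}\triangleright a)\bullet_{\mathsf F}(\mathsf R_{\mathsf F}{}^\alpha\triangleright_{\mathsf F}\psi)(a')$, with bracket $[\psi,\lambda]_{\mathsf R_{\mathsf F}}=\psi\circ\lambda-(\mathsf R_{\mathsf F\,\alpha}\triangleright_{\mathsf F}\lambda)\circ(\mathsf R_{\mathsf F}{}^\alpha\triangleright_{\mathsf F}\psi)$ and $*$-structure $\psi^*(a)=-\big((\overline{\mathsf R}_{\mathsf F}{}^\alpha\triangleright_{\mathsf F}\psi)(\overline{\mathsf R}_{\mathsf F\,\alpha}\triangleright a^* )\big)^*$, which is compatible with the $K_{\mathsf F}$-action in the sense that $(k\triangleright_{\mathsf F}\psi)^*=S_{\mathsf F}^{-1}(k^{*_{\mathsf F}})\triangleright_{\mathsf F}\psi^*$. *)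

(* Defs.v *)
From HB Require Import structures.
From mathcomp Require Import all_boot all_order all_algebra.
From mathcomp Require Import finmap boolp classical_sets functions reals.
From mathcomp Require Import complex monalg.

Set Implicit Arguments.
Unset Strict Implicit.
Unset Printing Implicit Defensive.

Import GRing.Theory Num.Theory.

Local Open Scope quotient_scope.
Local Open Scope ring_scope.

Inductive span (C : pzRingType) (V : lmodType C) (X : set V) : V -> Prop :=
| span0 : span X 0
| span_lin c x v : X x -> span X v -> span X (c *: x + v).

Section SpanTheory.
Variables (C : pzRingType) (V : lmodType C) (X : set V).

Lemma span_gen x : X x -> span X x.
Proof. by move=> Xx; have := span_lin 1 Xx (span0 X); rewrite scale1r addr0. Qed.

Lemma spanD u v : span X u -> span X v -> span X (u + v).
Proof.
move=> Xu Xv; elim: Xu => [|c x w Xx _ IH]; first by rewrite add0r.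
by rewrite -addrA; apply: span_lin.
Qed.

Lemma spanZ a u : span X u -> span X (a *: u).
Proof.
elim=> [|c x w Xx _ IH]; first by rewrite scaler0; apply: span0.
by rewrite scalerDr scalerA; apply: span_lin.
Qed.

Lemma spanN u : span X u -> span X (- u).
Proof. by rewrite -scaleN1r; apply: spanZ. Qed.

Lemma span_min (P : V -> Prop) :
  P 0 -> (forall c u v, P u -> P v -> P (c *: u + v)) ->
  (forall x, X x -> P x) -> forall v, span X v -> P v.
Proof. by move=> P0 Pl PX v; elim=> // c x w /PX Px _; apply: Pl. Qed.

End SpanTheory.

Section LQuot.
Variables (C : pzRingType) (V : lmodType C) (X : set V).

Definition lquot_rel (u v : V) : bool := `[< span X (u - v) >].

Lemma lquot_equiv : equiv_class_of lquot_rel.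
Proof.
split=> [u|u v|v u w].
- by apply/asboolP; rewrite subrr; apply: span0.
- by apply/asboolP/asboolP => /spanN; rewrite opprB.
- move=> /asboolP uv /asboolP vw; apply/asboolP.
  by have := spanD uv vw; rewrite addrA subrK.
Qed.

Canonical lquot_equivRel := EquivRelPack lquot_equiv.

Definition lquot : Type := {eq_quot lquot_equivRel}.
HB.instance Definition _ := EqQuotient.on lquot.
HB.instance Definition _ := Choice.on lquot.

Definition lpi (v : V) : lquot := \pi_lquot v.

Lemma lpiP u v : lpi u = lpi v <-> span X (u - v).
Proof. by rewrite /lpi; split=> [/eqquotP/asboolP|H]; last exact/eqquotP/asboolP. Qed.

Lemma lpiK (q : lquot) : lpi (repr q) = q.
Proof. exact: reprK. Qed.

Definition lquot_zero := lpi 0.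
Definition lquot_add (p q : lquot) := lpi (repr p + repr q).
Definition lquot_opp (p : lquot) := lpi (- repr p).
Definition lquot_scale c (p : lquot) := lpi (c *: repr p).

Lemma lpi_repr u : span X (repr (lpi u) - u).
Proof. by apply/lpiP; rewrite lpiK. Qed.

Lemma lquot_addE u v : lquot_add (lpi u) (lpi v) = lpi (u + v).
Proof.
apply/lpiP; rewrite opprD addrACA.
by apply: spanD; apply: lpi_repr.
Qed.

Lemma lquot_oppE u : lquot_opp (lpi u) = lpi (- u).
Proof. by apply/lpiP; rewrite -opprD; apply/spanN/lpi_repr. Qed.

Lemma lquot_scaleE c u : lquot_scale c (lpi u) = lpi (c *: u).
Proof. by apply/lpiP; rewrite -scalerBr; apply/spanZ/lpi_repr. Qed.

Lemma lquot_addA : associative lquot_add.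
Proof.
by move=> p q r; rewrite -[p]lpiK -[q]lpiK -[r]lpiK !lquot_addE addrA.
Qed.
Lemma lquot_addC : commutative lquot_add.
Proof. by move=> p q; rewrite /lquot_add addrC. Qed.
Lemma lquot_add0 : left_id lquot_zero lquot_add.
Proof. by move=> p; rewrite -[p]lpiK lquot_addE add0r. Qed.
Lemma lquot_addN : left_inverse lquot_zero lquot_opp lquot_add.
Proof. by move=> p; rewrite -[p]lpiK lquot_oppE lquot_addE addNr. Qed.

HB.instance Definition _ :=
  GRing.isZmodule.Build lquot lquot_addA lquot_addC lquot_add0 lquot_addN.

Lemma lpiD u v : lpi (u + v) = lpi u + lpi v.
Proof. exact/esym/lquot_addE. Qed.

Lemma lquot_scaleA a b p :
  lquot_scale a (lquot_scale b p) = lquot_scale (a * b) p.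
Proof. by rewrite -[p]lpiK !lquot_scaleE scalerA. Qed.
Lemma lquot_scale1 : left_id 1 lquot_scale.
Proof. by move=> p; rewrite -[p]lpiK lquot_scaleE scale1r. Qed.
Lemma lquot_scaleDr : right_distributive lquot_scale +%R.
Proof.
by move=> a p q; rewrite -[p]lpiK -[q]lpiK -lpiD !lquot_scaleE -lpiD scalerDr.
Qed.
Lemma lquot_scaleDl p : {morph lquot_scale^~ p : a b / a + b}.
Proof. by move=> a b; rewrite -[p]lpiK !lquot_scaleE -lpiD scalerDl. Qed.

HB.instance Definition _ := GRing.Zmodule_isLmodule.Build C lquot
  lquot_scaleA lquot_scale1 lquot_scaleDr lquot_scaleDl.

Lemma lpi_linear : linear lpi.
Proof. by move=> c u v; rewrite lpiD -lquot_scaleE. Qed.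
HB.instance Definition _ := GRing.isLinear.Build C V lquot *:%R lpi lpi_linear.

End LQuot.

Section AQuot.
Variables (C : comNzRingType) (A : algType C) (X : set A).

(** [span ideal_gens] is the two-sided ideal generated by [X]. *)
Definition ideal_gens : set A :=
  fun y => exists a x b, X x /\ y = a * x * b.

Definition aquot : Type := lquot ideal_gens.
HB.instance Definition _ := GRing.Lmodule.on aquot.

Definition api : A -> aquot := @lpi C A ideal_gens.
Lemma api_linear : linear api. Proof. exact: lpi_linear. Qed.
HB.instance Definition _ := GRing.isLinear.Build C A aquot *:%R api api_linear.

Lemma apiD u v : api (u + v) = api u + api v. Proof. exact: raddfD. Qed.
Lemma apiZ c u : api (c *: u) = c *: api u. Proof. exact: linearZ. Qed.

Lemma apiP u v : api u = api v <-> span ideal_gens (u - v).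
Proof. exact: lpiP. Qed.

Lemma apiK (q : aquot) : api (repr (q : lquot ideal_gens)) = q.
Proof. exact: lpiK. Qed.

Lemma ideal_mull a u : span ideal_gens u -> span ideal_gens (a * u).
Proof.
elim=> [|c _ v [b [x [d [Xx ->]]]] _ IH]; first by rewrite mulr0; apply: span0.
rewrite mulrDr -scalerAr !mulrA; apply: span_lin => //.
by exists (a * b), x, d.
Qed.

Lemma ideal_mulr a u : span ideal_gens u -> span ideal_gens (u * a).
Proof.
elim=> [|c _ v [b [x [d [Xx ->]]]] _ IH]; first by rewrite mul0r; apply: span0.
rewrite mulrDl -scalerAl -!mulrA; apply: span_lin => //.
by exists b, x, (d * a); rewrite mulrA.
Qed.

Definition aquot_one : aquot := api 1.
Definition aquot_mul (p q : aquot) : aquot :=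
  api (repr (p : lquot ideal_gens) * repr (q : lquot ideal_gens)).

Lemma aquot_mulE u v : aquot_mul (api u) (api v) = api (u * v).
Proof.
apply/apiP; set u' := repr _; set v' := repr _.
have -> : u' * v' - u * v = (u' - u) * v' + u * (v' - v).
  by rewrite mulrBl mulrBr addrA subrK.
by apply: spanD; [apply: ideal_mulr | apply: ideal_mull]; apply: lpi_repr.
Qed.

Lemma aquot_mulA : associative aquot_mul.
Proof.
by move=> p q r; rewrite -[p]apiK -[q]apiK -[r]apiK !aquot_mulE mulrA.
Qed.
Lemma aquot_mul1l : left_id aquot_one aquot_mul.
Proof. by move=> p; rewrite -[p]apiK aquot_mulE mul1r. Qed.
Lemma aquot_mul1r : right_id aquot_one aquot_mul.
Proof. by move=> p; rewrite -[p]apiK aquot_mulE mulr1. Qed.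
Lemma aquot_mulDl : left_distributive aquot_mul +%R.
Proof.
move=> p q r; rewrite -[p]apiK -[q]apiK -[r]apiK -apiD !aquot_mulE.
by rewrite -apiD mulrDl.
Qed.
Lemma aquot_mulDr : right_distributive aquot_mul +%R.
Proof.
move=> p q r; rewrite -[p]apiK -[q]apiK -[r]apiK -apiD !aquot_mulE.
by rewrite -apiD mulrDr.
Qed.

HB.instance Definition _ := GRing.Zmodule_isPzRing.Build aquot
  aquot_mulA aquot_mul1l aquot_mul1r aquot_mulDl aquot_mulDr.

Lemma apiM u v : api (u * v) = api u * api v.
Proof. exact/esym/aquot_mulE. Qed.

Lemma aquot_scaleAl (c : C) (p q : aquot) : c *: (p * q) = (c *: p) * q.
Proof. by rewrite -[p]apiK -[q]apiK -apiM -apiZ scalerAl apiM apiZ. Qed.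
Lemma aquot_scaleAr (c : C) (p q : aquot) : c *: (p * q) = p * (c *: q).
Proof. by rewrite -[p]apiK -[q]apiK -apiM -apiZ scalerAr apiM apiZ. Qed.

End AQuot.

Section Tensor.
Variables (C : fieldType) (V W : lmodType C).

Inductive tensor_rel : {malg C[(V * W)%type]} -> Prop :=
| tensor_rel_l c v v' w :
    tensor_rel (<< (c *: v + v', w) >> - (c *: << (v, w) >> + << (v', w) >>))
| tensor_rel_r c v w w' :
    tensor_rel (<< (v, c *: w + w') >> - (c *: << (v, w) >> + << (v, w') >>)).

Definition tensor : Type := lquot tensor_rel.
HB.instance Definition _ := GRing.Lmodule.on tensor.

Definition tpure (v : V) (w : W) : tensor := @lpi C _ tensor_rel << (v, w) >>.

(** [tsum f t] is the value at [t] of the additive map on [V ⊗ W] that sends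
    [v ⊗ w] to [f v w]; it is meaningful when [f] is balanced (see
    [tsum_pure]), which covers [f] bilinear as well as [f] antilinear in both
    arguments. *)
Definition tsum (U : zmodType) (f : V -> W -> U) (t : tensor) : U :=
  let m := repr (t : lquot tensor_rel) in
  \sum_(p <- msupp m) f (m@_p *: p.1) p.2.

Definition balanced (U : zmodType) (f : V -> W -> U) : Prop :=
  [/\ forall v v' w, f (v + v') w = f v w + f v' w,
      forall v w w', f v (w + w') = f v w + f v w'
    & forall c v w, f (c *: v) w = f v (c *: w)].

End Tensor.

Arguments tensor {C} (V W)%_type_scope.

Notation "V ⊗ W" := (tensor V W) (at level 40, left associativity) : type_scope.
Notation "v ⊗ w" := (tpure v w) (at level 40, left associativity) : ring_scope.
Notation "\tsum_ ( x , y <- t ) E" := (tsum (fun x y => E) t)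
  (at level 41, x name, y name, t at level 200, E at level 41,
   format "\tsum_ ( x ,  y  <-  t )  E") : ring_scope.

Section TensorTheory.
Variables (C : fieldType) (V W : lmodType C).

Lemma tpure_linl (w : W) : linear (fun v : V => v ⊗ w).
Proof.
move=> c v v'; rewrite /tpure -linearP.
by apply/lpiP/span_gen/tensor_rel_l.
Qed.

Lemma tpure_linr (v : V) : linear (fun w : W => v ⊗ w).
Proof.
move=> c w w'; rewrite /tpure -linearP.
by apply/lpiP/span_gen/tensor_rel_r.
Qed.

Lemma tpureDl (v v' : V) (w : W) : (v + v') ⊗ w = v ⊗ w + v' ⊗ w.
Proof. by have := tpure_linl w 1 v v'; rewrite !scale1r. Qed.
Lemma tpureDr (v : V) (w w' : W) : v ⊗ (w + w') = v ⊗ w + v ⊗ w'.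
Proof. by have := tpure_linr v 1 w w'; rewrite !scale1r. Qed.
Lemma tpure0l (w : W) : (0 : V) ⊗ w = 0.
Proof. by apply: (addrI (0 ⊗ w)); rewrite -tpureDl !addr0. Qed.
Lemma tpure0r (v : V) : v ⊗ (0 : W) = 0.
Proof. by apply: (addrI (v ⊗ 0)); rewrite -tpureDr !addr0. Qed.
Lemma tpureZl c (v : V) (w : W) : (c *: v) ⊗ w = c *: (v ⊗ w).
Proof. by have := tpure_linl w c v 0; rewrite !addr0 tpure0l addr0. Qed.
Lemma tpureZr c (v : V) (w : W) : v ⊗ (c *: w) = c *: (v ⊗ w).
Proof. by have := tpure_linr v c w 0; rewrite !addr0 tpure0r addr0. Qed.

Lemma tensor_ind (P : V ⊗ W -> Prop) :
  (forall v w, P (v ⊗ w)) -> (forall s t, P s -> P t -> P (s + t)) ->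
  forall t, P t.
Proof.
move=> Pp PD t; rewrite -[t](@lpiK C _ (@tensor_rel C V W)) [repr _]monalgE.
have P0 : P 0 by rewrite -(tpure0l 0).
rewrite raddf_sum /=; elim/big_ind: _ => // -[v w] _.
have -> : << (repr (t : lquot (@tensor_rel C V W)))@_(v, w) *g (v, w) >>
   = (repr (t : lquot (@tensor_rel C V W)))@_(v, w) *: << (v, w) >>.
  by apply/malgP=> k; rewrite mcoeffZ !mcoeffU mulr_natr.
by rewrite linearZ /= -/(v ⊗ w) -tpureZl.
Qed.

Section Tsum.
Variables (U : zmodType).
Implicit Types (f g : V -> W -> U).

Lemma tsum_addf f g t :
  tsum (fun v w => f v w + g v w) t = tsum f t + tsum g t.
Proof. exact: big_split. Qed.

Lemma eq_tsum f g t : (forall v w, f v w = g v w) -> tsum f t = tsum g t.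
Proof. by move=> fg; apply: eq_bigr. Qed.

Lemma raddf_tsum (U' : zmodType) (h : {additive U -> U'}) f t :
  h (tsum f t) = tsum (fun v w => h (f v w)) t.
Proof. exact: raddf_sum. Qed.

Variable f : V -> W -> U.
Hypothesis bal_f : balanced f.

Let F (m : {malg C[(V * W)%type]}) :=
  \sum_(p <- msupp m) f (m@_p *: p.1) p.2.

Let f0l w : f 0 w = 0.
Proof. by case: bal_f => fD _ _; apply: (addrI (f 0 w)); rewrite -fD !addr0. Qed.

Let F_w (d : {fset (V * W)%type}) m : (msupp m `<=` d)%fset ->
  F m = \sum_(p <- d) f (m@_p *: p.1) p.2.
Proof.
move=> le; rewrite /F (big_fset_incl _ le) => //= x xd /mcoeff_outdom ->.
by rewrite scale0r f0l.
Qed.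

Let FD m n : F (m + n) = F m + F n.
Proof.
rewrite (F_w (msuppD_le _ _)) (F_w (fsubsetUl _ (msupp n))).
rewrite (F_w (fsubsetUr (msupp m) _)) -big_split /=; apply: eq_bigr => p _.
by rewrite mcoeffD scalerDl; case: bal_f => ->.
Qed.

Let F0 : F 0 = 0.
Proof. by rewrite /F msupp0 big_seq_fset0. Qed.

Let FB m n : F (m - n) = F m - F n.
Proof. by apply: (addIr (F n)); rewrite -FD !subrK. Qed.

Let FU c v w : F (c *: << (v, w) >>) = f (c *: v) w.
Proof.
rewrite (F_w (d := [fset (v, w)]%fset)) ?big_seq_fset1 /=.
  by rewrite mcoeffZ mcoeffUU mulr1.
exact: fsubset_trans (msuppZ_le _ _) msuppU_le.
Qed.

Let F_span m : span (@tensor_rel C V W) m -> F m = 0.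
Proof.
case: bal_f => fDl fDr fZ.
have sub3 (x y z x' y' z' : U) :
    x = x' -> y = y' -> z = z' -> x' = y' + z' -> x - (y + z) = 0.
  by move=> -> -> -> ->; rewrite subrr.
elim=> // c _ n [a v v' w|a v w w'] _ IH; rewrite FD IH addr0.
  rewrite scalerBr FB scalerDr scalerA FD.
  apply: (sub3 _ _ _ _ _ _ (FU c (a *: v + v') w) (FU (c * a) v w)
               (FU c v' w)).
  by rewrite scalerDr fDl scalerA.
rewrite scalerBr FB scalerDr scalerA FD.
apply: (sub3 _ _ _ _ _ _ (FU c v (a *: w + w')) (FU (c * a) v w) (FU c v w')).
by rewrite fDr -fZ scalerA [a * c]mulrC.
Qed.

Lemma tsum_lpi m : tsum f (@lpi C _ (@tensor_rel C V W) m) = F m.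
Proof.
by apply/eqP; rewrite -subr_eq0 -FB; apply/eqP/F_span/lpi_repr.
Qed.

Lemma tsum_pure v w : tsum f (v ⊗ w) = f v w.
Proof. by rewrite tsum_lpi -[<< _ >>]scale1r FU scale1r. Qed.

Lemma tsumD s t : tsum f (s + t) = tsum f s + tsum f t.
Proof.
rewrite -[s](@lpiK C _ (@tensor_rel C V W)) -[t](@lpiK C _ (@tensor_rel C V W)).
by rewrite -raddfD !tsum_lpi FD.
Qed.

End Tsum.

Lemma tsum_lin (U : lmodType C) (f g : V -> W -> U) c t :
  tsum (fun v w => c *: f v w + g v w) t = c *: tsum f t + tsum g t.
Proof. by rewrite tsum_addf /tsum scaler_sumr. Qed.

Lemma linE (V' U : lmodType C) (f : V' -> U) : linear f ->
  [/\ f 0 = 0, forall u v, f (u + v) = f u + f v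
    & forall c u, f (c *: u) = c *: f u].
Proof.
move=> lf; have fD u v : f (u + v) = f u + f v.
  by have := lf 1 u v; rewrite !scale1r.
have f0 : f 0 = 0 by apply: (addrI (f 0)); rewrite -fD !addr0.
by split=> // c u; have := lf c u 0; rewrite f0 !addr0.
Qed.

Lemma lin_balanced (U : lmodType C) (f : V -> W -> U) :
  (forall w, linear (f^~ w)) -> (forall v, linear (f v)) -> balanced f.
Proof.
move=> fl fr; split=> [v v' w|v w w'|c v w].
- by have [_ -> _] := linE (fl w).
- by have [_ -> _] := linE (fr v).
have [_ _ ->] := linE (fl w); by have [_ _ ->] := linE (fr v).
Qed.

Lemma tsum_linear (U : lmodType C) (f : V -> W -> U) :
  (forall w, linear (f^~ w)) -> (forall v, linear (f v)) -> linear (tsum f).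
Proof.
move=> fl fr c s t; have bal := lin_balanced fl fr.
rewrite (tsumD bal); congr (_ + _).
elim/tensor_ind: s => [v w|s1 s2 IH1 IH2].
  rewrite -tpureZl !(tsum_pure bal); by have [_ _ ->] := linE (fl w).
by rewrite scalerDr !(tsumD bal) IH1 IH2 scalerDr.
Qed.

End TensorTheory.

(** A vector space has enough linear forms; this gives [1 != 0] in [A ⊗ B]. *)
Section LinearForm.
Variables (C : fieldType) (V : lmodType C) (v0 : V).
Hypothesis v0_neq0 : v0 != 0.

Let good (M : set V) : Prop :=
  (forall c u v, M u -> M v -> M (c *: u + v)) /\ ~ M v0.

Lemma exists_linear_form : exists f : V -> C, scalar f /\ f v0 = 1.
Proof.
have [F Fgood Ftot|M [[Mlin Mv0] Mmax]] := @Zorn_bigcup V good.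
  split=> [c u v [A FA Au] [B FB Bv]|[A FA Av0]]; last by case: (Fgood _ FA).
  case: (Ftot A B FA FB) => [AB|BA].
    by exists B => //; case: (Fgood _ FB) => + _; apply=> //; apply: AB.
  by exists A => //; case: (Fgood _ FA) => + _; apply=> //; apply: BA.
have M0 : M 0.
  apply: contrapT => nM0.
  have gM0 : good [set 0]%classic.
    split=> [c u v -> ->|/eqP]; first by rewrite scaler0 addr0.
    by rewrite (negbTE v0_neq0).
  have Me : (M `<=` [set 0])%classic.
    move=> u Mu; exfalso; apply: nM0.
    by have := Mlin (-1) u u Mu Mu; rewrite scaleN1r addNr.
  have [] := Mmax [set 0]%classic; last by [].
  by split=> // /(_ 0 erefl).
have MD u v : M u -> M v -> M (u + v).
  by move=> Mu Mv; have := Mlin 1 u v Mu Mv; rewrite scale1r.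
have MZ c u : M u -> M (c *: u).
  by move=> Mu; have := Mlin c u 0 Mu M0; rewrite addr0.
have MB u v : M u -> M v -> M (u - v).
  by move=> Mu /(MZ (-1)); rewrite scaleN1r; apply: MD.
have ex x : exists c, M (x - c *: v0).
  apply: contrapT => nex.
  pose N : set V := fun y => exists c z, M z /\ y = z + c *: x.
  have gN : good N.
    split=> [c _ _ [a [z [Mz ->]]] [b [t [Mt ->]]]|[c [z [Mz e]]]].
      exists (c * a + b), (c *: z + t); split; first exact: Mlin.
      by rewrite scalerDr scalerDl scalerA addrACA.
    have [c0|c0] := eqVneq c 0.
      by apply: Mv0; rewrite e c0 scale0r addr0.
    apply: nex; exists c^-1; rewrite e scalerDr scalerA mulVf // scale1r.
    by rewrite opprD addrCA subrr addr0 -scaleN1r; apply/MZ/MZ.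
  apply: (Mmax N) => //; split.
    by move=> u Mu; exists 0, u; rewrite scale0r addr0.
  move=> NM; apply: nex; exists 0; rewrite scale0r subr0; apply: NM.
  by exists 1, 0; rewrite scale1r add0r.
have uniq x c d : M (x - c *: v0) -> M (x - d *: v0) -> c = d.
  move=> Mc Md; apply/eqP; rewrite -subr_eq0; apply/negP => /negP cd.
  have e : x - d *: v0 - (x - c *: v0) = (c - d) *: v0.
    by rewrite opprB [LHS]addrC addrA subrK scalerBl.
  apply: Mv0; have := MZ (c - d)^-1 _ (MB _ _ Md Mc).
  by rewrite e scalerA mulVf // scale1r.
have [f fP] := choice ex.
exists f; split; last first.
  by apply: (uniq v0); rewrite ?scale1r ?subrr.
move=> c u v; apply: (uniq (c *: u + v)) => //.
rewrite scalerDl opprD addrACA -scalerA -scalerBr.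
exact: Mlin.
Qed.

End LinearForm.

Section TensorAlgebraStructure.
Variables (C : fieldType) (A B : algType C).

Lemma tpure_neq0 (V W : lmodType C) (v : V) (w : W) :
  v != 0 -> w != 0 -> v ⊗ w != 0.
Proof.
move=> /exists_linear_form [f [fl fv]] /exists_linear_form [g [gl gw]].
pose h (x : V) (y : W) : C^o := f x * g y.
have hl y : linear (h^~ y).
  by move=> c x x'; rewrite /h fl mulrDl -mulrA.
have hr x : linear (h x).
  by move=> c y y'; rewrite /h gl mulrDr mulrCA.
have bal : balanced h by exact: lin_balanced.
apply/eqP => vw0; have := tsum_pure bal v w.
have [tsum0 _ _] := linE (tsum_linear hl hr).
by rewrite vw0 tsum0 /h fv gw mulr1 => /esym/eqP; rewrite oner_eq0.
Qed.

Definition tmul (s t : A ⊗ B) : A ⊗ B :=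
  \tsum_(a, b <- s) \tsum_(a', b' <- t) ((a * a') ⊗ (b * b')).

Let tmul_linr s : linear (tmul s).
Proof.
move=> c t t'; rewrite -tsum_lin; apply: eq_tsum => a b.
by apply: tsum_linear => [y|x] d u v; rewrite mulrDr -scalerAr;
   [apply: tpure_linl | apply: tpure_linr].
Qed.

Let tmul_linl t : linear (tmul^~ t).
Proof.
apply: tsum_linear => [b|a] c x y; rewrite -tsum_lin; apply: eq_tsum => a' b'.
  by rewrite mulrDl -scalerAl tpure_linl.
by rewrite mulrDl -scalerAl tpure_linr.
Qed.

Lemma tmul_pure a b a' b' : tmul (a ⊗ b) (a' ⊗ b') = (a * a') ⊗ (b * b').
Proof.
rewrite /tmul tsum_pure; last first.
  apply: lin_balanced => [y|x] c u v; rewrite -tsum_lin;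
    apply: eq_tsum => x' y'; rewrite mulrDl -scalerAl.
  - exact: tpure_linl.
  - exact: tpure_linr.
rewrite tsum_pure //; apply: lin_balanced => [y|x] d u v; rewrite mulrDr -scalerAr.
- exact: tpure_linl.
- exact: tpure_linr.
Qed.

Let tmulDl : left_distributive tmul +%R.
Proof. by move=> s t u; have := tmul_linl u 1 s t; rewrite !scale1r. Qed.
Let tmulDr : right_distributive tmul +%R.
Proof. by move=> u s t; have := tmul_linr u 1 s t; rewrite !scale1r. Qed.

Let tmulA : associative tmul.
Proof.
move=> s t u; elim/tensor_ind: s => [a b|? ? IH1 IH2]; last first.
  by rewrite !tmulDl IH1 IH2.
elim/tensor_ind: t => [a' b'|? ? IH1 IH2]; last first.
  by rewrite !(tmulDl, tmulDr) IH1 IH2.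
elim/tensor_ind: u => [a'' b''|? ? IH1 IH2]; last by rewrite !tmulDr IH1 IH2.
by rewrite !tmul_pure !mulrA.
Qed.

Let tmul1l : left_id (1 ⊗ 1) tmul.
Proof.
by elim/tensor_ind=> [a b|s t IHs IHt]; rewrite ?tmulDr ?IHs ?IHt // tmul_pure !mul1r.
Qed.

Let tmul1r : right_id (1 ⊗ 1) tmul.
Proof.
by elim/tensor_ind=> [a b|s t IHs IHt]; rewrite ?tmulDl ?IHs ?IHt // tmul_pure !mulr1.
Qed.

Let tone_neq0 : (1 : A) ⊗ (1 : B) != 0.
Proof. by apply: tpure_neq0; apply: oner_neq0. Qed.

HB.instance Definition _ := GRing.Zmodule_isNzRing.Build (tensor A B)
  tmulA tmul1l tmul1r tmulDl tmulDr tone_neq0.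

Let tscaleAl (c : C) (s t : A ⊗ B) : c *: (s * t) = (c *: s) * t.
Proof. by have [_ _ tZ] := linE (tmul_linl t); apply/esym/tZ. Qed.

Let tscaleAr (c : C) (s t : A ⊗ B) : c *: (s * t) = s * (c *: t).
Proof. by have [_ _ tZ] := linE (tmul_linr s); apply/esym/tZ. Qed.

HB.instance Definition _ := GRing.Lmodule_isLalgebra.Build C (tensor A B) tscaleAl.
HB.instance Definition _ := GRing.Lalgebra_isAlgebra.Build C (tensor A B) tscaleAr.

Lemma tensor_oneE : (1 : A ⊗ B) = 1 ⊗ 1. Proof. by []. Qed.
Lemma tensor_mulE (a a' : A) (b b' : B) :
  (a ⊗ b) * (a' ⊗ b') = (a * a') ⊗ (b * b').
Proof. exact: tmul_pure. Qed.

End TensorAlgebraStructure.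

Section Augmentation.
Variables (C : fieldType) (A : algType C) (X : set A) (e : A -> C).
Hypotheses (e_lin : scalar e) (e_mul : forall x y, e (x * y) = e x * e y).
Hypotheses (e_one : e 1 = 1) (e_X : forall x, X x -> e x = 0).

Definition aug (q : aquot X) : C := e (repr (q : lquot (ideal_gens X))).

Lemma aug_api u : aug (api X u) = e u.
Proof.
have e0 : e 0 = 0 by have := e_lin (-1) 0 0; rewrite scaler0 addr0 mulN1r addNr.
have : span (ideal_gens X) (repr (api X u : lquot (ideal_gens X)) - u).
  exact: lpi_repr.
have e_span z : span (ideal_gens X) z -> e z = 0.
  elim=> // c _ v [a [x [b [/e_X ex ->]]]] _ IH.
  by rewrite e_lin !e_mul ex IH mulr0 mul0r mulr0 addr0.
move=> /e_span; rewrite -[_ - u]addrC -scaleN1r e_lin mulN1r addrC.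
by move/eqP; rewrite subr_eq0 => /eqP.
Qed.

Lemma aug_lin : scalar aug.
Proof.
by move=> c p q; rewrite -[p]apiK -[q]apiK -apiZ -apiD !aug_api e_lin.
Qed.
Lemma aug_mul p q : aug (p * q) = aug p * aug q.
Proof. by rewrite -[p]apiK -[q]apiK -apiM !aug_api e_mul. Qed.
Lemma aug_one : aug 1 = 1.
Proof. by rewrite -[1]/(api X 1) aug_api. Qed.

Lemma aquot_one_neq0 : (1 : aquot X) != 0.
Proof.
apply/eqP => e10; have := aug_one.
have -> : (1 : aquot X) = 0 by [].
rewrite -[0]/(api X 0) aug_api.
have -> : e 0 = 0 by have := e_lin (-1) 0 0; rewrite scaler0 addr0 mulN1r addNr.
by move/esym/eqP; rewrite oner_eq0.
Qed.

End Augmentation.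

Section TensorAlgebra.
Variables (C : fieldType) (g : lmodType C).

Definition free_alg : Type := {malg C[{fmonom g}]}.
HB.instance Definition _ := GRing.Lalgebra.on free_alg.

Lemma free_scaleAr (c : C) (x y : free_alg) : c *: (x * y) = x * (c *: y).
Proof.
have comm (z : {malg C[{fmonom g}]}) : z * c%:MP = c *: z.
  rewrite malgM_def fgmulgU malgZ_def; apply: eq_bigr => k _.
  by rewrite mulrC mulm1.
have comm' (z : {malg C[{fmonom g}]}) : c%:MP * z = c *: z := mul_malgC c z.
have e (z t : {malg C[{fmonom g}]}) : c *: (z * t) = z * (c *: t).
  by rewrite -comm' mulrA -comm' mulrA comm comm'.
exact: e.
Qed.
HB.instance Definition _ :=
  GRing.Lalgebra_isAlgebra.Build C free_alg free_scaleAr.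

Definition fgen (u : g) : free_alg := << fmu u >>.

Inductive free_lin_rel : free_alg -> Prop :=
| Free_lin_rel c u v :
    free_lin_rel (fgen (c *: u + v) - (c *: fgen u + fgen v)).

(** The tensor algebra is the free algebra on the set [g] in which the
    inclusion of [g] has been made linear. *)
Definition tensor_alg : Type := aquot free_lin_rel.
HB.instance Definition _ := GRing.Lmodule.on tensor_alg.
HB.instance Definition _ := GRing.PzRing.on tensor_alg.

Definition tgen (u : g) : tensor_alg := api free_lin_rel (fgen u).

Definition free_counit (x : free_alg) : C :=
  mcoeff (@mone {fmonom g}) x.

Lemma free_counit_lin : scalar free_counit.
Proof. by move=> c x y; rewrite /free_counit mcoeffD mcoeffZ. Qed.
Lemma free_counitM x y : free_counit (x * y) = free_counit x * free_counit y.
Proof. by case: (@mcoeff1g_is_multiplicative {fmonom g} C) => + _; apply. Qed.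
Lemma free_counit1 : free_counit 1 = 1.
Proof. by rewrite /free_counit mcoeff1 eqxx. Qed.
Lemma free_counit_gen u : free_counit (fgen u) = 0.
Proof.
rewrite /free_counit mcoeffU1; case: eqP => // /(congr1 (@fmonom_val g)).
by rewrite fmuE fm1.
Qed.
Lemma free_counit_rel x : free_lin_rel x -> free_counit x = 0.
Proof.
case=> c u v; rewrite -scaleN1r addrC free_counit_lin free_counit_gen addr0.
by rewrite free_counit_lin !free_counit_gen mulr0 addr0 mulr0.
Qed.

Definition tensor_counit : tensor_alg -> C := @aug C _ free_lin_rel free_counit.

Lemma tensor_counit_lin : scalar tensor_counit.
Proof.
exact: (aug_lin free_counit_lin free_counitM free_counit_rel).
Qed.
Lemma tensor_counitM x y :
  tensor_counit (x * y) = tensor_counit x * tensor_counit y.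
Proof. exact: (aug_mul free_counit_lin free_counitM free_counit_rel). Qed.
Lemma tensor_counit1 : tensor_counit 1 = 1.
Proof.
exact: (aug_one free_counit_lin free_counitM free_counit1 free_counit_rel).
Qed.
Lemma tensor_counit_gen u : tensor_counit (tgen u) = 0.
Proof.
rewrite /tensor_counit /tgen (aug_api free_counit_lin free_counitM free_counit_rel).
exact: free_counit_gen.
Qed.

Lemma tensor_alg_neq0 : (1 : tensor_alg) != 0.
Proof.
exact: (aquot_one_neq0 free_counit_lin free_counitM free_counit1 free_counit_rel).
Qed.

HB.instance Definition _ :=
  GRing.PzSemiRing_isNonZero.Build tensor_alg tensor_alg_neq0.
HB.instance Definition _ := GRing.Lmodule_isLalgebra.Build C tensor_alg
  (@aquot_scaleAl C _ free_lin_rel).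
HB.instance Definition _ := GRing.Lalgebra_isAlgebra.Build C tensor_alg
  (@aquot_scaleAr C _ free_lin_rel).

Lemma tgen_linear : linear tgen.
Proof.
move=> c u v; rewrite /tgen -apiZ -apiD; apply/apiP/span_gen.
exists 1, (fgen (c *: u + v) - (c *: fgen u + fgen v)), 1.
by rewrite mul1r mulr1.
Qed.

End TensorAlgebra.

Section Enveloping.
Variables (C : fieldType) (K : algType C) (g : lmodType C).
Variables (R : K ⊗ K) (act : K -> g -> g) (br : g -> g -> g).

Inductive env_rel : tensor_alg g -> Prop :=
| Env_rel u v :
    env_rel (tgen u * tgen v
             - (\tsum_(r1, r2 <- R) tgen (act r2 v) * tgen (act r1 u))
             - tgen (br u v)).

Definition env : Type := aquot env_rel.
HB.instance Definition _ := GRing.Lmodule.on env.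
HB.instance Definition _ := GRing.PzRing.on env.

Definition egen (u : g) : env := api env_rel (tgen u).

Lemma tensor_counit_rel x : env_rel x -> tensor_counit x = 0.
Proof.
have eD (y z : tensor_alg g) :
    tensor_counit (y + z) = tensor_counit y + tensor_counit z.
  by have := tensor_counit_lin 1 y z; rewrite scale1r mul1r.
have e0 : tensor_counit (0 : tensor_alg g) = 0.
  by apply: (addrI (tensor_counit (0 : tensor_alg g))); rewrite -eD !addr0.
have eB (y z : tensor_alg g) :
    tensor_counit (y - z) = tensor_counit y - tensor_counit z.
  by apply: (addIr (tensor_counit z)); rewrite -eD !subrK.
case=> u v; rewrite !eB tensor_counitM !tensor_counit_gen mulr0 subr0 sub0r.
apply/eqP; rewrite oppr_eq0; apply/eqP; rewrite /tsum.
elim/big_rec: _ => // p y _; rewrite eD => ->.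
by rewrite tensor_counitM !tensor_counit_gen mulr0 addr0.
Qed.

Lemma env_neq0 : (1 : env) != 0.
Proof.
exact: (aquot_one_neq0 (@tensor_counit_lin C g) (@tensor_counitM C g)
  (@tensor_counit1 C g) tensor_counit_rel).
Qed.

HB.instance Definition _ := GRing.PzSemiRing_isNonZero.Build env env_neq0.
HB.instance Definition _ := GRing.Lmodule_isLalgebra.Build C env
  (@aquot_scaleAl C _ env_rel).
HB.instance Definition _ := GRing.Lalgebra_isAlgebra.Build C env
  (@aquot_scaleAr C _ env_rel).

End Enveloping.

Section Generalities.

Definition two_sided_inverse (B : nzRingType) (x y : B) : Prop :=
  x * y = 1 /\ y * x = 1.

Definition invertible (B : nzRingType) (x : B) : Prop :=
  exists y, two_sided_inverse x y.

(** [inv_elt x] and [inv_fun f y] are default values ([0]) unless [x] is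
    invertible, resp. [y] is in the image of [f]. *)
Definition inv_elt (B : nzRingType) (x : B) : B :=
  xget 0 [set y | two_sided_inverse x y]%classic.

Definition inv_fun (V : zmodType) (f : V -> V) (y : V) : V :=
  xget 0 [set x | f x = y]%classic.

Variable C : numClosedFieldType.

Definition antilinear (V W : lmodType C) (f : V -> W) : Prop :=
  forall c u v, f (c *: u + v) = c^* *: f u + f v.

Definition tmap (V V' W W' : lmodType C) (f : V -> V') (h : W -> W')
  (t : V ⊗ W) : V' ⊗ W' := \tsum_(x, y <- t) f x ⊗ h y.

Definition tflip (V W : lmodType C) (t : V ⊗ W) : W ⊗ V :=
  \tsum_(x, y <- t) y ⊗ x.

Definition leg12 (K : algType C) (t : K ⊗ K) := t ⊗ (1 : K).
Definition leg13 (K : algType C) (t : K ⊗ K) :=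
  \tsum_(x, y <- t) (x ⊗ (1 : K)) ⊗ y.
Definition leg23 (K : algType C) (t : K ⊗ K) :=
  \tsum_(x, y <- t) ((1 : K) ⊗ x) ⊗ y.

(** [(f ⊗ id) t] and [(id ⊗ f) t], the latter reassociated to the left. *)
Definition map_left (V W : lmodType C) (f : V -> V ⊗ V) (t : V ⊗ W) :=
  \tsum_(x, y <- t) f x ⊗ y.
Definition map_right (V W : lmodType C) (f : W -> W ⊗ W) (t : V ⊗ W) :=
  \tsum_(x, y <- t) \tsum_(y1, y2 <- f y) (x ⊗ y1) ⊗ y2.

End Generalities.

Record hopf_data (C : numClosedFieldType) (K : algType C) := HopfData {
  comul : K -> K ⊗ K;
  counit : K -> C;
  antipode : K -> K;
  hstar : K -> K;
  Rmat : K ⊗ K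
}.

Section HopfStar.
Variables (C : numClosedFieldType) (K : algType C) (H : hopf_data K).

Local Notation Δ := (comul H).
Local Notation ε := (counit H).
Local Notation S := (antipode H).

Definition Rinv : K ⊗ K := inv_elt (Rmat H).
Definition antipodeV : K -> K := inv_fun S.

Record hopf_algebra : Prop := {
  comul_linear : linear Δ;
  comul_mul : forall k l, Δ (k * l) = Δ k * Δ l;
  comul_one : Δ 1 = 1;
  counit_linear : scalar ε;
  counit_mul : forall k l, ε (k * l) = ε k * ε l;
  counit_one : ε 1 = 1;
  comul_assoc : forall k, map_left Δ (Δ k) = map_right Δ (Δ k);
  comul_counitl : forall k, \tsum_(k1, k2 <- Δ k) ε k1 *: k2 = k;
  comul_counitr : forall k, \tsum_(k1, k2 <- Δ k) ε k2 *: k1 = k;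
  antipode_linear : linear S;
  antipodel : forall k, \tsum_(k1, k2 <- Δ k) S k1 * k2 = ε k *: 1;
  antipoder : forall k, \tsum_(k1, k2 <- Δ k) k1 * S k2 = ε k *: 1
}.

Record star_structure (B : lmodType C) (mul : B -> B -> B) (s : B -> B) :
    Prop := {
  star_antilinear : antilinear s;
  star_involutive : involutive s;
  star_mul : forall x y, s (mul x y) = mul (s y) (s x)
}.

Record triangular_hopf_star_algebra : Prop := {
  is_hopf : hopf_algebra;
  is_star : star_structure *%R (hstar H);
  comul_star : forall k, Δ (hstar H k) = tmap (hstar H) (hstar H) (Δ k);
  Rmat_invertible : invertible (Rmat H);
  Rmat_comul : forall k, tflip (Δ k) = Rmat H * Δ k * Rinv;
  Rmat_hexagonl : map_left Δ (Rmat H) = leg13 (Rmat H) * leg23 (Rmat H);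
  Rmat_hexagonr : map_right Δ (Rmat H) = leg13 (Rmat H) * leg12 (Rmat H);
  Rmat_triangular : Rinv = tflip (Rmat H);
  Rmat_star : tmap (hstar H) (hstar H) (Rmat H) = tflip (Rmat H)
}.

Record is_module (V : lmodType C) (act : K -> V -> V) : Prop := {
  act_linear : forall k, linear (act k);
  act_linearl : forall v, linear (act^~ v);
  act_one : forall v, act 1 v = v;
  act_mul : forall k l v, act (k * l) v = act k (act l v)
}.

Definition star_compatible (V : lmodType C) (act : K -> V -> V) (s : V -> V) :=
  forall k v, s (act k v) = act (antipodeV (hstar H k)) (s v).

(** [module_star_algebra act mul one s]: the algebra [(B, mul, one)], acted
    upon by [act], is a [K]-module [*]-algebra with involution [s]. *)
Record module_star_algebra (B : lmodType C) (act : K -> B -> B)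
    (mul : B -> B -> B) (one : B) (s : B -> B) : Prop := {
  msa_linearl : forall b, linear (mul^~ b);
  msa_linearr : forall a, linear (mul a);
  msa_assoc : associative mul;
  msa_one_l : left_id one mul;
  msa_one_r : right_id one mul;
  msa_module : is_module act;
  msa_act_mul : forall k a b,
    act k (mul a b) = \tsum_(k1, k2 <- Δ k) mul (act k1 a) (act k2 b);
  msa_act_one : forall k, act k one = ε k *: one;
  msa_star : star_structure mul s;
  msa_compat : star_compatible act s
}.

End HopfStar.

Record blie_data (C : numClosedFieldType) (K : algType C) (g : lmodType C) :=
  BLieData {
    lact : K -> g -> g;
    lbr : g -> g -> g;
    lstar : g -> g
  }.

Section BraidedLie.
Variables (C : numClosedFieldType) (K : algType C) (H : hopf_data K).
Variables (g : lmodType C) (d : blie_data K g).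

Record braided_lie_star_algebra : Prop := {
  blie_hopf : triangular_hopf_star_algebra H;
  blie_module : is_module (lact d);
  blie_linearl : forall v, linear ((lbr d)^~ v);
  blie_linearr : forall u, linear (lbr d u);
  blie_equivariant : forall k u v,
    lact d k (lbr d u v)
    = \tsum_(k1, k2 <- comul H k) lbr d (lact d k1 u) (lact d k2 v);
  blie_antisymmetric : forall u v,
    lbr d u v = - \tsum_(r1, r2 <- Rmat H) lbr d (lact d r2 v) (lact d r1 u);
  blie_jacobi : forall u v w,
    lbr d u (lbr d v w)
    = lbr d (lbr d u v) w
      + \tsum_(r1, r2 <- Rmat H) lbr d (lact d r2 v) (lbr d (lact d r1 u) w);
  blie_star_antilinear : antilinear (lstar d);
  blie_star_involutive : involutive (lstar d);
  blie_star_compat : star_compatible H (lact d) (lstar d);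
  blie_star_br : forall u v, lstar d (lbr d u v) = lbr d (lstar d v) (lstar d u)
}.

Definition uenv : Type := env (Rmat H) (lact d) (lbr d).
HB.instance Definition _ := GRing.Algebra.on uenv.

Definition ugen (u : g) : uenv := egen (Rmat H) (lact d) (lbr d) u.

End BraidedLie.

Record braided_lie_star_iso (C : numClosedFieldType) (K : algType C)
    (H : hopf_data K) (g g' : lmodType C) (d : blie_data K g)
    (d' : blie_data K g') (f : g -> g') : Prop := {
  bliso_source : braided_lie_star_algebra H d;
  bliso_target : braided_lie_star_algebra H d';
  bliso_linear : linear f;
  bliso_bijective : bijective f;
  bliso_act : forall k u, f (lact d k u) = lact d' k (f u);
  bliso_br : forall u v, f (lbr d u v) = lbr d' (f u) (f v);
  bliso_star : forall u, f (lstar d u) = lstar d' (f u)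
}.

Record bhopf_data (C : numClosedFieldType) (K L : algType C) := BHopfData {
  bact : K -> L -> L;
  bcomul : L -> L ⊗ L;
  bcounit : L -> C;
  bantipode : L -> L;
  bstar : L -> L
}.

Section BraidedHopf.
Variables (C : numClosedFieldType) (K : algType C) (H : hopf_data K).
Variables (L : algType C) (b : bhopf_data K L).

(** Product and involution of [L ⊠ L], which has the same underlying space as
    [L ⊗ L]. *)
Definition bmul (s t : L ⊗ L) : L ⊗ L :=
  \tsum_(x, y <- s) \tsum_(x', y' <- t) \tsum_(r1, r2 <- Rmat H)
    (x * bact b r2 x') ⊗ (bact b r1 y * y').

Definition bstar2 (t : L ⊗ L) : L ⊗ L :=
  \tsum_(x, y <- t) \tsum_(r1, r2 <- Rmat H)
    bact b r2 (bstar b x) ⊗ bact b r1 (bstar b y).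

Record braided_hopf_star_algebra : Prop := {
  bhopf_hopf : triangular_hopf_star_algebra H;
  bhopf_module_algebra : module_star_algebra H (bact b) *%R 1 (bstar b);
  bcomul_linear : linear (bcomul b);
  bcomul_mul : forall x y, bcomul b (x * y) = bmul (bcomul b x) (bcomul b y);
  bcomul_one : bcomul b 1 = 1 ⊗ 1;
  bcomul_act : forall k x,
    bcomul b (bact b k x)
    = \tsum_(k1, k2 <- comul H k) tmap (bact b k1) (bact b k2) (bcomul b x);
  bcounit_linear : scalar (bcounit b);
  bcounit_mul : forall x y, bcounit b (x * y) = bcounit b x * bcounit b y;
  bcounit_one : bcounit b 1 = 1;
  bcounit_act : forall k x, bcounit b (bact b k x) = counit H k * bcounit b x;
  bcomul_assoc : forall x,
    map_left (bcomul b) (bcomul b x) = map_right (bcomul b) (bcomul b x);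
  bcomul_counitl : forall x,
    \tsum_(x1, x2 <- bcomul b x) bcounit b x1 *: x2 = x;
  bcomul_counitr : forall x,
    \tsum_(x1, x2 <- bcomul b x) bcounit b x2 *: x1 = x;
  bantipode_linear : linear (bantipode b);
  bantipode_act : forall k x, bantipode b (bact b k x) = bact b k (bantipode b x);
  bantipodel : forall x,
    \tsum_(x1, x2 <- bcomul b x) bantipode b x1 * x2 = bcounit b x *: 1;
  bantipoder : forall x,
    \tsum_(x1, x2 <- bcomul b x) x1 * bantipode b x2 = bcounit b x *: 1;
  bcomul_star : forall x, bcomul b (bstar b x) = bstar2 (bcomul b x)
}.

End BraidedHopf.

Record braided_hopf_star_iso (C : numClosedFieldType) (K : algType C)
    (H : hopf_data K) (L L' : algType C) (b : bhopf_data K L)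
    (b' : bhopf_data K L') (f : L -> L') : Prop := {
  bhiso_source : braided_hopf_star_algebra H b;
  bhiso_target : braided_hopf_star_algebra H b';
  bhiso_linear : linear f;
  bhiso_mul : forall x y, f (x * y) = f x * f y;
  bhiso_one : f 1 = 1;
  bhiso_bijective : bijective f;
  bhiso_act : forall k x, f (bact b k x) = bact b' k (f x);
  bhiso_comul : forall x, bcomul b' (f x) = tmap f f (bcomul b x);
  bhiso_counit : forall x, bcounit b' (f x) = bcounit b x;
  bhiso_antipode : forall x, f (bantipode b x) = bantipode b' (f x);
  bhiso_star : forall x, f (bstar b x) = bstar b' (f x)
}.

(** [b] is the structure of [U(g)]: on generators the action and the involution
    are those of [g], and the coproduct is [u ⊠ 1 + 1 ⊠ u].  A braided Hopf
    [*]-algebra structure on [U(g)] is determined by these values. *)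
Record uenv_structure (C : numClosedFieldType) (K : algType C)
    (H : hopf_data K) (g : lmodType C) (d : blie_data K g)
    (b : bhopf_data K (uenv H d)) : Prop := {
  uenv_act : forall k u, bact b k (ugen H d u) = ugen H d (lact d k u);
  uenv_comul : forall u,
    bcomul b (ugen H d u) = ugen H d u ⊗ 1 + 1 ⊗ ugen H d u;
  uenv_star : forall u, bstar b (ugen H d u) = ugen H d (lstar d u)
}.

Section Derivations.
Variables (C : numClosedFieldType) (K : algType C) (H : hopf_data K).
Variables (A : lmodType C).

Definition hom_act (act : K -> A -> A) (k : K) (psi : A -> A) (a : A) : A :=
  \tsum_(k1, k2 <- comul H k) act k1 (psi (act (antipode H k2) a)).

Definition braided_derivation (act : K -> A -> A) (mul : A -> A -> A)
    (psi : A -> A) : Prop :=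
  linear psi /\
  forall a a', psi (mul a a')
    = mul (psi a) a'
      + \tsum_(r1, r2 <- Rmat H) mul (act r2 a) (hom_act act r1 psi a').

Variables (act : K -> {linear A -> A}) (mul : {bilinear A -> A -> A}).

Definition der_pred : {pred A -> A} :=
  fun psi => `[< braided_derivation act mul psi >].

Lemma hom_act_lin k c (f h : A -> A) a :
  hom_act act k (c *: f + h) a = c *: hom_act act k f a + hom_act act k h a.
Proof.
by rewrite /hom_act -tsum_lin; apply: eq_tsum => k1 k2; rewrite -linearP.
Qed.

Lemma hom_act0 k a : hom_act act k (fun=> 0) a = 0.
Proof. by rewrite /hom_act /tsum big1 // => p _; rewrite linear0. Qed.

Lemma der_subsemimod_closed : GRing.subsemimod_closed der_pred.
Proof.
apply: GRing.submod_closed_semi; split.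
  apply/asboolP; split=> [c u v|a a']; first by rewrite scaler0 addr0.
  rewrite linear0l add0r /tsum big1 // => p _.
  by rewrite (_ : hom_act _ _ _ _ = 0) ?linear0r //; apply: hom_act0.
move=> c f h /asboolP [flin fder] /asboolP [hlin hder].
apply/asboolP; split=> [d u v|a a'].
  rewrite -[LHS]/(c *: f (d *: u + v) + h (d *: u + v)) flin hlin.
  by rewrite !scalerDr !scalerA [c * d]mulrC addrACA.
rewrite -[LHS]/(c *: f (mul a a') + h (mul a a')) fder hder.
rewrite -[(c *: f + h) a]/(c *: f a + h a) linearPl scalerDr addrACA -tsum_lin.
congr (_ + _); apply: eq_tsum => r1 r2.
by rewrite hom_act_lin linearPr.
Qed.

Record Der : Type := MkDer { der_fun :> A -> A; _ : der_fun \in der_pred }.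
HB.instance Definition _ := [isSub for der_fun].
HB.instance Definition _ := [Choice of Der by <:].
HB.instance Definition _ :=
  GRing.SubChoice_isSubLmodule.Build C (A -> A) der_pred Der
    der_subsemimod_closed.

(** [d] is the structure of [Der(A)], for [A] with product [mul], action [act]
    and involution [s]. *)
Record der_structure (s : A -> A) (d : blie_data K Der) : Prop := {
  der_act : forall k psi a, lact d k psi a = hom_act act k psi a;
  der_br : forall psi lam a,
    lbr d psi lam a
    = psi (lam a)
      - \tsum_(r1, r2 <- Rmat H) hom_act act r2 lam (hom_act act r1 psi a);
  der_star : forall psi a,
    lstar d psi a
    = - s (\tsum_(r1, r2 <- Rinv H) hom_act act r1 psi (act r2 (s a)))
}.

End Derivations.

Section Twist.
Variables (C : numClosedFieldType) (K : algType C) (H : hopf_data K).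
Variable F : K ⊗ K.

Record is_twist : Prop := {
  twist_invertible : invertible F;
  twist_counitl : \tsum_(f1, f2 <- F) counit H f1 *: f2 = 1;
  twist_counitr : \tsum_(f1, f2 <- F) counit H f2 *: f1 = 1;
  twist_cocycle : leg12 F * map_left (comul H) F = leg23 F * map_right (comul H) F;
  twist_star : tmap (hstar H) (hstar H) F
    = tmap (antipode H) (antipode H) (tflip F)
}.

Definition Finv : K ⊗ K := inv_elt F.

Definition twist_u : K := \tsum_(f1, f2 <- F) f1 * antipode H f2.

Definition twist_hopf : hopf_data K := {|
  comul := fun k => F * comul H k * Finv;
  counit := counit H;
  antipode := fun k => twist_u * antipode H k * inv_elt twist_u;
  hstar := fun k => twist_u * hstar H k * inv_elt twist_u;
  Rmat := tflip F * Rmat H * Finv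
|}.

Section TwistMul.
Variables (A : lmodType C) (act : K -> {linear A -> A}).
Variable mul : {bilinear A -> A -> A}.

Definition twist_mul (a a' : A) : A :=
  \tsum_(f1, f2 <- Finv) mul (act f1 a) (act f2 a').

Lemma twist_mul_bilinear : bilinear_for *:%R *:%R twist_mul.
Proof.
split=> x c u v; rewrite -[RHS]tsum_lin; apply: eq_tsum => f1 f2.
  by rewrite linearP linearPl.
by rewrite linearP linearPr.
Qed.
HB.instance Definition _ :=
  bilinear_isBilinear.Build C A A A *:%R *:%R twist_mul twist_mul_bilinear.

End TwistMul.

Definition twist_blie (g : lmodType C) (d : blie_data K g) : blie_data K g := {|
  lact := lact d;
  lbr := fun u v => \tsum_(f1, f2 <- Finv) lbr d (lact d f1 u) (lact d f2 v);
  lstar := lstar d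
|}.

End Twist.

(* Main.v *)
(** The map [s = * ∘ S] is an antilinear, multiplicative involution of [K] with
    [Δ ∘ s = (s ⊗ s) ∘ flip ∘ Δ], and since [*_F = S_F ∘ s] the twisted Hopf algebra has
    the same [s]; the conditions on [F] and [R] become [(s ⊗ s) F = F_21] and
    [(s ⊗ s) R = R_21].

    Let [D_G ψ = (G^α ▷ ψ) ∘ (G_α ▷ _)] on the endomorphisms of [A]. The cocycle
    identity for [G] makes [D_G] multiplicative up to [G]. For [G = F^{-1}] this is
    the map of the theorem, hence it respects the brackets, and for [G = R_21] it
    gives [ψ^* = - (D_G ψ)^†] with [f^† = * ∘ f ∘ *]. Compatibility of the two
    involutions reduces to [R_F = F_21 R F^{-1}] together with [(s ⊗ s) F = F_21].

    The braided Lie algebra [Der(A)_F] is obtained by transport along the bijection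
    onto [Der(A_F)]. All structure maps of [U(g)] come from its universal
    property, are determined by a recursion on [u x] with [u] in [g], and are
    compared by induction along that recursion. *)
Require Import Defs.
From HB Require Import structures.
From mathcomp Require Import all_boot all_order all_algebra.
From mathcomp Require Import finmap boolp classical_sets functions reals.
From mathcomp Require Import complex monalg.

Set Implicit Arguments.
Unset Strict Implicit.
Unset Printing Implicit Defensive.

Import GRing.Theory Num.Theory.

Local Open Scope quotient_scope.
Local Open Scope ring_scope.

(** * Linear maps and sums over tensors *)

(** [tsum] evaluates a function on a chosen representative of a tensor and is well behaved only for
    balanced functions. Tensor identities are therefore used in tested form, against an arbitrary
    bilinear or trilinear [f]; each use owes a linearity proof, found by the tactic [lin], and
    antilinear maps have to be applied to both legs at once.

    The actions on endomorphisms are not compared through their formula with the antipode. With ρ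
    the representation of [K] on [A], the action is determined by the relation ρ(k) ψ = (k1 ▷ ψ)
    ρ(k2), which passes through a twist by moving [G] across a coproduct. In the same spirit ψ is a
    derivation when [ψ, ℓ_a] = ℓ_{ψ(a)} for the left multiplications ℓ_a: closure under brackets
    becomes the Jacobi identity, and derivations of [A] and of its twist correspond because D sends
    ℓ_a to the twisted left multiplication.

    The conditions on [R] and those on the involution are kept in two records, [triangular_Rmat] and
    [conj_structure], so that the twist can be treated on each and the twisted involution rebuilt at
    the end. *)

Section Linear.
Variables (C : fieldType).
Implicit Types (U V W X : lmodType C) (B : algType C).

(** Linearity is kept as a predicate on bare functions, because almost every function summed over is
    an anonymous abstraction with no bundled structure. *)
Definition bilin V W U (f : V -> W -> U) : Prop :=
  (forall w, linear (fun v => f v w)) /\ (forall v, linear (fun w => f v w)).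

Definition trilin V W X U (f : V -> W -> X -> U) : Prop :=
  [/\ forall w x, linear (fun v => f v w x), forall v x, linear (fun w => f v w x)
    & forall v w, linear (fun x => f v w x)].

Lemma trilin1 V W X U (f : V -> W -> X -> U) : trilin f ->
  forall w x, linear (fun v => f v w x).
Proof. by case. Qed.
Lemma trilin2 V W X U (f : V -> W -> X -> U) : trilin f ->
  forall v x, linear (fun w => f v w x).
Proof. by case. Qed.
Lemma trilin3 V W X U (f : V -> W -> X -> U) : trilin f ->
  forall v w, linear (fun x => f v w x).
Proof. by case. Qed.

Lemma lin_id V : linear (fun v : V => v). Proof. by []. Qed.

Lemma lin_zero V U : linear (fun v : V => 0 : U).
Proof. by move=> c u v; rewrite scaler0 addr0. Qed.

Lemma lin_comp V W U (h : W -> U) (g : V -> W) :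
  linear h -> linear g -> linear (fun v => h (g v)).
Proof. by move=> hl gl c u v; rewrite gl hl. Qed.

Lemma lin_add V U (f g : V -> U) :
  linear f -> linear g -> linear (fun v => f v + g v).
Proof. by move=> fl gl c u v; rewrite fl gl scalerDr addrACA. Qed.

Lemma lin_opp V U (f : V -> U) : linear f -> linear (fun v => - f v).
Proof. by move=> fl c u v; rewrite fl opprD scalerN. Qed.

Lemma lin_scale V U a (f : V -> U) : linear f -> linear (fun v => a *: f v).
Proof. by move=> fl c u v; rewrite fl scalerDr !scalerA mulrC. Qed.

Lemma lin_scalar V U (e : V -> C) (u : U) :
  scalar e -> linear (fun v => e v *: u).
Proof. by move=> el c v w; rewrite el scalerDl scalerA. Qed.

Lemma lin_mull V B (f : V -> B) b : linear f -> linear (fun v => f v * b).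
Proof. by move=> fl c u v; rewrite fl mulrDl scalerAl. Qed.

Lemma lin_mulr V B (f : V -> B) b : linear f -> linear (fun v => b * f v).
Proof. by move=> fl c u v; rewrite fl mulrDr scalerAr. Qed.

Lemma lin_tpurel V W U (f : V -> W) (w : U) :
  linear f -> linear (fun v => f v ⊗ w).
Proof. by move=> fl c u v; rewrite fl tpure_linl. Qed.

Lemma lin_tpurer V W U (f : V -> W) (w : U) :
  linear f -> linear (fun v => w ⊗ f v).
Proof. by move=> fl c u v; rewrite fl tpure_linr. Qed.

Lemma lin_tsum V W X U (f : V -> W -> X -> U) t :
  (forall w x, linear (fun v => f v w x)) -> linear (fun v => tsum (f v) t).
Proof. by move=> fl c u v; rewrite -tsum_lin; apply: eq_tsum => w x; apply: fl. Qed.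

Lemma lin_tsum_arg V W X U (f : W -> X -> U) (g : V -> W ⊗ X) :
  bilin f -> linear g -> linear (fun v => tsum f (g v)).
Proof. by case=> fl fr gl; apply: (lin_comp _ gl); apply: tsum_linear. Qed.

Lemma linD V U (f : V -> U) : linear f -> forall u v, f (u + v) = f u + f v.
Proof. by case/linE. Qed.
Lemma lin0 V U (f : V -> U) : linear f -> f 0 = 0.
Proof. by case/linE. Qed.
Lemma linZ V U (f : V -> U) : linear f -> forall c u, f (c *: u) = c *: f u.
Proof. by case/linE. Qed.
Lemma linN V U (f : V -> U) : linear f -> forall u, f (- u) = - f u.
Proof. by move=> fl u; rewrite -scaleN1r (linZ fl) scaleN1r. Qed.
Lemma linB V U (f : V -> U) : linear f -> forall u v, f (u - v) = f u - f v.
Proof. by move=> fl u v; rewrite (linD fl) (linN fl). Qed.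

Lemma lin_sum V W X U (h : U -> V) (f : W -> X -> U) t : linear h ->
  h (tsum f t) = tsum (fun x y => h (f x y)) t.
Proof.
move=> hl; rewrite /tsum; elim: (msupp _ : seq _) => [|p s IH].
  by rewrite !big_nil lin0.
by rewrite !big_cons linD // IH.
Qed.

Lemma tsumE V W U (f : V -> W -> U) v w : bilin f -> tsum f (v ⊗ w) = f v w.
Proof. by case=> fl fr; rewrite tsum_pure //; apply: lin_balanced. Qed.

Lemma bilin_linear V W U (f : V -> W -> U) : bilin f -> linear (tsum f).
Proof. by case=> fl fr; apply: tsum_linear. Qed.

(** Valid for any [f]: both sides are finite sums over the chosen representatives. *)
Lemma exchange_tsum V W V' W' (U : zmodType) (f : V -> W -> V' -> W' -> U) s t :
  \tsum_(x, y <- s) \tsum_(x', y' <- t) f x y x' y'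
  = \tsum_(x', y' <- t) \tsum_(x, y <- s) f x y x' y'.
Proof. exact: exchange_big. Qed.

Lemma tsum_opp V W (U : zmodType) (f : V -> W -> U) t :
  \tsum_(x, y <- t) (- f x y) = - \tsum_(x, y <- t) f x y.
Proof. by rewrite /tsum sumrN. Qed.

Lemma tsum_sub V W (U : zmodType) (f g : V -> W -> U) t :
  \tsum_(x, y <- t) (f x y - g x y) = tsum f t - tsum g t.
Proof. by rewrite tsum_addf tsum_opp. Qed.

Lemma tensor_lin_ext V W U (f g : V ⊗ W -> U) : linear f -> linear g ->
  (forall v w, f (v ⊗ w) = g (v ⊗ w)) -> forall t, f t = g t.
Proof.
move=> fl gl fg; elim/tensor_ind => // s t IHs IHt.
by rewrite (linD fl) (linD gl) IHs IHt.
Qed.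

Lemma tsum_tpure V W (t : V ⊗ W) : \tsum_(x, y <- t) x ⊗ y = t.
Proof.
have bl : bilin (fun (x : V) (y : W) => x ⊗ y).
  by split=> ?; [apply: tpure_linl | apply: tpure_linr].
apply: (tensor_lin_ext (bilin_linear bl)); first exact: lin_id.
by move=> v w; rewrite tsumE.
Qed.

End Linear.

(* Automated proofs of linearity *)
Create HintDb lin discriminated.

(** Leaf cases. [constr_eq] compares heads syntactically, so that a hypothesis about one function is
    not matched with another by unfolding. *)
Ltac lin_known :=
  cbv beta;
  match goal with
  | H : GRing.linear_for _ ?f |- GRing.linear_for _ ?g => constr_eq f g; exact H
  | H : bilin ?f |- GRing.linear_for _ (fun x => ?g x _) =>
      constr_eq f g; exact (proj1 H _)
  | H : bilin ?f |- GRing.linear_for _ (fun x => ?g _ x) =>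
      constr_eq f g; exact (proj2 H _)
  | H : bilin ?f |- GRing.linear_for _ (?g _) => constr_eq f g; exact (proj2 H _)
  | H : trilin ?f |- GRing.linear_for _ (fun x => ?g x _ _) =>
      constr_eq f g; exact (trilin1 H _ _)
  | H : trilin ?f |- GRing.linear_for _ (fun x => ?g _ x _) =>
      constr_eq f g; exact (trilin2 H _ _)
  | H : trilin ?f |- GRing.linear_for _ (fun x => ?g _ _ x) =>
      constr_eq f g; exact (trilin3 H _ _)
  | H : trilin ?f |- GRing.linear_for _ (?g _ _) =>
      constr_eq f g; exact (trilin3 H _ _)
  | |- _ => solve [ eauto with lin nocore ]
  | H : forall _, GRing.linear_for _ _ |- _ => exact (H _)
  | H : forall _ _, GRing.linear_for _ _ |- _ => exact (H _ _)
  end.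

(* In a pattern such as [fun x => ?a + ?b] Ltac may bind [?b] to a term
   mentioning [x]; [closed] rejects such bindings. *)
Ltac closed t := let T := type of t in idtac.

Ltac lin_hyp :=
  match goal with
  | H : bilin ?f |- bilin ?g => constr_eq f g; exact H
  | H : trilin ?f |- trilin ?g => constr_eq f g; exact H
  end.

(** Placeholders, redefined with [::=] once linearity of the product of [B ⊗ B'] is proved. *)
Ltac lin_tmull f b := fail.
Ltac lin_tmulr g a := fail.

(** Recursion on the body of the function. In a product, a pure tensor, a scaling or a [tsum] the
    bound variable may occur in one argument only; [closed] tells which. *)
Ltac lin :=
  cbv beta;
  lazymatch goal with
  | |- bilin _ => first [ lin_hyp | split; intros ?; lin ]
  | |- trilin _ => first [ lin_hyp | split; intros ? ?; lin ]
  | |- GRing.linear_for _ (fun x => _) => lin_go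
  | |- GRing.linear_for ?s ?f =>
      first [ lin_known | change (GRing.linear_for s (fun x => f x)); lin_go ]
  | |- forall _, _ => intros ?; lin
  end
with lin_go :=
  lazymatch goal with
  | |- GRing.linear_for _ (fun x => x) => exact: lin_id
  | |- GRing.linear_for _ (fun x => 0) => exact: lin_zero
  | |- GRing.linear_for _ (fun x => @GRing.add _ (@?f x) (@?g x)) =>
      apply (@lin_add _ _ _ f g); lin
  | |- GRing.linear_for _ (fun x => @GRing.opp _ (@?f x)) =>
      apply (@lin_opp _ _ _ f); lin
  | |- GRing.linear_for _ (fun x => @GRing.mul _ (@?f x) (@?g x)) =>
      lazymatch goal with
      | |- GRing.linear_for _ (fun x => @GRing.mul _ ?a ?b) =>
        tryif closed b then (first [ lin_tmull f b | apply (@lin_mull _ _ _ f b) ]; lin)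
        else (first [ lin_tmulr g a | apply (@lin_mulr _ _ _ g a) ]; lin)
      end
  | |- GRing.linear_for _ (fun x => @tpure _ _ _ (@?f x) (@?g x)) =>
      lazymatch goal with
      | |- GRing.linear_for _ (fun x => @tpure _ _ _ ?a ?b) =>
        tryif closed b then (apply (@lin_tpurel _ _ _ _ f b); lin)
        else (apply (@lin_tpurer _ _ _ _ g a); lin)
      end
  | |- GRing.linear_for _ (fun x => @GRing.scale _ _ (@?f x) (@?g x)) =>
      lazymatch goal with
      | |- GRing.linear_for _ (fun x => @GRing.scale _ _ ?a ?b) =>
        tryif closed b then
          lazymatch goal with
          | |- GRing.linear_for _ (fun x => @GRing.scale _ _ (?e (@?h x)) _) =>
              apply (@lin_comp _ _ _ _ (fun k => e k *: b) h);
              [ apply: lin_scalar; lin_known | lin ]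
          end
        else (apply (@lin_scale _ _ _ a g); lin)
      end
  | |- GRing.linear_for _ (fun x => @tsum _ _ _ _ (@?f x) (@?g x)) =>
      lazymatch goal with
      | |- GRing.linear_for _ (fun x => @tsum _ _ _ _ ?a ?b) =>
        tryif closed b then (apply (@lin_tsum _ _ _ _ _ f b); lin)
        else (apply (@lin_tsum_arg _ _ _ _ _ a g); lin)
      end
  | |- _ => lin_app
  end
with lin_app :=
  match goal with
  | |- GRing.linear_for ?s (fun x => ?h x) =>
      closed h; change (GRing.linear_for s h); lin_known
  | |- GRing.linear_for _ (fun x => ?h x ?v) => closed h; closed v; lin_known
  | |- GRing.linear_for _ (fun x => ?h x ?v ?w) =>
      closed h; closed v; closed w; lin_known
  | |- GRing.linear_for _ (fun x => ?h (@?g x)) =>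
      closed h; apply (@lin_comp _ _ _ _ h g); [ lin_known | lin ]
  | |- GRing.linear_for _ (fun x => ?h (@?g x) ?v) =>
      closed h; closed v;
      apply (@lin_comp _ _ _ _ (fun y => h y v) g); [ lin_known | lin ]
  | |- GRing.linear_for _ (fun x => ?h (@?g x) ?v ?w) =>
      closed h; closed v; closed w;
      apply (@lin_comp _ _ _ _ (fun y => h y v w) g); [ lin_known | lin ]
  end.

Section Tensors.
Variables (C : fieldType).
Implicit Types (U V W X : lmodType C) (B K : algType C).

Lemma tsum_tsum V W V' W' U (f : V -> W -> U) (g : V' -> W' -> V ⊗ W) t :
  bilin f ->
  tsum f (\tsum_(x, y <- t) g x y) = \tsum_(x, y <- t) tsum f (g x y).
Proof. by move=> fl; apply: lin_sum; apply: bilin_linear. Qed.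

Lemma tmul_bilin B B' : bilin (@tmul C B B').
Proof. by rewrite /tmul; lin. Qed.

Lemma tmulE B B' (s t : B ⊗ B') : s * t = tmul s t. Proof. by []. Qed.

Lemma lin_tmull V B B' (f : V -> B ⊗ B') t : linear f -> linear (fun v => f v * t).
Proof.
move=> fl c u v; rewrite !tmulE fl (linD (proj1 (tmul_bilin _ _) _)).
by rewrite (linZ (proj1 (tmul_bilin _ _) _)).
Qed.

Lemma lin_tmulr V B B' (f : V -> B ⊗ B') t : linear f -> linear (fun v => t * f v).
Proof.
move=> fl c u v; rewrite !tmulE fl (linD (proj2 (tmul_bilin _ _) _)).
by rewrite (linZ (proj2 (tmul_bilin _ _) _)).
Qed.

Lemma tsum_mul B B' U (f : B -> B' -> U) s t : bilin f ->
  tsum f (s * t)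
  = \tsum_(x, y <- s) \tsum_(x', y' <- t) f (x * x') (y * y').
Proof.
move=> [fl fr]; have fb : bilin f by split.
rewrite -[s in LHS]tsum_tpure -[t in LHS]tsum_tpure.
rewrite (lin_sum (h := fun s => s * _)); last by lin.
rewrite tsum_tsum //; apply: eq_tsum => x y.
rewrite (lin_sum (h := fun t => _ * t)); last by lin.
rewrite tsum_tsum //; apply: eq_tsum => x' y'.
by rewrite tensor_mulE tsumE.
Qed.

Lemma tsum_one B B' U (f : B -> B' -> U) : bilin f -> tsum f 1 = f 1 1.
Proof. by move=> fb; rewrite tensor_oneE tsumE. Qed.

End Tensors.

Ltac lin_tmull f b ::= apply (@lin_tmull _ _ _ _ f b).
Ltac lin_tmulr g a ::= apply (@lin_tmulr _ _ _ _ g a).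

#[global] Hint Extern 1 (GRing.linear_for _ (comul _)) => refine (comul_linear _) : lin.
#[global] Hint Extern 1 (GRing.linear_for _ (antipode _)) => refine (antipode_linear _) : lin.
#[global] Hint Extern 1 (GRing.linear_for _ (counit _)) => refine (counit_linear _) : lin.

(** * Sweedler calculus and the antipode *)

Section SweedlerHopf.
Variables (C : numClosedFieldType) (K : algType C) (H : hopf_data K).
Hypothesis hH : hopf_algebra H.
Implicit Types (U : lmodType C) (B : algType C).

Local Notation Δ := (comul H).
Local Notation ε := (counit H).
Local Notation S := (antipode H).

Lemma coassocE U (f : K -> K -> K -> U) k : trilin f ->
  \tsum_(x, z <- Δ k) \tsum_(a, b <- Δ x) f a b z
  = \tsum_(x, z <- Δ k) \tsum_(a, b <- Δ z) f x a b.
Proof.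
move=> fl; pose g s z := \tsum_(x, y <- s) f x y z.
have gb : bilin g by rewrite /g; lin.
transitivity (tsum g (map_left Δ (Δ k))).
  by rewrite (tsum_tsum _ _ gb); apply: eq_tsum => x z; rewrite (tsumE _ _ gb).
rewrite (comul_assoc hH) (tsum_tsum _ _ gb); apply: eq_tsum => x z.
rewrite (tsum_tsum _ _ gb); apply: eq_tsum => a b.
by rewrite (tsumE _ _ gb) /g tsumE //; lin.
Qed.

Lemma counitlE U (f : K -> U) k : linear f ->
  \tsum_(x, y <- Δ k) ε x *: f y = f k.
Proof.
move=> fl; rewrite -[in RHS](comul_counitl hH k) (lin_sum _ _ fl).
by apply: eq_tsum => x y; rewrite (linZ fl).
Qed.

Lemma counitrE U (f : K -> U) k : linear f ->
  \tsum_(x, y <- Δ k) ε y *: f x = f k.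
Proof.
move=> fl; rewrite -[in RHS](comul_counitr hH k) (lin_sum _ _ fl).
by apply: eq_tsum => x y; rewrite (linZ fl).
Qed.

Lemma antipodelE U (f : K -> U) k : linear f ->
  \tsum_(x, y <- Δ k) f (S x * y) = ε k *: f 1.
Proof. by move=> fl; rewrite -(lin_sum _ _ fl) (antipodel hH) (linZ fl). Qed.

Lemma antipoderE U (f : K -> U) k : linear f ->
  \tsum_(x, y <- Δ k) f (x * S y) = ε k *: f 1.
Proof. by move=> fl; rewrite -(lin_sum _ _ fl) (antipoder hH) (linZ fl). Qed.

Lemma comulME U (f : K -> K -> U) k l : bilin f ->
  \tsum_(x, y <- Δ (k * l)) f x y
  = \tsum_(x, y <- Δ k) \tsum_(x', y' <- Δ l) f (x * x') (y * y').
Proof. by move=> fb; rewrite (comul_mul hH) tsum_mul. Qed.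

Lemma comul1E U (f : K -> K -> U) : bilin f -> \tsum_(x, y <- Δ 1) f x y = f 1 1.
Proof. by move=> fb; rewrite (comul_one hH) tsum_one. Qed.

Lemma antipode1 : S 1 = 1.
Proof.
have := antipodel hH 1; rewrite comul1E; last by lin.
by rewrite mulr1 (counit_one hH) scale1r.
Qed.

(** For the convolution product of maps from [K], [f = f * (g * h) = (f * g) * h = h]. *)
Lemma convolution_inverse_uniq U (mul : U -> U -> U) (one : U) (f g h : K -> U) :
  bilin mul -> associative mul -> left_id one mul -> right_id one mul ->
  linear f -> linear g -> linear h ->
  (forall k, \tsum_(x, y <- Δ k) mul (f x) (g y) = ε k *: one) ->
  (forall k, \tsum_(x, y <- Δ k) mul (g x) (h y) = ε k *: one) -> f =1 h.
Proof.
move=> mb mA m1l m1r fl gl hl fg gh k.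
have [ml mr] := mb.
rewrite -(counitrE k fl) -[RHS](counitlE k hl).
transitivity (\tsum_(x, y <- Δ k) \tsum_(a, b <- Δ y) mul (mul (f x) (g a)) (h b)).
  apply: eq_tsum => x y; transitivity (mul (f x) (ε y *: one)).
    by rewrite (linZ (mr _)) m1r.
  rewrite -gh (lin_sum _ _ (mr _)).
  by apply: eq_tsum => a b; rewrite mA.
rewrite -(coassocE (f := fun x a b => mul (mul (f x) (g a)) (h b))); last by lin.
apply: eq_tsum => x y; transitivity (mul (ε x *: one) (h y)).
  by rewrite -fg (lin_sum _ _ (ml _)).
by rewrite (linZ (ml _)) m1l.
Qed.

(** Write [S(k l)] as [S(k1 l) k2 S(k3)]; by [aux] the factor [S(k1 l) k2] is [ε(k1) S(l)]. *)
Lemma antipodeM k l : S (k * l) = S l * S k.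
Proof.
(* Expanding [ε(n2)] as [n2 S(n3)] makes the left part a contraction [S(z1) z2] over the coproduct
   of the product [z = m n1]. *)
have aux m n : \tsum_(x, y <- Δ m) S (x * n) * y = ε m *: S n.
  transitivity (\tsum_(a, b <- Δ n) \tsum_(x, y <- Δ m)
                 \tsum_(b1, b2 <- Δ b) S (x * a) * (y * b1) * S b2).
    transitivity (\tsum_(a, b <- Δ n) \tsum_(x, y <- Δ m)
                    ε b *: (S (x * a) * y)).
      rewrite exchange_tsum; apply: eq_tsum => x y.
      by rewrite (counitrE (f := fun a => S (x * a) * y)) //; lin.
    apply: eq_tsum => a b; apply: eq_tsum => x y.
    transitivity (S (x * a) * y * (ε b *: 1)).
      by rewrite -scalerAr mulr1.
    rewrite -(antipoder hH) (lin_sum (h := fun z => _ * z)); last by lin.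
    by apply: eq_tsum => b1 b2; rewrite !mulrA.
  under eq_tsum => a b do rewrite exchange_tsum.
  rewrite -(coassocE (f := fun a b1 b2 =>
      \tsum_(x, y <- Δ m) S (x * a) * (y * b1) * S b2)); last by lin.
  rewrite -(counitlE n (antipode_linear hH)).
  rewrite (lin_sum (h := fun z => ε m *: z)); last by lin.
  apply: eq_tsum => a b; rewrite exchange_tsum scalerA -(counit_mul hH).
  transitivity ((ε (m * a) *: 1) * S b); last by rewrite -scalerAl mul1r.
  rewrite -(antipodel hH) comulME; last by lin.
  rewrite (lin_sum (h := fun z => z * S b)); last by lin.
  apply: eq_tsum => x y; rewrite (lin_sum (h := fun z => z * S b)) //; lin.
transitivity (\tsum_(x, y <- Δ k) \tsum_(a, b <- Δ y) S (x * l) * a * S b).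
  rewrite -(counitrE (f := fun k => S (k * l))); last by lin.
  apply: eq_tsum => x y; transitivity (S (x * l) * (ε y *: 1)).
    by rewrite -scalerAr mulr1.
  rewrite -(antipoder hH) (lin_sum (h := fun z => _ * z)); last by lin.
  by apply: eq_tsum => a b; rewrite mulrA.
rewrite -(coassocE (f := fun x a b => S (x * l) * a * S b)); last by lin.
transitivity (\tsum_(x, y <- Δ k) ε x *: (S l * S y)).
  apply: eq_tsum => x y; rewrite scalerAl -aux.
  by rewrite (lin_sum (h := fun z => z * S y)) //; lin.
by rewrite (counitlE (f := fun k => S l * S k)) //; lin.
Qed.

(** One side is a left and the other a right convolution inverse of [Δ], among maps from [K] to
    [K ⊗ K]. *)
Lemma antipode_comul k : Δ (S k) = \tsum_(x, y <- Δ k) S y ⊗ S x.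
Proof.
apply: (@convolution_inverse_uniq _ (@tmul C K K) 1 (fun k => Δ (S k)) Δ
          (fun k => \tsum_(x, y <- Δ k) S y ⊗ S x)) => {k}; try by lin.
- exact: tmul_bilin.
- exact: mulrA.
- exact: mul1r.
- exact: mulr1.
- move=> k; rewrite -(comul_one hH) -(linZ (comul_linear hH)) -(antipodel hH).
  rewrite (lin_sum _ _ (comul_linear hH)).
  by apply: eq_tsum => x y; rewrite (comul_mul hH).
move=> k.
transitivity (\tsum_(x, y <- Δ k) \tsum_(a, b <- Δ y) \tsum_(c, d <- Δ x)
    ((c * S b) ⊗ (d * S a))).
  apply: eq_tsum => x y; rewrite (lin_sum _ _ (proj2 (tmul_bilin _ _) _)).
  apply: eq_tsum => a b; rewrite -[Δ x in LHS]tsum_tpure.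
  rewrite (lin_sum _ _ (proj1 (tmul_bilin _ _) _)).
  by apply: eq_tsum => c d; rewrite tmul_pure.
rewrite -(coassocE (f := fun x a b => \tsum_(c, d <- Δ x)
    ((c * S b) ⊗ (d * S a)))); last by lin.
transitivity (\tsum_(x, y <- Δ k) ((x * S y) ⊗ (1 : K))).
  apply: eq_tsum => x y.
  rewrite (coassocE (f := fun c d a => ((c * S y) ⊗ (d * S a)))); last by lin.
  transitivity (\tsum_(c, d <- Δ x) ε d *: ((c * S y) ⊗ (1 : K))).
    apply: eq_tsum => c d.
    by rewrite (antipoderE (f := fun z => (c * S y) ⊗ z)) //; lin.
  by rewrite (counitrE (f := fun c => (c * S y) ⊗ (1 : K))) //; lin.
by rewrite (antipoderE (f := fun z => z ⊗ (1 : K))) //; lin.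
Qed.

(** [ε(k) = ε(S(k1) k2) = ε(S(k1)) ε(k2) = ε(S(k))]. *)
Lemma counit_antipode k : ε (S k) = ε k.
Proof.
have e : forall z : K, ε (ε z *: 1) = ε z.
  by move=> z; have /linE [_ _ ->] := (counit_linear hH : linear (ε : K -> C^o));
    rewrite (counit_one hH) /GRing.scale /= mulr1.
rewrite -[RHS]e -(antipodel hH).
rewrite (lin_sum (V := C^o) _ _ (counit_linear hH)).
rewrite -{1}(comul_counitr hH k) (lin_sum _ _ (antipode_linear hH)).
rewrite (lin_sum (V := C^o) _ _ (counit_linear hH)).
apply: eq_tsum => x y; rewrite (counit_mul hH) mulrC.
rewrite (linZ (antipode_linear hH)).
by have /linE [_ _ ->] := (counit_linear hH : linear (ε : K -> C^o)).
Qed.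

(** The hypothesis says that [X] is an antipode for the opposite coproduct. *)
Lemma antipode_opposite (X : K -> K) : linear X ->
  (forall k, \tsum_(x, y <- Δ k) X y * x = ε k *: 1) -> forall k, S (X k) = k.
Proof.
move=> Xl hX k; symmetry.
apply: (@convolution_inverse_uniq _ *%R 1 id S (fun k => S (X k))) => {k}; try by lin.
- exact: mulrA.
- exact: mul1r.
- exact: mulr1.
- exact: (antipoder hH).
move=> k; under eq_tsum => x y do rewrite -antipodeM.
by rewrite -(lin_sum _ _ (antipode_linear hH)) hX (linZ (antipode_linear hH)) antipode1.
Qed.

End SweedlerHopf.

Section Inverses.
Variables (B : nzRingType).
Implicit Types (x y : B).

Lemma inv_eltP x : invertible x -> two_sided_inverse x (inv_elt x).
Proof. by move=> [y xy]; rewrite /inv_elt; case: xgetP => [z _ //|/(_ y)]. Qed.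

Lemma two_sided_inverse_uniq x y z : x * y = 1 -> z * x = 1 -> y = z.
Proof. by move=> xy zx; rewrite -[y]mul1r -zx -mulrA xy mulr1. Qed.

Lemma inv_elt_eq x y : two_sided_inverse x y -> inv_elt x = y.
Proof.
move=> [xy yx]; have [] : two_sided_inverse x (inv_elt x) by apply: inv_eltP; exists y.
by move=> xz _; apply: two_sided_inverse_uniq xz yx.
Qed.

End Inverses.

(** * Flips and antilinear maps *)

Section FlipMap.
Variables (C : numClosedFieldType).
Implicit Types (U V W : lmodType C) (B K : algType C).

Lemma tsum_flip V W U (f : W -> V -> U) (t : V ⊗ W) : bilin f ->
  tsum f (tflip t) = \tsum_(x, y <- t) f y x.
Proof.
by move=> fb; rewrite tsum_tsum //; apply: eq_tsum => x y; rewrite tsumE.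
Qed.

Lemma tsum_tmap V W V' W' U (f : V' -> W' -> U) (g : V -> V') (h : W -> W') t :
  bilin f -> tsum f (tmap g h t) = \tsum_(x, y <- t) f (g x) (h y).
Proof.
by move=> fb; rewrite tsum_tsum //; apply: eq_tsum => x y; rewrite tsumE.
Qed.

Lemma tflip_linear V W : linear (@tflip C V W).
Proof. by rewrite /tflip; lin. Qed.

Lemma tflipE V W (v : V) (w : W) : tflip (v ⊗ w) = w ⊗ v.
Proof. by rewrite /tflip tsumE //; lin. Qed.

Lemma tflipK V W (t : V ⊗ W) : tflip (tflip t) = t.
Proof.
apply: (tensor_lin_ext (f := fun t : V ⊗ W => tflip (tflip t)) (g := id)) => [||v w].
- by apply: (lin_comp (@tflip_linear _ _) (@tflip_linear _ _)).
- exact: lin_id.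
by rewrite !tflipE.
Qed.

Lemma tflipM B (s t : B ⊗ B) : tflip (s * t) = tflip s * tflip t.
Proof.
have fl := @tflip_linear B B.
apply: (tensor_lin_ext (f := fun s => tflip (s * t)) (g := fun s => tflip s * tflip t)).
- by lin.
- by lin.
move=> a b.
apply: (tensor_lin_ext (f := fun t => tflip (a ⊗ b * t)) (g := fun t => tflip (a ⊗ b) * tflip t)).
- by lin.
- by lin.
by move=> c d; rewrite tensor_mulE !tflipE tensor_mulE.
Qed.

Lemma tflip1 B : tflip (1 : B ⊗ B) = 1.
Proof. by rewrite tensor_oneE tflipE. Qed.

Lemma antilinD V W (s : V -> W) : antilinear s -> forall u v, s (u + v) = s u + s v.
Proof. by move=> sl u v; have := sl 1 u v; rewrite conjC1 !scale1r. Qed.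

Lemma antilin0 V W (s : V -> W) : antilinear s -> s 0 = 0.
Proof. by move=> sl; apply: (addrI (s 0)); rewrite -(antilinD sl) !addr0. Qed.

Lemma antilinZ V W (s : V -> W) : antilinear s -> forall c v, s (c *: v) = c^* *: s v.
Proof. by move=> sl c v; have := sl c v 0; rewrite (antilin0 sl) !addr0. Qed.

Lemma antilinN V W (s : V -> W) : antilinear s -> forall v, s (- v) = - s v.
Proof. by move=> sl v; apply: (addrI (s v)); rewrite -(antilinD sl) !subrr (antilin0 sl). Qed.

Lemma antilinB V W (s : V -> W) : antilinear s -> forall u v, s (u - v) = s u - s v.
Proof. by move=> sl u v; rewrite (antilinD sl) (antilinN sl). Qed.

Lemma antilin_sum V W V' W' (s : V -> W) (f : V' -> W' -> V) t : antilinear s ->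
  s (tsum f t) = \tsum_(x, y <- t) s (f x y).
Proof.
move=> sl; rewrite /tsum; elim: (msupp _ : seq _) => [|p r IH].
  by rewrite !big_nil (antilin0 sl).
by rewrite !big_cons (antilinD sl) IH.
Qed.

(** A scalar comes out of either argument as its conjugate, so it may still be moved across: such
    sums are well defined although not linear in the tensor. *)
Lemma balanced_antilin V W V' W' U (s : V -> V') (r : W -> W') (f : V' -> W' -> U) :
  antilinear s -> antilinear r -> bilin f -> balanced (fun x y => f (s x) (r y)).
Proof.
move=> sl rl [fl fr]; split=> [v v' w|v w w'|c v w].
- by rewrite (antilinD sl) (linD (fl _)).
- by rewrite (antilinD rl) (linD (fr _)).
by rewrite (antilinZ sl) (antilinZ rl) (linZ (fl _)) (linZ (fr _)).
Qed.

Lemma balanced_tsum V W V' W' (U : zmodType) (f : V -> W -> U)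
    (g : V' -> W' -> V ⊗ W) t : balanced f ->
  tsum f (\tsum_(x, y <- t) g x y) = \tsum_(x, y <- t) tsum f (g x y).
Proof.
move=> fb; have f0 : tsum f 0 = 0.
  by apply: (addrI (tsum f 0)); rewrite addr0 -(tsumD fb) addr0.
exact: (big_morph (tsum f) (tsumD fb) f0).
Qed.

Lemma balanced_antilinear V W U (f : V -> W -> U) : balanced f ->
  (forall c v w, f (c *: v) w = c^* *: f v w) -> antilinear (tsum f).
Proof.
move=> fb fa c t t'; rewrite (tsumD fb); congr (_ + _).
elim/tensor_ind: t => [v w|t1 t2 IH1 IH2].
  by rewrite -tpureZl !(tsum_pure fb).
apply: etrans (congr1 (tsum f) (scalerDr c t1 t2)) _.
apply: etrans (tsumD fb _ _) _; apply: etrans (congr2 +%R IH1 IH2) _.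
apply: etrans (esym (scalerDr _ _ _)) _; congr (_ *: _).
exact/esym/(tsumD fb).
Qed.

End FlipMap.

#[global] Hint Extern 1 (GRing.linear_for _ (@tflip _ _ _)) => exact (@tflip_linear _ _ _) : lin.

(** The conditions that do not mention the involution. The inverse is written [tflip R], and
    quasi-cocommutativity without an inverse, since a twist preserves these forms by plain
    cancellation. *)
Record triangular_Rmat (C : numClosedFieldType) (K : algType C) (H : hopf_data K)
    : Prop := {
  tri_hopf : hopf_algebra H;
  tri_mulV : Rmat H * tflip (Rmat H) = 1;
  tri_comul : forall k, tflip (comul H k) * Rmat H = Rmat H * comul H k;
  tri_hexl : map_left (comul H) (Rmat H) = leg13 (Rmat H) * leg23 (Rmat H);
  tri_hexr : map_right (comul H) (Rmat H) = leg13 (Rmat H) * leg12 (Rmat H)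
}.

(** * Tensors of order three and identities for a triangular R-matrix *)

Section ThreeLegs.
Variables (C : numClosedFieldType) (K : algType C).
Implicit Types (U : lmodType C).

Definition tsum3 U (f : K -> K -> K -> U) (T : K ⊗ K ⊗ K) : U :=
  \tsum_(s, z <- T) \tsum_(x, y <- s) f x y z.

Variables (U : lmodType C) (f : K -> K -> K -> U).
Hypothesis fl : trilin f.

Lemma tsum3_bilin : bilin (fun s z => \tsum_(x, y <- s) f x y z).
Proof. by lin. Qed.

Lemma tsum3_linear : linear (tsum3 f).
Proof. by apply: bilin_linear; apply: tsum3_bilin. Qed.

Lemma tsum3E x y z : tsum3 f (x ⊗ y ⊗ z) = f x y z.
Proof. by rewrite /tsum3 (tsumE _ _ tsum3_bilin) tsumE //; lin. Qed.

Lemma tsum3_map_left (D : K -> K ⊗ K) t :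
  tsum3 f (map_left D t) = \tsum_(x, z <- t) \tsum_(a, b <- D x) f a b z.
Proof.
rewrite /tsum3 (tsum_tsum _ _ tsum3_bilin); apply: eq_tsum => x z.
by rewrite (tsumE _ _ tsum3_bilin).
Qed.

Lemma tsum3_map_right (D : K -> K ⊗ K) t :
  tsum3 f (map_right D t) = \tsum_(x, z <- t) \tsum_(a, b <- D z) f x a b.
Proof.
rewrite /tsum3 (tsum_tsum _ _ tsum3_bilin); apply: eq_tsum => x z.
rewrite (tsum_tsum _ _ tsum3_bilin); apply: eq_tsum => a b.
by rewrite -[LHS]/(tsum3 f (x ⊗ a ⊗ b)) tsum3E.
Qed.

Lemma tsum3_leg12 t : tsum3 f (leg12 t) = \tsum_(x, y <- t) f x y 1.
Proof. by rewrite /tsum3 /leg12 (tsumE _ _ tsum3_bilin). Qed.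

Lemma tsum3_leg13 t : tsum3 f (leg13 t) = \tsum_(x, y <- t) f x 1 y.
Proof.
rewrite /leg13 (lin_sum _ _ tsum3_linear).
by apply: eq_tsum => x y; rewrite tsum3E.
Qed.

Lemma tsum3_leg23 t : tsum3 f (leg23 t) = \tsum_(x, y <- t) f 1 x y.
Proof.
rewrite /leg23 (lin_sum _ _ tsum3_linear).
by apply: eq_tsum => x y; rewrite tsum3E.
Qed.

Lemma tsum3_mul T T' :
  tsum3 f (T * T') = tsum3 (fun x y z => tsum3 (fun x' y' z' =>
    f (x * x') (y * y') (z * z')) T') T.
Proof.
rewrite /tsum3 (tsum_mul _ _ tsum3_bilin); apply: eq_tsum => s z.
rewrite exchange_tsum; apply: eq_tsum => s' z'.
by rewrite tsum_mul //; lin.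
Qed.

End ThreeLegs.

Lemma tensor3_ext (C : numClosedFieldType) (K : algType C) (U : lmodType C)
    (f g : K ⊗ K ⊗ K -> U) : linear f -> linear g ->
  (forall x y z, f (x ⊗ y ⊗ z) = g (x ⊗ y ⊗ z)) -> forall T, f T = g T.
Proof.
move=> fl gl fg; apply: tensor_lin_ext => // s z; move: s.
apply: (tensor_lin_ext (f := fun s => f (s ⊗ z)) (g := fun s => g (s ⊗ z))) => //; lin.
Qed.

Section RmatSums.
Variables (C : numClosedFieldType) (K : algType C) (H : hopf_data K).
Hypothesis hT : triangular_Rmat H.
Implicit Types (U : lmodType C).

Local Notation Δ := (comul H).
Local Notation ε := (counit H).
Local Notation S := (antipode H).
Local Notation R := (Rmat H).

Let hH : hopf_algebra H := tri_hopf hT.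

Lemma tri_Vmul : tflip R * R = 1.
Proof. by rewrite -{2}[R]tflipK -tflipM (tri_mulV hT) tflip1. Qed.

Lemma Rmat_mulV U (f : K -> K -> U) : bilin f ->
  \tsum_(r1, r2 <- R) \tsum_(s1, s2 <- R) f (r1 * s2) (r2 * s1) = f 1 1.
Proof.
move=> fb; rewrite -(tsum_one fb) -(tri_mulV hT) (tsum_mul _ _ fb).
by apply: eq_tsum => r1 r2; rewrite tsum_flip //; lin.
Qed.

Lemma Rmat_Vmul U (f : K -> K -> U) : bilin f ->
  \tsum_(r1, r2 <- R) \tsum_(s1, s2 <- R) f (r2 * s1) (r1 * s2) = f 1 1.
Proof.
move=> fb; rewrite -(tsum_one fb) -tri_Vmul (tsum_mul _ _ fb).
by rewrite tsum_flip //; lin.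
Qed.

Lemma Rmat_comulE U (f : K -> K -> U) k : bilin f ->
  \tsum_(r1, r2 <- R) \tsum_(x, y <- Δ k) f (r1 * x) (r2 * y)
  = \tsum_(x, y <- Δ k) \tsum_(r1, r2 <- R) f (y * r1) (x * r2).
Proof.
move=> fb; rewrite -tsum_mul // -(tri_comul hT) tsum_mul // tsum_flip //; lin.
Qed.

Lemma Rmat_hexlE U (f : K -> K -> K -> U) : trilin f ->
  \tsum_(r1, r2 <- R) \tsum_(a, b <- Δ r1) f a b r2
  = \tsum_(r1, r2 <- R) \tsum_(s1, s2 <- R) f r1 s1 (r2 * s2).
Proof.
move=> fl; rewrite -tsum3_map_left // (tri_hexl hT) tsum3_mul //.
rewrite tsum3_leg13; last by rewrite /tsum3; lin.
apply: eq_tsum => r1 r2; rewrite tsum3_leg23; last by lin.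
by apply: eq_tsum => s1 s2; rewrite mulr1 mul1r.
Qed.

Lemma Rmat_hexrE U (f : K -> K -> K -> U) : trilin f ->
  \tsum_(r1, r2 <- R) \tsum_(a, b <- Δ r2) f r1 a b
  = \tsum_(r1, r2 <- R) \tsum_(s1, s2 <- R) f (r1 * s1) s2 r2.
Proof.
move=> fl; rewrite -tsum3_map_right // (tri_hexr hT) tsum3_mul //.
rewrite tsum3_leg13; last by rewrite /tsum3; lin.
apply: eq_tsum => r1 r2; rewrite tsum3_leg12; last by lin.
by apply: eq_tsum => s1 s2; rewrite mulr1 mul1r.
Qed.

(** [R12 R13 R23 = R12 (Δ ⊗ id)R = (Δcop ⊗ id)R R12 = R23 R13 R12], by the hexagon,
    quasi-cocommutativity and the hexagon again. *)
Lemma yang_baxterE U (f : K -> K -> K -> U) : trilin f ->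
  \tsum_(r1, r2 <- R) \tsum_(s1, s2 <- R) \tsum_(t1, t2 <- R)
     f (r1 * s1) (r2 * t1) (s2 * t2)
  = \tsum_(r1, r2 <- R) \tsum_(s1, s2 <- R) \tsum_(t1, t2 <- R)
     f (s1 * r1) (t1 * r2) (t2 * s2).
Proof.
move=> fl.
transitivity (\tsum_(r1, r2 <- R) \tsum_(s1, s2 <- R) \tsum_(a, b <- Δ s1)
                 f (r1 * a) (r2 * b) s2).
  apply: eq_tsum => r1 r2.
  by rewrite (Rmat_hexlE (f := fun a b c => f (r1 * a) (r2 * b) c)) //; lin.
transitivity (\tsum_(s1, s2 <- R) \tsum_(a, b <- Δ s1) \tsum_(r1, r2 <- R)
                 f (b * r1) (a * r2) s2).
  rewrite exchange_tsum; apply: eq_tsum => s1 s2.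
  by rewrite (Rmat_comulE (f := fun a b => f a b s2)) //; lin.
rewrite (Rmat_hexlE (f := fun a b c => \tsum_(r1, r2 <- R) f (b * r1) (a * r2) c)).
  rewrite exchange_tsum; under eq_tsum => a b do rewrite exchange_tsum.
  rewrite exchange_tsum.
  apply: eq_tsum => r1 r2; apply: eq_tsum => a b; apply: eq_tsum => c d.
  by [].
lin.
Qed.

(** Put [e = (ε ⊗ id)R]. Applying [ε] to the first leg of the hexagon gives [R = (1 ⊗ e) R], and [R]
    is invertible; the sum over [t] in [g] is the multiplication by its inverse [R21]. *)
Lemma Rmat_counitl U (f : K -> U) : linear f ->
  \tsum_(r1, r2 <- R) ε r1 *: f r2 = f 1.
Proof.
move=> fl; pose g a b c := \tsum_(t1, t2 <- R) ε a *: f (b * t2 * (c * t1)).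
have gl : trilin g.
  split=> [y z|x z|x y]; rewrite /g; [|by lin..].
  by apply: lin_tsum => t1 t2; apply: lin_scalar; apply: counit_linear.
transitivity (\tsum_(r1, r2 <- R) \tsum_(s1, s2 <- R) g r1 s1 (r2 * s2)).
  apply: eq_tsum => r1 r2.
  transitivity (ε r1 *: f (1 * (r2 * 1))); first by rewrite mul1r mulr1.
  rewrite /g -(Rmat_mulV (f := fun x y => ε r1 *: f (x * (r2 * y)))); last by lin.
  by apply: eq_tsum => s1 s2; apply: eq_tsum => t1 t2; rewrite !mulrA.
rewrite -(Rmat_hexlE gl) -(mulr1 (1 : K)) -(Rmat_mulV (f := fun x y => f (x * y))); last by lin.
apply: eq_tsum => r1 r2; rewrite /g exchange_tsum; apply: eq_tsum => t1 t2.
by rewrite (counitlE hH (f := fun b => f (b * t2 * (r2 * t1)))) //; lin.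
Qed.

Lemma Rmat_counitr U (f : K -> U) : linear f ->
  \tsum_(r1, r2 <- R) ε r2 *: f r1 = f 1.
Proof.
move=> fl; pose g a b c := \tsum_(t1, t2 <- R) ε b *: f (t2 * a * (t1 * c)).
have gl : trilin g.
  split=> [y z|x z|x y]; rewrite /g; [by lin| |by lin].
  by apply: lin_tsum => t1 t2; apply: lin_scalar; apply: counit_linear.
transitivity (\tsum_(r1, r2 <- R) \tsum_(s1, s2 <- R) g (r1 * s1) s2 r2).
  rewrite exchange_tsum; apply: eq_tsum => s1 s2; rewrite /g exchange_tsum.
  transitivity (ε s2 *: f (1 * s1 * 1)); first by rewrite mul1r mulr1.
  rewrite -(Rmat_Vmul (f := fun x y => ε s2 *: f (x * s1 * y))); last by lin.
  by apply: eq_tsum => t1 t2; apply: eq_tsum => r1 r2; rewrite !mulrA.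
rewrite -(Rmat_hexrE gl) -(mulr1 (1 : K)) -(Rmat_Vmul (f := fun x y => f (x * y))); last by lin.
rewrite exchange_tsum.
apply: eq_tsum => r1 r2; rewrite /g exchange_tsum; apply: eq_tsum => t1 t2.
by rewrite (counitlE hH (f := fun b => f (t2 * r1 * (t1 * b)))) //; lin.
Qed.

(** Contracting the first two legs of the hexagon by [S(a) b] gives [1 = (S ⊗ id)R · R], so
    [(S ⊗ id)R] is the inverse [R21]. *)
Lemma Rmat_antipodel U (f : K -> K -> U) : bilin f ->
  \tsum_(r1, r2 <- R) f (S r1) r2 = \tsum_(r1, r2 <- R) f r2 r1.
Proof.
move=> fb; pose g a b c := \tsum_(t1, t2 <- R) f (S a * b * t2) (c * t1).
have gl : trilin g by rewrite /g; lin.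
transitivity (\tsum_(r1, r2 <- R) \tsum_(s1, s2 <- R) g r1 s1 (r2 * s2)).
  apply: eq_tsum => r1 r2; rewrite /g.
  transitivity (f (S r1 * 1) (r2 * 1)); first by rewrite !mulr1.
  rewrite -(Rmat_mulV (f := fun x y => f (S r1 * x) (r2 * y))); last by lin.
  by apply: eq_tsum => s1 s2; apply: eq_tsum => t1 t2; rewrite !mulrA.
rewrite -(Rmat_hexlE gl) /g; under eq_tsum => r1 r2 do rewrite exchange_tsum.
rewrite exchange_tsum; apply: eq_tsum => t1 t2.
rewrite -{2}[t1]mul1r -(Rmat_counitl (f := fun x => f t2 (x * t1))); last by lin.
apply: eq_tsum => r1 r2.
rewrite (antipodelE hH (f := fun x => f (x * t2) (r2 * t1))) ?mul1r //; lin.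
Qed.

Lemma Rmat_antipode U (f : K -> K -> U) : bilin f ->
  \tsum_(r1, r2 <- R) f (S r1) (S r2) = \tsum_(r1, r2 <- R) f r1 r2.
Proof.
move=> fb; have Sl := antipode_linear hH.
rewrite (Rmat_antipodel (f := fun x y => f x (S y))); last by lin.
by rewrite (Rmat_antipodel (f := fun x y => f y x)) //; lin.
Qed.

End RmatSums.

(** * The conjugation [* ∘ S] *)

(** In a Hopf [*]-algebra [s = * ∘ S = S^{-1} ∘ *]; it is
    multiplicative, and unlike [*] itself it is unchanged by a twist. *)
Record conj_structure (C : numClosedFieldType) (K : algType C) (H : hopf_data K)
    (s : K -> K) : Prop := {
  conj_antilinear : antilinear s;
  conjM : forall k l, s (k * l) = s k * s l;
  conjK : involutive s;
  conj_counit : forall k, counit H (s k) = (counit H k)^*;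
  conj_comul : forall k,
    comul H (s k) = \tsum_(x, y <- comul H k) s y ⊗ s x;
  conj_Rmat : \tsum_(r1, r2 <- Rmat H) s r1 ⊗ s r2 = tflip (Rmat H)
}.

Section ConjTheory.
Variables (C : numClosedFieldType) (K : algType C) (H : hopf_data K) (s : K -> K).
Hypothesis hs : conj_structure H s.
Implicit Types (U : lmodType C).

Lemma conj1 : s 1 = 1.
Proof.
have e k : s 1 * k = k by rewrite -[k in LHS](conjK hs) -(conjM hs) mul1r (conjK hs).
by rewrite -[LHS]mulr1 e.
Qed.

Lemma conj_comulE U (f : K -> K -> U) k : bilin f ->
  \tsum_(x, y <- comul H (s k)) f x y = \tsum_(x, y <- comul H k) f (s y) (s x).
Proof.
move=> fb; rewrite (conj_comul hs) (tsum_tsum _ _ fb).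
by apply: eq_tsum => x y; rewrite tsumE.
Qed.

Lemma conj_RmatE U (f : K -> K -> U) : bilin f ->
  \tsum_(r1, r2 <- Rmat H) f (s r1) (s r2) = \tsum_(r1, r2 <- Rmat H) f r2 r1.
Proof.
move=> fb; rewrite -(tsum_flip _ fb) -(conj_Rmat hs) (tsum_tsum _ _ fb).
by apply: eq_tsum => x y; rewrite tsumE.
Qed.

(** As [s] reverses the coproduct and preserves products, [s ∘ S ∘ s] is an antipode for the
    opposite coproduct, hence inverse to [S]. *)
Lemma conj_antipode : hopf_algebra H ->
  forall k, antipode H (s (antipode H (s k))) = k.
Proof.
move=> hH; have al := conj_antilinear hs.
apply: (antipode_opposite hH (X := fun k => s (antipode H (s k)))) => [|k].
  move=> c u v; rewrite al; have Sl := antipode_linear hH.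
  by rewrite Sl al conjCK.
transitivity (s (\tsum_(x, y <- comul H (s k)) antipode H x * y)); last first.
  by rewrite (antipodel hH) (antilinZ al) (conj_counit hs) conjCK conj1.
rewrite conj_comulE; last by have Sl := antipode_linear hH; lin.
rewrite (antilin_sum _ _ al); apply: eq_tsum => x y.
by rewrite (conjM hs) (conjK hs).
Qed.

End ConjTheory.

Section StarConj.
Variables (C : numClosedFieldType) (K : algType C) (H : hopf_data K).
Local Notation S := (antipode H).
Local Notation star := (hstar H).

Lemma triangular_star_Rmat : triangular_hopf_star_algebra H -> triangular_Rmat H.
Proof.
case=> hH _ _ inv qc hl hr tr _.
have [RV VR] := inv_eltP inv; rewrite -/(Rinv H) in RV VR.
split; [exact: hH| by rewrite -tr | | exact: hl | exact: hr].
by move=> k; rewrite qc -mulrA VR mulr1.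
Qed.

Hypothesis hT : triangular_hopf_star_algebra H.
Let hH := is_hopf hT.
Let hR := triangular_star_Rmat hT.
Let sa := star_antilinear (is_star hT).
Let sK := star_involutive (is_star hT).
Let sM := star_mul (is_star hT).

Let star1 : star 1 = 1.
Proof. by rewrite -[LHS]mulr1 -[X in _ * X]sK -sM mulr1 sK. Qed.

Lemma hstar_counit k : counit H (star k) = (counit H k)^*.
Proof.
have el := counit_linear hH.
have e0 : counit H 0 = 0 by have := el (-1) 0 0; rewrite scaler0 addr0 mulN1r addNr.
have eZ c x : counit H (c *: x) = c * counit H x.
  by have := el c x 0; rewrite e0 !addr0.
(* both sides are counits for the conjugate coproduct *)
pose e' k : C := (counit H (star k))^*.
have e'l : scalar e'.
  move=> c u v; rewrite /e' sa el rmorphD rmorphM /= conjCK //.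
have e'u j : \tsum_(x, y <- comul H j) e' x *: y = j.
  rewrite -[RHS]sK -(comul_counitl hH (star j)) (comul_star hT).
  have fl : bilin (fun x y : K => counit H x *: y).
    by split=> [w|v]; [apply: lin_scalar | lin].
  rewrite (tsum_tmap _ _ _ fl) (antilin_sum _ _ sa).
  by apply: eq_tsum => x y; rewrite (antilinZ sa) sK.
apply: (can_inj (@conjCK C)); rewrite conjCK -/(e' k).
(* Both sides become the sum of [e' k1 * ε k2]: a left counit and a right counit of one coproduct
   agree. *)
rewrite -[in RHS](e'u k).
have el' : linear (counit H : K -> C^o) by exact: el.
have e'l' : linear (e' : K -> C^o) by exact: e'l.
rewrite (lin_sum (V := C^o) _ _ el') -[in LHS](comul_counitr hH k) (lin_sum (V := C^o) _ _ e'l').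
by apply: eq_tsum => x y; rewrite (linZ e'l') (linZ el') /GRing.scale /= mulrC.
Qed.

Lemma hstar_comulE (U : lmodType C) (f : K -> K -> U) k : bilin f ->
  \tsum_(x, y <- comul H (star k)) f x y
  = \tsum_(x, y <- comul H k) f (star x) (star y).
Proof. by move=> fb; rewrite (comul_star hT) tsum_tmap. Qed.

(** The involution preserves the coproduct and reverses products, so conjugating [S] by it gives an
    antipode for the opposite coproduct. *)
Lemma antipode_star k : S (star (S (star k))) = k.
Proof.
apply: (antipode_opposite hH (X := fun k => star (S (star k)))) => {k} [|k].
  by move=> c u v; rewrite sa (antipode_linear hH) sa conjCK.
transitivity (star (\tsum_(x, y <- comul H (star k)) x * S y)); last first.
  by rewrite (antipoder hH) (antilinZ sa) hstar_counit conjCK star1.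
rewrite hstar_comulE; last by have Sl := antipode_linear hH; lin.
rewrite (antilin_sum _ _ sa); apply: eq_tsum => x y.
by rewrite sM sK.
Qed.

Definition hconj (k : K) : K := star (S k).

(** Immediate from [antipode_star]. In this form of the involution a twist changes [S] only, not
    [hconj]. *)
Lemma hstar_hconj k : star k = S (hconj k).
Proof. by rewrite /hconj -[in RHS](sK k) antipode_star. Qed.

Lemma hconj_structure : conj_structure H hconj.
Proof.
have Sl := antipode_linear hH.
have al : antilinear hconj by move=> c u v; rewrite /hconj Sl sa.
split; first exact: al.
- by move=> k l; rewrite /hconj (antipodeM hH) sM.
- by move=> k; rewrite {1}/hconj -hstar_hconj sK.
- by move=> k; rewrite /hconj hstar_counit (counit_antipode hH).
- move=> k; rewrite /hconj (comul_star hT) (antipode_comul hH) /tmap.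
  have fb : bilin (fun x y : K => x ⊗ y) by lin.
  have bb := balanced_antilin sa sa fb.
  rewrite [LHS](balanced_tsum _ _ bb).
  by apply: eq_tsum => x y; rewrite (tsum_pure bb).
have fb : bilin (fun x y : K => x ⊗ y) by lin.
have bb := balanced_antilin sa sa fb.
transitivity (tmap star star (\tsum_(r1, r2 <- Rmat H) S r1 ⊗ S r2)).
  apply: esym; rewrite [LHS](balanced_tsum _ _ bb).
  by apply: eq_tsum => x y; rewrite (tsum_pure bb).
by rewrite (Rmat_antipode hR fb) tsum_tpure (Rmat_star hT).
Qed.

(** [antipodeV] picks some preimage under [S], with a default if there is none. [S] is injective,
    and [hconj k] is a preimage, so the compatibility of a star with the action simply reads
    [star (k ▷ a) = hconj k ▷ star a]. *)
Lemma antipodeV_star k : antipodeV H (star k) = hconj k.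
Proof.
have Sinj : injective S.
  apply: (can_inj (g := fun j => hconj (star j))) => j.
  exact: conjK hconj_structure j.
apply: Sinj; rewrite -hstar_hconj /antipodeV /inv_fun.
by case: xgetP => [l _ //|/(_ (hconj k)) []]; apply: esym; apply: hstar_hconj.
Qed.

End StarConj.

Section ConjStar.
Variables (C : numClosedFieldType) (K : algType C) (H : hopf_data K) (s : K -> K).
Hypotheses (hR : triangular_Rmat H) (hs : conj_structure H s).
Hypothesis star_conj : forall k, hstar H k = antipode H (s k).

(** Converse of [hconj_structure]: a conjugation [s] makes [S ∘ s] an involution with all the
    required properties. The axioms for the twisted involution are obtained from it. *)
Lemma conj_triangular_star : triangular_hopf_star_algebra H.
Proof.
have hH := tri_hopf hR; have Sl := antipode_linear hH.
have al := conj_antilinear hs.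
have RR : two_sided_inverse (Rmat H) (tflip (Rmat H)).
  by split; [apply: tri_mulV hR | apply: tri_Vmul hR].
have Re : Rinv H = tflip (Rmat H) by apply: inv_elt_eq.
have fb : bilin (fun x y : K => x ⊗ y) by lin.
have gb : bilin (fun x y : K => antipode H x ⊗ antipode H y) by lin.
split; first exact: hH.
- split=> [c u v|k|k l]; rewrite !star_conj.
  + by rewrite al Sl.
  + exact: conj_antipode hs hH k.
  + by rewrite (conjM hs) (antipodeM hH).
- move=> k; rewrite star_conj (antipode_comul hH).
  rewrite (conj_comulE hs (f := fun x y => antipode H y ⊗ antipode H x)); last by lin.
  by apply: eq_tsum => x y; rewrite !star_conj.
- by exists (tflip (Rmat H)); exact: RR.
- by move=> k; rewrite Re -(tri_comul hR) -mulrA (tri_mulV hR) mulr1.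
- exact: tri_hexl hR.
- exact: tri_hexr hR.
- exact: Re.
rewrite /tmap; under eq_tsum => x y do rewrite !star_conj.
rewrite (conj_RmatE hs gb) (Rmat_antipode hR (f := fun x y => y ⊗ x)); last by lin.
by [].
Qed.

End ConjStar.

(** * The twisted Hopf algebra *)

(** The operator [f => f ◁ T], [(f ◁ T) x y z = Σ f (x t1) (y t2) (z t3)], for
    [T] a tensor of order three of the indicated shape. Products of such tensors
    become compositions of operators. *)
Section Operators.
Variables (C : numClosedFieldType) (K : algType C) (D : K -> K ⊗ K) (U : lmodType C).
Implicit Types (f : K -> K -> K -> U) (t : K ⊗ K).

Definition op12 t f x y z := \tsum_(a, b <- t) f (x * a) (y * b) z.
Definition op13 t f x y z := \tsum_(a, b <- t) f (x * a) y (z * b).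
Definition op23 t f x y z := \tsum_(a, b <- t) f x (y * a) (z * b).
Definition opDl t f x y z :=
  \tsum_(c, d <- t) \tsum_(a, b <- D c) f (x * a) (y * b) (z * d).
Definition opDr t f x y z :=
  \tsum_(c, d <- t) \tsum_(a, b <- D d) f (x * c) (y * a) (z * b).

Definition swap23 f x y z := f x z y.
Definition rot3 f x y z := f y z x.

Lemma eq_fun3 f g : (forall x y z, f x y z = g x y z) -> f = g.
Proof. by move=> e; do 3!apply: funext => ?; apply: e. Qed.

Lemma trilin_op12 t f : trilin f -> trilin (op12 t f).
Proof. by move=> fl; rewrite /op12; lin. Qed.
Lemma trilin_op13 t f : trilin f -> trilin (op13 t f).
Proof. by move=> fl; rewrite /op13; lin. Qed.
Lemma trilin_op23 t f : trilin f -> trilin (op23 t f).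
Proof. by move=> fl; rewrite /op23; lin. Qed.
Lemma trilin_opDl t f : linear D -> trilin f -> trilin (opDl t f).
Proof. by move=> Dl fl; rewrite /opDl; lin. Qed.
Lemma trilin_opDr t f : linear D -> trilin f -> trilin (opDr t f).
Proof. by move=> Dl fl; rewrite /opDr; lin. Qed.
Lemma trilin_swap23 f : trilin f -> trilin (swap23 f).
Proof. by move=> fl; rewrite /swap23; lin. Qed.
Lemma trilin_rot3 f : trilin f -> trilin (rot3 f).
Proof. by move=> fl; rewrite /rot3; lin. Qed.

Lemma op12M s t f : trilin f -> op12 (s * t) f = op12 s (op12 t f).
Proof.
move=> fl; apply: eq_fun3 => x y z; rewrite /op12 tsum_mul; last by lin.
by apply: eq_tsum => a b; apply: eq_tsum => a' b'; rewrite !mulrA.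
Qed.

Lemma op13M s t f : trilin f -> op13 (s * t) f = op13 s (op13 t f).
Proof.
move=> fl; apply: eq_fun3 => x y z; rewrite /op13 tsum_mul; last by lin.
by apply: eq_tsum => a b; apply: eq_tsum => a' b'; rewrite !mulrA.
Qed.

Lemma op23M s t f : trilin f -> op23 (s * t) f = op23 s (op23 t f).
Proof.
move=> fl; apply: eq_fun3 => x y z; rewrite /op23 tsum_mul; last by lin.
by apply: eq_tsum => a b; apply: eq_tsum => a' b'; rewrite !mulrA.
Qed.

Lemma op12_1 f : trilin f -> op12 1 f = f.
Proof.
move=> fl; apply: eq_fun3 => x y z; rewrite /op12 tsum_one; last by lin.
by rewrite !mulr1.
Qed.

Lemma op13_1 f : trilin f -> op13 1 f = f.
Proof.
move=> fl; apply: eq_fun3 => x y z; rewrite /op13 tsum_one; last by lin.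
by rewrite !mulr1.
Qed.

Lemma op23_1 f : trilin f -> op23 1 f = f.
Proof.
move=> fl; apply: eq_fun3 => x y z; rewrite /op23 tsum_one; last by lin.
by rewrite !mulr1.
Qed.

Hypotheses (Dl : linear D) (DM : forall k l, D (k * l) = D k * D l) (D1 : D 1 = 1).

Lemma opDlM s t f : trilin f -> opDl (s * t) f = opDl s (opDl t f).
Proof.
move=> fl; apply: eq_fun3 => x y z; rewrite /opDl tsum_mul; last by lin.
apply: eq_tsum => c d; rewrite [RHS]exchange_tsum; apply: eq_tsum => c' d'.
rewrite DM tsum_mul; last by lin.
by apply: eq_tsum => a b; apply: eq_tsum => a' b'; rewrite !mulrA.
Qed.

Lemma opDrM s t f : trilin f -> opDr (s * t) f = opDr s (opDr t f).
Proof.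
move=> fl; apply: eq_fun3 => x y z; rewrite /opDr tsum_mul; last by lin.
apply: eq_tsum => c d; rewrite [RHS]exchange_tsum; apply: eq_tsum => c' d'.
rewrite DM tsum_mul; last by lin.
by apply: eq_tsum => a b; apply: eq_tsum => a' b'; rewrite !mulrA.
Qed.

Lemma opDl_1 f : trilin f -> opDl 1 f = f.
Proof.
move=> fl; apply: eq_fun3 => x y z; rewrite /opDl tsum_one; last by lin.
by rewrite D1 tsum_one ?mulr1 //; lin.
Qed.

Lemma opDr_1 f : trilin f -> opDr 1 f = f.
Proof.
move=> fl; apply: eq_fun3 => x y z; rewrite /opDr tsum_one; last by lin.
by rewrite D1 tsum_one ?mulr1 //; lin.
Qed.

Section Inverse.
Variables (s t : K ⊗ K).
Hypothesis st1 : s * t = 1.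

Lemma op12V f : trilin f -> op12 s (op12 t f) = f.
Proof. by move=> fl; rewrite -op12M // st1 op12_1. Qed.
Lemma op13V f : trilin f -> op13 s (op13 t f) = f.
Proof. by move=> fl; rewrite -op13M // st1 op13_1. Qed.
Lemma op23V f : trilin f -> op23 s (op23 t f) = f.
Proof. by move=> fl; rewrite -op23M // st1 op23_1. Qed.
Lemma opDlV f : trilin f -> opDl s (opDl t f) = f.
Proof. by move=> fl; rewrite -opDlM // st1 opDl_1. Qed.
Lemma opDrV f : trilin f -> opDr s (opDr t f) = f.
Proof. by move=> fl; rewrite -opDrM // st1 opDr_1. Qed.

End Inverse.

End Operators.

Ltac tri :=
  first [ lin_hyp | lazymatch goal with
  | |- trilin (op12 _ _) => apply trilin_op12; tri
  | |- trilin (op13 _ _) => apply trilin_op13; tri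
  | |- trilin (op23 _ _) => apply trilin_op23; tri
  | |- trilin (opDl _ _ _) => apply trilin_opDl; [ assumption | tri ]
  | |- trilin (opDr _ _ _) => apply trilin_opDr; [ assumption | tri ]
  | |- trilin (swap23 _) => apply trilin_swap23; tri
  | |- trilin (rot3 _) => apply trilin_rot3; tri
  end ].

Section ThreeLegsExt.
Variables (C : numClosedFieldType) (K : algType C).

Definition pure3 (x y z : K) : K ⊗ K ⊗ K := x ⊗ y ⊗ z.

Lemma pure3_trilin : trilin pure3.
Proof. by rewrite /pure3; lin. Qed.

Lemma tsum3_pure3 T : tsum3 pure3 T = T.
Proof.
apply: (tensor3_ext (tsum3_linear pure3_trilin) (@lin_id _ _)) => x y z.
by rewrite tsum3E //; apply: pure3_trilin.
Qed.

(** Testing against the universal trilinear map [pure3] already suffices; this passes from the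
    operator calculus back to tensors. *)
Lemma eq_tsum3 (T T' : K ⊗ K ⊗ K) :
  (forall f : K -> K -> K -> K ⊗ K ⊗ K, trilin f -> tsum3 f T = tsum3 f T') -> T = T'.
Proof. by move=> e; rewrite -(tsum3_pure3 T) -(tsum3_pure3 T') e //; apply: pure3_trilin. Qed.

Lemma eq_tsum2 (s t : K ⊗ K) :
  (forall f : K -> K -> K ⊗ K, bilin f -> tsum f s = tsum f t) -> s = t.
Proof. by move=> e; rewrite -(tsum_tpure s) -(tsum_tpure t) e //; lin. Qed.

Variables (U : lmodType C) (f : K -> K -> K -> U).
Hypothesis fl : trilin f.

Lemma tsum3_13_23 s t : tsum3 f (leg13 s * leg23 t) = op13 s (op23 t f) 1 1 1.
Proof.
rewrite tsum3_mul // tsum3_leg13; last by rewrite /tsum3; lin.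
apply: eq_tsum => a b; rewrite tsum3_leg23; last by lin.
by apply: eq_tsum => c d; rewrite !mulr1 !mul1r.
Qed.

Lemma tsum3_13_12 s t : tsum3 f (leg13 s * leg12 t) = op13 s (op12 t f) 1 1 1.
Proof.
rewrite tsum3_mul // tsum3_leg13; last by rewrite /tsum3; lin.
apply: eq_tsum => a b; rewrite tsum3_leg12; last by lin.
by apply: eq_tsum => c d; rewrite !mulr1 !mul1r.
Qed.

Lemma tsum3_opDr (D : K -> K ⊗ K) t : tsum3 f (map_right D t) = opDr D t f 1 1 1.
Proof.
rewrite tsum3_map_right //; apply: eq_tsum => a b; apply: eq_tsum => c d.
by rewrite !mul1r.
Qed.

End ThreeLegsExt.

(** * For triangular R one hexagon implies the other *)

Section HexagonSymmetry.
Variables (C : numClosedFieldType) (K : algType C) (D : K -> K ⊗ K) (R : K ⊗ K).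
Hypotheses (Dl : linear D) (DM : forall k l, D (k * l) = D k * D l) (D1 : D 1 = 1).
Hypotheses (RV : R * tflip R = 1) (VR : tflip R * R = 1).
Hypothesis hexl : map_left D R = leg13 R * leg23 R.

Lemma hexl_op (U : lmodType C) (f : K -> K -> K -> U) : trilin f ->
  opDl D R f = op13 R (op23 R f).
Proof.
move=> fl; apply: eq_fun3 => x y z.
pose g a b c := f (x * a) (y * b) (z * c).
have gl : trilin g by rewrite /g; lin.
have := congr1 (tsum3 g) hexl; rewrite tsum3_map_left // => e.
rewrite -[LHS]/(\tsum_(c, d <- R) \tsum_(a, b <- D c) g a b d) e tsum3_13_23 //.
by apply: eq_tsum => a b; apply: eq_tsum => c d; rewrite /g !mul1r !mulrA.
Qed.

(* Invert [(D ⊗ id) R = R13 R23] and use [R^-1 = R21]. *)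
Lemma hexr_op (U : lmodType C) (f : K -> K -> K -> U) : trilin f ->
  opDr D R f = op13 R (op12 R f).
Proof.
(* [g y z x] is [f x y z]: the rotation, combined with the flip of [R], turns a coproduct of the
   first leg into a coproduct of the last one. *)
move=> fl; pose g := rot3 (rot3 f); have gl : trilin g by rewrite /g; tri.
have e : opDl D (tflip R) g = op23 (tflip R) (op13 (tflip R) g).
  pose h := op23 (tflip R) (op13 (tflip R) g).
  have hl : trilin h by rewrite /h; tri.
  transitivity (opDl D (tflip R) (opDl D R h)); last exact: opDlV.
  by rewrite (hexl_op hl) /h (op23V RV) ?(op13V RV) //; tri.
apply: eq_fun3 => x y z.
have := congr1 (fun F => F y z x) e; rewrite /opDl /op23 /op13.
do !(rewrite tsum_flip; last by rewrite /g /rot3; lin).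
move=> {}e; rewrite -[LHS]/(\tsum_(c, d <- R) \tsum_(a, b <- D d) g (y * a) (z * b) (x * c)) e.
by apply: eq_tsum => a b; rewrite tsum_flip //; rewrite /g /rot3; lin.
Qed.

(** Thanks to this only one hexagon has to be verified for the twisted R-matrix. *)
Lemma hexr_of_hexl : map_right D R = leg13 R * leg12 R.
Proof.
apply: eq_tsum3 => f fl; rewrite (tsum3_opDr fl) (tsum3_13_12 fl).
by rewrite (hexr_op fl).
Qed.

End HexagonSymmetry.

Lemma mul_conjM (B : nzRingType) (a b c d e : B) : e * a = 1 ->
  a * (b * c) * e = (a * b * e) * (a * c * e).
Proof. by move=> ea; rewrite !mulrA -(mulrA _ e) ea mulr1. Qed.

(** * Hopf algebra axioms after the twist *)

Section Twisting.
Variables (C : numClosedFieldType) (K : algType C) (H : hopf_data K) (F : K ⊗ K).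
Hypotheses (hR : triangular_Rmat H) (hF : is_twist H F).
Implicit Types (U : lmodType C).

Local Notation Δ := (comul H).
Local Notation ε := (counit H).
Local Notation S := (antipode H).
Local Notation R := (Rmat H).
Local Notation G := (Finv F).

Let hH := tri_hopf hR.
Let Dl := comul_linear hH.
Let DM := comul_mul hH.
Let D1 := comul_one hH.

Lemma twist_mulV : F * G = 1.
Proof. by case: (inv_eltP (twist_invertible hF)). Qed.

Lemma twist_Vmul : G * F = 1.
Proof. by case: (inv_eltP (twist_invertible hF)). Qed.

Let FG := twist_mulV.
Let GF := twist_Vmul.

Lemma twist_mulVE U (f : K -> K -> U) : bilin f ->
  \tsum_(f1, f2 <- F) \tsum_(g1, g2 <- G) f (f1 * g1) (f2 * g2) = f 1 1.
Proof. by move=> fb; rewrite -(tsum_one fb) -FG tsum_mul. Qed.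

Lemma twist_VmulE U (f : K -> K -> U) : bilin f ->
  \tsum_(g1, g2 <- G) \tsum_(f1, f2 <- F) f (g1 * f1) (g2 * f2) = f 1 1.
Proof. by move=> fb; rewrite -(tsum_one fb) -GF tsum_mul. Qed.

Lemma twist_cocycle_op U (f : K -> K -> K -> U) : trilin f ->
  op12 F (opDl Δ F f) = op23 F (opDr Δ F f).
Proof.
move=> fl; apply: eq_fun3 => x y z.
pose g a b c := f (x * a) (y * b) (z * c).
have gl : trilin g by rewrite /g; lin.
pose gr a b c := tsum3 (fun x' y' z' => g (a * x') (b * y') (c * z')) (map_right Δ F).
have grl : trilin gr by rewrite /gr /tsum3; lin.
pose ga a b c := tsum3 (fun x' y' z' => g (a * x') (b * y') (c * z')) (map_left Δ F).
have gal : trilin ga by rewrite /ga /tsum3; lin.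
have e := etrans (esym (tsum3_mul gl (leg12 F) (map_left Δ F)))
  (etrans (congr1 (tsum3 g) (twist_cocycle hF))
     (tsum3_mul gl (leg23 F) (map_right Δ F))).
have {}e := etrans (esym (tsum3_leg12 gal F)) (etrans e (tsum3_leg23 grl F)).
transitivity (\tsum_(a, b <- F) ga a b 1).
  apply: eq_tsum => a b; rewrite /ga tsum3_map_left; last by lin.
  by apply: eq_tsum => c d; apply: eq_tsum => p q; rewrite /g mul1r !mulrA.
rewrite e; apply: eq_tsum => a b; rewrite /gr tsum3_map_right; last by lin.
by apply: eq_tsum => c d; apply: eq_tsum => p q; rewrite /g mul1r !mulrA.
Qed.

(** Inverting both sides of the cocycle identity gives [(Δ ⊗ id)G G12 = (id ⊗ Δ)G G23]. It is this
    form that governs the twisted products and the multiplicativity of D. *)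
Lemma twist_cocycleV_op U (f : K -> K -> K -> U) : trilin f ->
  opDl Δ G (op12 G f) = opDr Δ G (op23 G f).
Proof.
move=> fl; pose h := opDr Δ G (op23 G f).
have hl : trilin h by rewrite /h; tri.
transitivity (opDl Δ G (op12 G (op12 F (opDl Δ F h)))).
  by rewrite (twist_cocycle_op hl) /h (opDrV Dl DM D1 FG) ?(op23V FG) //; tri.
by rewrite (op12V GF) ?(opDlV Dl DM D1 GF) //; tri.
Qed.

Lemma twist_counitl_inv U (f : K -> U) : linear f ->
  \tsum_(g1, g2 <- G) ε g1 *: f g2 = f 1.
Proof.
move=> fl; have el := counit_linear hH.
transitivity (\tsum_(f1, f2 <- F) \tsum_(g1, g2 <- G) ε (f1 * g1) *: f (f2 * g2)).
  rewrite exchange_tsum; apply: eq_tsum => g1 g2.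
  have al : linear (fun z => ε g1 *: f (z * g2)) by lin.
  transitivity (ε g1 *: f (1 * g2)); first by rewrite mul1r.
  rewrite -(twist_counitl hF) (lin_sum (h := fun z => ε g1 *: f (z * g2))) //.
  apply: eq_tsum => f1 f2; rewrite (linZ al) scalerA (counit_mul hH) //.
rewrite (twist_mulVE (f := fun x y => ε x *: f y)); last by lin.
by rewrite (counit_one hH) scale1r.
Qed.

Lemma twist_counitr_inv U (f : K -> U) : linear f ->
  \tsum_(g1, g2 <- G) ε g2 *: f g1 = f 1.
Proof.
move=> fl; have el := counit_linear hH.
transitivity (\tsum_(f1, f2 <- F) \tsum_(g1, g2 <- G) ε (f2 * g2) *: f (f1 * g1)).
  rewrite exchange_tsum; apply: eq_tsum => g1 g2.
  have al : linear (fun z => ε g2 *: f (z * g1)) by lin.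
  transitivity (ε g2 *: f (1 * g1)); first by rewrite mul1r.
  rewrite -(twist_counitr hF) (lin_sum (h := fun z => ε g2 *: f (z * g1))) //.
  apply: eq_tsum => f1 f2; rewrite (linZ al) scalerA (counit_mul hH) //.
rewrite (twist_mulVE (f := fun x y => ε y *: f x)); last by lin.
by rewrite (counit_one hH) scale1r.
Qed.

Lemma twist_counitlE U (f : K -> U) : linear f ->
  \tsum_(f1, f2 <- F) ε f1 *: f f2 = f 1.
Proof.
move=> fl; rewrite -(twist_counitl hF) (lin_sum _ _ fl).
by apply: eq_tsum => a b; rewrite (linZ fl).
Qed.

Lemma twist_counitrE U (f : K -> U) : linear f ->
  \tsum_(f1, f2 <- F) ε f2 *: f f1 = f 1.
Proof.
move=> fl; rewrite -(twist_counitr hF) (lin_sum _ _ fl).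
by apply: eq_tsum => a b; rewrite (linZ fl).
Qed.

Local Notation u := (twist_u H F).
(** The inverse of [u], which makes the default-valued [inv_elt u] explicit. *)
Definition twist_v : K := \tsum_(g1, g2 <- G) S g1 * g2.

(** [u v] is the contraction [a S(b) c] of [G23 F12], which by the cocycle identity equals
    [(id ⊗ Δ)F (Δ ⊗ id)G]. There the antipode axioms reduce the coproducts to counits, and [F] and
    [G] are normalised. *)
Lemma twist_uv : u * twist_v = 1.
Proof.
have Sl := antipode_linear hH.
pose f (a b c : K) : K := a * S b * c.
have fl : trilin f by rewrite /f; lin.
transitivity (op23 G (op12 F f) 1 1 1).
  rewrite /twist_v (lin_sum (h := fun z => _ * z)); last by lin.
  apply: eq_tsum => g1 g2; rewrite /twist_u (lin_sum (h := fun z => z * _)); last by lin.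
  apply: eq_tsum => f1 f2; rewrite /f !mul1r (antipodeM hH) !mulrA //.
have -> : op12 F f = op23 F (opDr Δ F (opDl Δ G f)).
  by rewrite -twist_cocycle_op ?(opDlV Dl DM D1 FG) //; tri.
rewrite (op23V GF); last by tri.
transitivity (\tsum_(f1, f2 <- F) \tsum_(g1, g2 <- G)
    ε f2 *: (ε g1 *: (f1 * g2))); last first.
  rewrite exchange_tsum; transitivity (\tsum_(g1, g2 <- G) ε g1 *: g2).
    apply: eq_tsum => g1 g2.
    by rewrite (twist_counitrE (f := fun x => ε g1 *: (x * g2))) ?mul1r //; lin.
  exact: (twist_counitl_inv (@lin_id _ _)).
apply: eq_tsum => f1 f2.
rewrite /opDl exchange_tsum; apply: eq_tsum => g1 g2.
transitivity (\tsum_(a, b <- Δ f2) \tsum_(c, d <- Δ g1)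
   f1 * (c * S d) * (S a * b) * g2).
  apply: eq_tsum => a b; apply: eq_tsum => c d.
  by rewrite /f !mul1r (antipodeM hH) !mulrA.
rewrite exchange_tsum.
transitivity (\tsum_(c, d <- Δ g1) ε f2 *: (f1 * (c * S d) * g2)).
  apply: eq_tsum => c d.
  rewrite (antipodelE hH (f := fun z => f1 * (c * S d) * z * g2)) ?mulr1 //; lin.
rewrite (antipoderE hH (f := fun z => ε f2 *: (f1 * z * g2))); last by lin.
by rewrite mulr1 !scalerA mulrC.
Qed.

(** As for [twist_uv], with the contraction [S(a) b S(c)] of [G12 F23 = (Δ ⊗ id)F (id ⊗ Δ)G]. *)
Lemma twist_vu : twist_v * u = 1.
Proof.
have Sl := antipode_linear hH.
pose f (a b c : K) : K := S a * b * S c.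
have fl : trilin f by rewrite /f; lin.
transitivity (op12 G (op23 F f) 1 1 1).
  rewrite /twist_v (lin_sum (h := fun z => z * _)); last by lin.
  apply: eq_tsum => g1 g2; rewrite /twist_u (lin_sum (h := fun z => _ * z)); last by lin.
  by apply: eq_tsum => f1 f2; rewrite /f !mul1r !mulrA.
have -> : op23 F f = op12 F (opDl Δ F (opDr Δ G f)).
  by rewrite twist_cocycle_op ?(opDrV Dl DM D1 FG) //; tri.
rewrite (op12V GF); last by tri.
transitivity (\tsum_(f1, f2 <- F) \tsum_(g1, g2 <- G)
    ε g2 *: (ε f1 *: (S g1 * S f2))); last first.
  transitivity (\tsum_(f1, f2 <- F) ε f1 *: (S 1 * S f2)).
    apply: eq_tsum => f1 f2.
    by rewrite (twist_counitr_inv (f := fun x => ε f1 *: (S x * S f2))); last by lin.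
  rewrite (twist_counitlE (f := fun x => S 1 * S x)); last by lin.
  by rewrite (antipode1 hH) mulr1.
apply: eq_tsum => f1 f2.
rewrite /opDr exchange_tsum; apply: eq_tsum => g1 g2.
transitivity (\tsum_(a, b <- Δ f1) \tsum_(c, d <- Δ g2)
   S g1 * (S a * b) * (c * S d) * S f2).
  apply: eq_tsum => a b; apply: eq_tsum => c d.
  by rewrite /f !mul1r !(antipodeM hH) !mulrA.
transitivity (\tsum_(a, b <- Δ f1) ε g2 *: (S g1 * (S a * b) * S f2)).
  apply: eq_tsum => a b.
  rewrite (antipoderE hH (f := fun z => S g1 * (S a * b) * z * S f2)) ?mulr1 //; lin.
rewrite (antipodelE hH (f := fun z => ε g2 *: (S g1 * z * S f2))); last by lin.
by rewrite mulr1 !scalerA mulrC.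
Qed.

Lemma inv_twist_u : inv_elt u = twist_v.
Proof. by apply: inv_elt_eq; split; [apply: twist_uv | apply: twist_vu]. Qed.

Local Notation HF := (twist_hopf H F).
Local Notation ΔF := (comul HF).
Local Notation SF := (antipode HF).

Lemma twist_comulE U (f : K -> K -> U) k : bilin f ->
  \tsum_(x, y <- ΔF k) f x y
  = \tsum_(f1, f2 <- F) \tsum_(x, y <- Δ k) \tsum_(g1, g2 <- G)
      f (f1 * x * g1) (f2 * y * g2).
Proof.
move=> fb; rewrite /twist_hopf /= tsum_mul //.
rewrite (tsum_mul (f := fun x y => \tsum_(g1, g2 <- G) f (x * g1) (y * g2))) //; lin.
Qed.

(** The [v] inside the twisted antipode meets the [F] of the twisted coproduct in [S(h1 f1) h2 f2],
    where [G F = 1] removes both. Next [S(k1) k2] gives [ε(k)], and the legs of [G] that are left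
    give [u v = 1]. *)
Lemma twist_antipodel k : \tsum_(x, y <- ΔF k) SF x * y = ε k *: 1.
Proof.
have Sl := antipode_linear hH.
rewrite twist_comulE /= ?inv_twist_u; last by lin.
transitivity (\tsum_(f1, f2 <- F) \tsum_(x, y <- Δ k) \tsum_(g1, g2 <- G)
    \tsum_(h1, h2 <- G) u * (S g1 * (S x * (S (h1 * f1) * (h2 * f2)) * y) * g2)).
  apply: eq_tsum => f1 f2; apply: eq_tsum => x y; apply: eq_tsum => g1 g2.
  rewrite {1}/twist_v (lin_sum (h := fun z => u * S (f1 * x * g1) * z * (f2 * y * g2))); last by lin.
  by apply: eq_tsum => h1 h2; rewrite !(antipodeM hH) !mulrA.
transitivity (\tsum_(x, y <- Δ k) \tsum_(g1, g2 <- G)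
    u * (S g1 * (S x * y) * g2)).
  rewrite exchange_tsum; apply: eq_tsum => x y.
  rewrite exchange_tsum; apply: eq_tsum => g1 g2.
  rewrite exchange_tsum.
  rewrite (twist_VmulE (f := fun a b => u * (S g1 * (S x * (S a * b) * y) * g2))); last by lin.
  by rewrite (antipode1 hH) !mulr1.
transitivity (\tsum_(g1, g2 <- G) ε k *: (u * (S g1 * g2))).
  rewrite exchange_tsum; apply: eq_tsum => g1 g2.
  by rewrite (antipodelE hH (f := fun z => u * (S g1 * z * g2))) ?mulr1 //; lin.
rewrite -(lin_sum (h := fun z => ε k *: (u * z))); last by lin.
by rewrite -/twist_v twist_uv.
Qed.

Lemma twist_antipoder k : \tsum_(x, y <- ΔF k) x * SF y = ε k *: 1.
Proof.
have Sl := antipode_linear hH.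
rewrite twist_comulE /= ?inv_twist_u; last by lin.
transitivity (\tsum_(f1, f2 <- F) \tsum_(x, y <- Δ k) \tsum_(g1, g2 <- G)
    \tsum_(h1, h2 <- F) f1 * (x * ((g1 * h1) * S (g2 * h2)) * S y) * S f2 * twist_v).
  apply: eq_tsum => f1 f2; apply: eq_tsum => x y; apply: eq_tsum => g1 g2.
  rewrite {1}/twist_u (lin_sum (h := fun z => f1 * x * g1 * (z * S (f2 * y * g2) * twist_v))); last by lin.
  by apply: eq_tsum => h1 h2; rewrite !(antipodeM hH) !mulrA.
transitivity (\tsum_(f1, f2 <- F) \tsum_(x, y <- Δ k)
    f1 * (x * S y) * S f2 * twist_v).
  apply: eq_tsum => f1 f2; apply: eq_tsum => x y.
  rewrite (twist_VmulE (f := fun a b => f1 * (x * (a * S b) * S y) * S f2 * twist_v)); last by lin.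
  by rewrite (antipode1 hH) !mulr1.
transitivity (\tsum_(f1, f2 <- F) ε k *: (f1 * S f2 * twist_v)).
  apply: eq_tsum => f1 f2.
  by rewrite (antipoderE hH (f := fun z => f1 * z * S f2 * twist_v)) ?mulr1 //; lin.
rewrite -(lin_sum (h := fun z => ε k *: (z * twist_v))); last by lin.
by rewrite -/u twist_uv.
Qed.

Lemma twist_comul_linear : linear ΔF.
Proof. by rewrite /twist_hopf /=; lin. Qed.

Lemma twist_comul_mul k l : ΔF (k * l) = ΔF k * ΔF l.
Proof.
by rewrite /= DM; apply: mul_conjM.
Qed.

Lemma twist_comul_one : ΔF 1 = 1.
Proof. by rewrite /= D1 mulr1 FG. Qed.

Lemma twist_map_left U (f : K -> K -> K -> U) t : trilin f ->
  tsum3 f (map_left ΔF t) = op12 F (opDl Δ t (op12 G f)) 1 1 1.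
Proof.
move=> fl; rewrite (tsum3_map_left fl) /op12 /opDl.
transitivity (\tsum_(x, z <- t) \tsum_(f1, f2 <- F) \tsum_(a, b <- Δ x)
   \tsum_(g1, g2 <- G) f (f1 * a * g1) (f2 * b * g2) z).
  by apply: eq_tsum => x z; rewrite (twist_comulE (f := fun a b => f a b z)) //; lin.
rewrite exchange_tsum; do 4!(apply: eq_tsum => ? ?).
by rewrite !mul1r.
Qed.

Lemma twist_map_right U (f : K -> K -> K -> U) t : trilin f ->
  tsum3 f (map_right ΔF t) = op23 F (opDr Δ t (op23 G f)) 1 1 1.
Proof.
move=> fl; rewrite (tsum3_map_right fl) /op23 /opDr.
transitivity (\tsum_(x, z <- t) \tsum_(f1, f2 <- F) \tsum_(a, b <- Δ z)
   \tsum_(g1, g2 <- G) f x (f1 * a * g1) (f2 * b * g2)).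
  by apply: eq_tsum => x z; rewrite (twist_comulE (f := fun a b => f x a b)) //; lin.
rewrite exchange_tsum; do 4!(apply: eq_tsum => ? ?).
by rewrite !mul1r.
Qed.

Lemma coassoc_op U (f : K -> K -> K -> U) k : trilin f ->
  opDl Δ (Δ k) f = opDr Δ (Δ k) f.
Proof.
move=> fl; apply: eq_fun3 => x y z; rewrite /opDl /opDr.
by rewrite (coassocE hH (f := fun a b c => f (x * a) (y * b) (z * c))) //; lin.
Qed.

(** The two sides are [F12 (Δ ⊗ id)(F Δ(k) G) G12] and its mirror image. They agree factor by
    factor: cocycle identity for [F], coassociativity, inverse cocycle identity for [G]. *)
Lemma twist_coassoc k : map_left ΔF (ΔF k) = map_right ΔF (ΔF k).
Proof.
apply: eq_tsum3 => f fl; rewrite (twist_map_left _ fl) (twist_map_right _ fl).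
have Fl : opDl Δ (ΔF k) (op12 G f) = opDl Δ F (opDl Δ (Δ k) (opDl Δ G (op12 G f))).
  rewrite -[comul (twist_hopf H F) k]/(F * Δ k * G).
  by rewrite (opDlM Dl DM) ?(opDlM Dl DM) //; tri.
have Fr : opDr Δ (ΔF k) (op23 G f) = opDr Δ F (opDr Δ (Δ k) (opDr Δ G (op23 G f))).
  rewrite -[comul (twist_hopf H F) k]/(F * Δ k * G).
  by rewrite (opDrM Dl DM) ?(opDrM Dl DM) //; tri.
rewrite Fl Fr twist_cocycle_op; last by tri.
by rewrite coassoc_op ?twist_cocycleV_op //; tri.
Qed.

Lemma twist_counitl_comul k : \tsum_(x, y <- ΔF k) ε x *: y = k.
Proof.
rewrite (twist_comulE (f := fun x y => ε x *: y)); last by lin.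
transitivity (\tsum_(f1, f2 <- F) \tsum_(x, y <- Δ k) ε f1 *: (ε x *: (f2 * y))).
  apply: eq_tsum => f1 f2; apply: eq_tsum => x y.
  transitivity (\tsum_(g1, g2 <- G) ε g1 *: (ε f1 *: (ε x *: (f2 * y * g2)))).
    by apply: eq_tsum => g1 g2; rewrite !(counit_mul hH) !scalerA mulrC mulrA.
  by rewrite (twist_counitl_inv (f := fun z => ε f1 *: (ε x *: (f2 * y * z)))) ?mulr1 //; lin.
transitivity (\tsum_(x, y <- Δ k) ε x *: y); last exact: comul_counitl.
rewrite exchange_tsum; apply: eq_tsum => x y.
by rewrite (twist_counitlE (f := fun z => ε x *: (z * y))) ?mul1r //; lin.
Qed.

Lemma twist_counitr_comul k : \tsum_(x, y <- ΔF k) ε y *: x = k.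
Proof.
rewrite (twist_comulE (f := fun x y => ε y *: x)); last by lin.
transitivity (\tsum_(f1, f2 <- F) \tsum_(x, y <- Δ k) ε f2 *: (ε y *: (f1 * x))).
  apply: eq_tsum => f1 f2; apply: eq_tsum => x y.
  transitivity (\tsum_(g1, g2 <- G) ε g2 *: (ε f2 *: (ε y *: (f1 * x * g1)))).
    by apply: eq_tsum => g1 g2; rewrite !(counit_mul hH) !scalerA mulrC mulrA.
  by rewrite (twist_counitr_inv (f := fun z => ε f2 *: (ε y *: (f1 * x * z)))) ?mulr1 //; lin.
transitivity (\tsum_(x, y <- Δ k) ε y *: x); last exact: comul_counitr.
rewrite exchange_tsum; apply: eq_tsum => x y.
by rewrite (twist_counitrE (f := fun z => ε y *: (z * x))) ?mul1r //; lin.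
Qed.

Lemma twist_is_hopf : hopf_algebra HF.
Proof.
split.
- exact: twist_comul_linear.
- exact: twist_comul_mul.
- exact: twist_comul_one.
- exact: counit_linear hH.
- exact: counit_mul hH.
- exact: counit_one hH.
- exact: twist_coassoc.
- exact: twist_counitl_comul.
- exact: twist_counitr_comul.
- by have Sl := antipode_linear hH; rewrite /twist_hopf /=; lin.
- exact: twist_antipodel.
- exact: twist_antipoder.
Qed.

End Twisting.

Lemma mulr_twistV (B : nzRingType) (f f' g g' r r' : B) :
  f * g = 1 -> g * f = 1 -> f' * g' = 1 -> r * r' = 1 ->
  (f' * r * g) * (f * r' * g') = 1.
Proof.
move=> fg gf fg' rr'.
by rewrite !mulrA -(mulrA _ g) gf mulr1 -(mulrA _ r) rr' mulr1.
Qed.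

Lemma mulr_twist_comul (B : nzRingType) (f f' g g' r d d' : B) :
  g * f = 1 -> g' * f' = 1 -> d' * r = r * d ->
  (f' * d' * g') * (f' * r * g) = (f' * r * g) * (f * d * g).
Proof.
move=> gf gf' dr; rewrite !mulrA -(mulrA _ g') gf' mulr1 -(mulrA _ d') dr.
by rewrite -(mulrA _ g f) gf mulr1 !mulrA.
Qed.

(** * The twisted R-matrix *)

Section TwistRmat.
Variables (C : numClosedFieldType) (K : algType C) (H : hopf_data K) (F : K ⊗ K).
Hypotheses (hR : triangular_Rmat H) (hF : is_twist H F).
Implicit Types (U : lmodType C).

Local Notation Δ := (comul H).
Local Notation R := (Rmat H).
Local Notation G := (Finv F).
Local Notation HF := (twist_hopf H F).

Let hH := tri_hopf hR.
Let Dl := comul_linear hH.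
Let DM := comul_mul hH.
Let D1 := comul_one hH.
Let FG := twist_mulV hF.
Let GF := twist_Vmul hF.
Let F21 := tflip F.
Let G21 := tflip G.

Let FG21 : F21 * G21 = 1. Proof. by rewrite -tflipM FG tflip1. Qed.
Let GF21 : G21 * F21 = 1. Proof. by rewrite -tflipM GF tflip1. Qed.

Lemma twist_Rmat_flip : tflip (Rmat HF) = F * tflip R * G21.
Proof. by rewrite /= !tflipM tflipK. Qed.

Lemma twist_Rmat_mulV : Rmat HF * tflip (Rmat HF) = 1.
Proof.
rewrite twist_Rmat_flip -[Rmat HF]/(F21 * R * G).
exact: (mulr_twistV FG GF FG21 (tri_mulV hR)).
Qed.

Lemma twist_Rmat_comul k : tflip (comul HF k) * Rmat HF = Rmat HF * comul HF k.
Proof.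
rewrite -[comul HF k]/(F * Δ k * G) -[Rmat HF]/(F21 * R * G) !tflipM.
exact: (mulr_twist_comul GF GF21 (tri_comul hR k)).
Qed.

(* The flipped coproduct in the last two legs, resp. the first and last ones. *)
Definition opDrc U t (f : K -> K -> K -> U) x y z :=
  \tsum_(c, d <- t) \tsum_(a, b <- Δ d) f (x * c) (y * b) (z * a).
Definition opDm U t (f : K -> K -> K -> U) x y z :=
  \tsum_(c, d <- t) \tsum_(a, b <- Δ c) f (x * a) (y * d) (z * b).
Definition opDmc U t (f : K -> K -> K -> U) x y z :=
  \tsum_(c, d <- t) \tsum_(a, b <- Δ c) f (x * b) (y * d) (z * a).

Lemma trilin_opDmc U t (f : K -> K -> K -> U) : trilin f -> trilin (opDmc t f).
Proof. by move=> fl; rewrite /opDmc; lin. Qed.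

Lemma Rmat_opDr U t (f : K -> K -> K -> U) : trilin f ->
  op23 R (opDr Δ t f) = opDrc t (op23 R f).
Proof.
move=> fl; apply: eq_fun3 => x y z; rewrite /op23 /opDr /opDrc exchange_tsum.
apply: eq_tsum => c d.
transitivity (\tsum_(r1, r2 <- R) \tsum_(a, b <- Δ d) f (x * c) (y * (r1 * a)) (z * (r2 * b))).
  by do 2!(apply: eq_tsum => ? ?); rewrite !mulrA.
rewrite (Rmat_comulE hR (f := fun a b => f (x * c) (y * a) (z * b))); last by lin.
by do 2!(apply: eq_tsum => ? ?); rewrite !mulrA.
Qed.

Lemma Rmat_opDm U t (f : K -> K -> K -> U) : trilin f ->
  op13 R (opDm t f) = opDmc t (op13 R f).
Proof.
move=> fl; apply: eq_fun3 => x y z; rewrite /op13 /opDm /opDmc exchange_tsum.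
apply: eq_tsum => c d.
transitivity (\tsum_(r1, r2 <- R) \tsum_(a, b <- Δ c) f (x * (r1 * a)) (y * d) (z * (r2 * b))).
  by do 2!(apply: eq_tsum => ? ?); rewrite !mulrA.
rewrite (Rmat_comulE hR (f := fun a b => f (x * a) (y * d) (z * b))); last by lin.
by do 2!(apply: eq_tsum => ? ?); rewrite !mulrA.
Qed.

(* The cocycle condition with its last two legs exchanged. *)
Lemma twist_cocycle_swap U (f : K -> K -> K -> U) : trilin f ->
  opDrc G f = opDm G (op13 G (op23 F21 f)).
Proof.
move=> fl; pose g := swap23 f.
have gl : trilin g by rewrite /g; tri.
have e : opDr Δ G g = opDl Δ G (op12 G (op23 F g)).
  by rewrite (twist_cocycleV_op hR hF) ?(op23V GF) //; tri.
apply: eq_fun3 => x y z.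
transitivity (opDl Δ G (op12 G (op23 F g)) x z y); first by rewrite -e.
rewrite /opDl /op12 /op23 /opDm /op13; do 3!(apply: eq_tsum => ? ?).
by rewrite tsum_flip //; lin.
Qed.

(* The cocycle condition with its legs cyclically permuted. *)
Lemma twist_cocycle_rot U (f : K -> K -> K -> U) : trilin f ->
  op12 F (opDl Δ F21 f) = op13 F21 (opDmc F f).
Proof.
move=> fl; pose g := rot3 f; have gl : trilin g by rewrite /g; tri.
apply: eq_fun3 => x y z.
have := congr1 (fun h => h z x y) (twist_cocycle_op hF gl).
rewrite /op12 /op13 /opDl /opDmc /op23 /opDr => e.
rewrite tsum_flip; last by lin.
rewrite -[RHS]/(\tsum_(a, b <- F) \tsum_(c, d <- F) \tsum_(p, q <- Δ c)
   g (z * a * p) (x * b * q) (y * d)) e.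
by apply: eq_tsum => a b; rewrite tsum_flip //; lin.
Qed.

Lemma opDmcV U (f : K -> K -> K -> U) : trilin f -> opDmc F (opDmc G f) = f.
Proof.
move=> fl; pose g a b c := f b c a; have gl : trilin g by rewrite /g; lin.
apply: eq_fun3 => x y z.
exact: (congr1 (fun h => h z x y) (opDlV Dl DM D1 FG gl)).
Qed.

(** Start from [F12 (Δ ⊗ id)(F21 R G) G12] and split [R] into [R13 R23] by the hexagon.
    Quasi-cocommutativity carries [R23], then [R13], to the right across a coproduct of [G], and
    between these moves the three forms of the cocycle identity rearrange the twists. What remains
    is [F31 R13 G13] times [F32 R23 G23]. *)
Lemma twist_Rmat_hexl :
  map_left (comul HF) (Rmat HF) = leg13 (Rmat HF) * leg23 (Rmat HF).
Proof.
apply: eq_tsum3 => f fl; rewrite (twist_map_left H F _ fl) (tsum3_13_23 fl).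
have t1 : trilin (op23 R (op23 G f)) by tri.
have t2 : trilin (op23 F21 (op23 R (op23 G f))) by tri.
have t3 : trilin (op13 G (op23 F21 (op23 R (op23 G f)))) by tri.
have t4 : trilin (op13 R (op13 G (op23 F21 (op23 R (op23 G f))))) by tri.
have t5 : trilin (opDmc G (op13 R (op13 G (op23 F21 (op23 R (op23 G f)))))).
  exact: trilin_opDmc.
have -> : opDl Δ (Rmat HF) (op12 G f) = opDl Δ F21 (opDl Δ R (opDl Δ G (op12 G f))).
  rewrite -[Rmat HF]/(F21 * R * G).
  by rewrite (opDlM Dl DM) ?(opDlM Dl DM) //; tri.
rewrite (hexl_op (tri_hexl hR)); last by tri.
rewrite (twist_cocycleV_op hR hF fl) Rmat_opDr; last by tri.
rewrite (twist_cocycle_swap t1) (Rmat_opDm _ t3) (twist_cocycle_rot t5) (opDmcV t4).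
have -> : op23 (Rmat HF) f = op23 F21 (op23 R (op23 G f)).
  by rewrite -[Rmat HF]/(F21 * R * G) !op23M //; tri.
by rewrite -[Rmat HF]/(F21 * R * G) !op13M //; tri.
Qed.

Lemma twist_triangular : triangular_Rmat HF.
Proof.
have hHF := twist_is_hopf hR hF.
have VR : tflip (Rmat HF) * Rmat HF = 1.
  by rewrite -[X in _ * X]tflipK -tflipM twist_Rmat_mulV tflip1.
split.
- exact: hHF.
- exact: twist_Rmat_mulV.
- exact: twist_Rmat_comul.
- exact: twist_Rmat_hexl.
exact: (hexr_of_hexl (comul_linear hHF) (comul_mul hHF) (comul_one hHF)
  twist_Rmat_mulV VR twist_Rmat_hexl).
Qed.

End TwistRmat.

Section BalancedSums.
Variables (C : numClosedFieldType).
Implicit Types (V W : lmodType C) (U : zmodType).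

Lemma balanced_tmap V W V' W' U (f : V' -> W' -> U) (g : V -> V') (h : W -> W') t :
  balanced f -> tsum f (tmap g h t) = \tsum_(x, y <- t) f (g x) (h y).
Proof.
move=> fb; apply: etrans (balanced_tsum _ _ fb) _.
by apply: eq_tsum => x y; apply: tsum_pure.
Qed.

Lemma balanced_flip V W U (f : W -> V -> U) (t : V ⊗ W) :
  balanced f -> tsum f (tflip t) = \tsum_(x, y <- t) f y x.
Proof.
move=> fb; apply: etrans (balanced_tsum _ _ fb) _.
by apply: eq_tsum => x y; apply: tsum_pure.
Qed.

Lemma balanced_mul (B : algType C) U (f : B -> B -> U) (s t : B ⊗ B) : balanced f ->
  tsum f (s * t) = \tsum_(x, y <- s) \tsum_(x', y' <- t) f (x * x') (y * y').
Proof.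
move=> fb; rewrite tmulE; apply: etrans (balanced_tsum _ _ fb) _.
apply: eq_tsum => x y; apply: etrans (balanced_tsum _ _ fb) _.
by apply: eq_tsum => x' y'; apply: tsum_pure.
Qed.

End BalancedSums.

(** * The conjugation of the twisted Hopf algebra *)

Section TwistConj.
Variables (C : numClosedFieldType) (K : algType C) (H : hopf_data K) (F : K ⊗ K).
Hypotheses (hT : triangular_hopf_star_algebra H) (hF : is_twist H F).

Local Notation G := (Finv F).
Local Notation HF := (twist_hopf H F).
Local Notation s := (hconj H).

Let hR := triangular_star_Rmat hT.
Let hs := hconj_structure hT.

(** Applying the involution to both legs of [twist_star] cancels it on the left and turns [S] into
    [s] on the right: [F = (s ⊗ s)F21]. *)
Lemma twist_conj_tensor : \tsum_(f1, f2 <- F) s f1 ⊗ s f2 = tflip F.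
Proof.
have fb : bilin (fun x y : K => x ⊗ y) by lin.
have sa := star_antilinear (is_star hT).
have sK := star_involutive (is_star hT).
have bs := balanced_antilin sa sa fb.
have bh := balanced_antilin (conj_antilinear hs) (conj_antilinear hs) fb.
have e := congr1 (tsum (fun x y => hstar H x ⊗ hstar H y)) (twist_star hF).
have {}e := etrans (esym (balanced_tmap _ _ _ bs)) (etrans e (balanced_tmap _ _ _ bs)).
have {}e : F = \tsum_(x, y <- F) s y ⊗ s x.
  rewrite -[LHS]tsum_tpure; apply: etrans (etrans e (balanced_flip _ bh)).
  by apply: eq_tsum => x y; rewrite !sK.
rewrite {2}e (lin_sum _ _ (@tflip_linear _ _ _)).
by apply: eq_tsum => x y; rewrite tflipE.
Qed.

Lemma twist_conjE (U : lmodType C) (f : K -> K -> U) : bilin f ->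
  \tsum_(f1, f2 <- F) f (s f1) (s f2) = \tsum_(f1, f2 <- F) f f2 f1.
Proof.
move=> fb; rewrite -(tsum_flip _ fb) -twist_conj_tensor (tsum_tsum _ _ fb).
by apply: eq_tsum => x y; rewrite (tsumE _ _ fb).
Qed.

(** Since [s] is multiplicative, [(s ⊗ s)G] is the inverse of [(s ⊗ s)F = F21], that is [G21]. *)
Lemma twist_conj_invE (U : lmodType C) (f : K -> K -> U) : bilin f ->
  \tsum_(g1, g2 <- G) f (s g1) (s g2) = \tsum_(g1, g2 <- G) f g2 g1.
Proof.
move=> fb; have s1 := conj1 hs; have sM := conjM hs; have sa := conj_antilinear hs.
transitivity (\tsum_(h1, h2 <- G) \tsum_(f1, f2 <- F) \tsum_(g1, g2 <- G)
    f (h2 * (s f1 * s g1)) (h1 * (s f2 * s g2))); last first.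
  apply: eq_tsum => h1 h2.
  have gb : bilin (fun x y => f (h2 * x) (h1 * y)) by lin.
  have bg := balanced_antilin sa sa gb.
  transitivity (tsum (fun x y => f (h2 * s x) (h1 * s y)) (F * G)).
    rewrite (balanced_mul _ _ bg); do 2!(apply: eq_tsum => ? ?).
    by rewrite !sM.
  by rewrite (twist_mulV hF) tensor_oneE (tsum_pure bg) s1 !mulr1.
transitivity (\tsum_(h1, h2 <- G) \tsum_(f1, f2 <- F) \tsum_(g1, g2 <- G)
    f (h2 * (f2 * s g1)) (h1 * (f1 * s g2))); last first.
  apply: eq_tsum => h1 h2; apply: esym.
  rewrite (twist_conjE (f := fun x y => \tsum_(g1, g2 <- G)
     f (h2 * (x * s g1)) (h1 * (y * s g2)))) //; lin.
under [RHS]eq_tsum => h1 h2 do rewrite exchange_tsum.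
rewrite exchange_tsum; apply: eq_tsum => g1 g2.
transitivity (f (1 * s g1) (1 * s g2)); first by rewrite !mul1r.
rewrite -(twist_VmulE hF (f := fun x y => f (y * s g1) (x * s g2))); last by lin.
by do 2!(apply: eq_tsum => ? ?); rewrite !mulrA.
Qed.

Lemma twist_hconj k : hstar HF k = antipode HF (s k).
Proof. by rewrite /= (hstar_hconj hT). Qed.

Lemma conj_mul3E (U : lmodType C) (f : K -> K -> U) (a b c : K ⊗ K) : bilin f ->
  tsum (fun x y => f (s x) (s y)) (a * b * c)
  = \tsum_(x, y <- a) \tsum_(x', y' <- b) \tsum_(z, z' <- c)
     f (s x * s x' * s z) (s y * s y' * s z').
Proof.
have sM := conjM hs; have sa := conj_antilinear hs.
have mul2 (h : K -> K -> U) (p q : K ⊗ K) : bilin h ->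
    tsum (fun x y => h (s x) (s y)) (p * q)
    = \tsum_(x, y <- p) \tsum_(x', y' <- q) h (s x * s x') (s y * s y').
  move=> hb; rewrite (balanced_mul _ _ (balanced_antilin sa sa hb)).
  by do 2!(apply: eq_tsum => ? ?); rewrite !sM.
move=> fb; rewrite (mul2 _ _ _ fb).
pose h x y := \tsum_(z, z' <- c) f (x * s z) (y * s z').
have hb : bilin h by rewrite /h; lin.
exact: (mul2 h a b hb).
Qed.

(** [s] is applied factor by factor and exchanges each of [F], [R], [G] with its flip. So [F21 R G]
    becomes [F R21 G21], the flip of the twisted R-matrix; the coproduct is treated likewise. *)
Lemma twist_conj_structure : conj_structure HF s.
Proof.
have s1 := conj1 hs; have sM := conjM hs; have sa := conj_antilinear hs.
split; [exact: sa | exact: sM | exact: conjK hs | exact: conj_counit hs | | ].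
  move=> k; apply: eq_tsum2 => f fb.
  have fb' : bilin (fun a b => f b a) by lin.
  apply: etrans (twist_comulE H F (s k) fb) _.
  apply: etrans (esym (tsum_tsum _ _ fb)).
  transitivity (tsum (fun x y => f (s y) (s x)) (F * comul H k * G)); last first.
    by apply: eq_tsum => x y; rewrite (tsumE _ _ fb).
  rewrite (conj_mul3E _ _ _ fb').
  transitivity (\tsum_(f1, f2 <- F) \tsum_(x, y <- comul H k) \tsum_(g1, g2 <- G)
      f (f1 * s y * s g2) (f2 * s x * s g1)); last first.
    rewrite (twist_conjE (f := fun a b => \tsum_(x, y <- comul H k)
      \tsum_(g1, g2 <- G) f (b * s y * s g2) (a * s x * s g1))) //; lin.
  apply: eq_tsum => f1 f2.
  rewrite (conj_comulE hs (f := fun x y => \tsum_(g1, g2 <- G)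
    f (f1 * x * g1) (f2 * y * g2))); last by lin.
  apply: eq_tsum => x y; apply: esym.
  by rewrite (twist_conj_invE (f := fun a b => f (f1 * s y * b) (f2 * s x * a))) //; lin.
apply: eq_tsum2 => f fb.
rewrite twist_Rmat_flip; apply: etrans (tsum_tsum _ _ fb) _.
transitivity (tsum (fun x y => f (s x) (s y)) (tflip F * Rmat H * G)).
  by apply: eq_tsum => x y; rewrite (tsumE _ _ fb).
rewrite (conj_mul3E _ _ _ fb) (tsum_mul _ _ fb).
rewrite (tsum_mul (f := fun x y => \tsum_(x', y' <- tflip G) f (x * x') (y * y'))); last by lin.
have bh : balanced (fun x y : K => \tsum_(x', y' <- Rmat H) \tsum_(z, z' <- G)
    f (s x * s x' * s z) (s y * s y' * s z')).
  apply: (balanced_antilin sa sa (f := fun x y => \tsum_(x', y' <- Rmat H)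
    \tsum_(z, z' <- G) f (x * s x' * s z) (y * s y' * s z'))); lin.
rewrite (balanced_flip _ bh).
rewrite (twist_conjE (f := fun a b => \tsum_(x', y' <- Rmat H) \tsum_(z, z' <- G)
    f (b * s x' * s z) (a * s y' * s z'))); last by lin.
apply: eq_tsum => f1 f2.
rewrite (conj_RmatE hs (f := fun a b => \tsum_(z, z' <- G)
    f (f1 * a * s z) (f2 * b * s z'))); last by lin.
rewrite tsum_flip; last by lin.
apply: eq_tsum => r1 r2.
rewrite (twist_conj_invE (f := fun a b => f (f1 * r2 * a) (f2 * r1 * b))); last by lin.
by rewrite tsum_flip //; lin.
Qed.

Lemma twist_triangular_star : triangular_hopf_star_algebra HF.
Proof.
exact: conj_triangular_star (twist_triangular hR hF) twist_conj_structure twist_hconj.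
Qed.

End TwistConj.

(** * Braided commutators *)

Section ModuleAlgebra.
Variables (C : numClosedFieldType) (K : algType C) (H : hopf_data K).
Variables (E : lmodType C) (act : K -> E -> E) (mul : E -> E -> E).

Definition act_multiplicative := forall k x y,
  act k (mul x y) = \tsum_(k1, k2 <- comul H k) mul (act k1 x) (act k2 y).

(** The product composed with the braiding, again associative by [bop_assoc]; [bbr] is the braided
    commutator. *)
Definition bop (x y : E) : E := \tsum_(r1, r2 <- Rmat H) mul (act r2 y) (act r1 x).
Definition bbr (x y : E) : E := mul x y - bop x y.

Lemma module_bilin : is_module act -> bilin act.
Proof. by move=> am; split; [apply: act_linearl | apply: act_linear]. Qed.

Hypotheses (hR : triangular_Rmat H) (am : is_module act) (mb : bilin mul).
Hypotheses (mA : associative mul) (aM : act_multiplicative).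

Let ab : bilin act := module_bilin am.
Let aa k l x : act k (act l x) = act (k * l) x. Proof. by rewrite (act_mul am). Qed.
Let a1 x : act 1 x = x. Proof. exact: act_one am x. Qed.
Let R := Rmat H.

Lemma bop_bilin : bilin bop.
Proof. by rewrite /bop; lin. Qed.

Lemma bbr_bilin : bilin bbr.
Proof. by have bb := bop_bilin; rewrite /bbr; lin. Qed.

Let bb := bop_bilin.

(** For triangular [R] the braiding squares to the identity. *)
Lemma bop_flip x y : \tsum_(r1, r2 <- R) bop (act r2 y) (act r1 x) = mul x y.
Proof.
rewrite -[in RHS](a1 x) -[in RHS](a1 y).
rewrite -(Rmat_Vmul hR (f := fun a b => mul (act a x) (act b y))); last by lin.
rewrite exchange_tsum; do 2!(apply: eq_tsum => ? ?).
by rewrite !aa.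
Qed.

(** By the hexagon, [x] passes over a product by passing over its factors one at a time. *)
Lemma bop_mulr x y z :
  bop x (mul y z) = \tsum_(r1, r2 <- R) mul (act r2 y) (bop (act r1 x) z).
Proof.
transitivity (\tsum_(r1, r2 <- R) \tsum_(a, b <- comul H r2)
   mul (mul (act a y) (act b z)) (act r1 x)).
  apply: eq_tsum => r1 r2; rewrite aM (lin_sum (h := fun w => mul w _)) //; lin.
rewrite (Rmat_hexrE hR (f := fun r a b => mul (mul (act a y) (act b z)) (act r x))); last by lin.
rewrite exchange_tsum; apply: eq_tsum => s1 s2.
rewrite /bop (lin_sum (h := fun w => mul _ w)); last by lin.
by apply: eq_tsum => r1 r2; rewrite aa mA.
Qed.

(** Both sides reverse the order of [x], [y], [z]; the two ways to do so agree by the Yang-Baxter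
    equation. *)
Lemma bop_assoc x y z : bop x (bop y z) = bop (bop x y) z.
Proof.
pose f a b c := mul (act c z) (mul (act b y) (act a x)).
have fl : trilin f by rewrite /f; lin.
transitivity (\tsum_(t1, t2 <- R) \tsum_(s1, s2 <- R) \tsum_(r1, r2 <- R)
   f (t1 * s1) (t2 * r1) (s2 * r2)).
  rewrite exchange_tsum; under [RHS]eq_tsum => ? ? do rewrite exchange_tsum.
  rewrite exchange_tsum {2}/bop (lin_sum (h := fun w => bop x w)); last by lin.
  apply: eq_tsum => r1 r2; rewrite bop_mulr; apply: eq_tsum => s1 s2.
  rewrite /bop (lin_sum (h := fun w => mul _ w)); last by lin.
  by apply: eq_tsum => t1 t2; rewrite /f !aa.
rewrite (yang_baxterE hR fl) {2}/bop (lin_sum (h := fun w => bop w z)); last by lin.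
apply: eq_tsum => t1 t2.
transitivity (\tsum_(r1, r2 <- R) \tsum_(a, b <- comul H r1)
   f (b * t1) (a * t2) r2).
  rewrite (Rmat_hexlE hR (f := fun a b c => f (b * t1) (a * t2) c)); last by lin.
  by rewrite exchange_tsum.
apply: eq_tsum => r1 r2; rewrite aM (lin_sum (h := fun w => mul _ w)); last by lin.
by apply: eq_tsum => a b; rewrite /f !aa.
Qed.

Lemma bop_mull_sum x y z :
  \tsum_(r1, r2 <- R) bop (act r2 y) (mul (act r1 x) z) = mul x (bop y z).
Proof.
transitivity (\tsum_(s1, s2 <- R) \tsum_(r1, r2 <- R)
    mul (act (s2 * r1) x) (bop (act (s1 * r2) y) z)).
  rewrite exchange_tsum; apply: eq_tsum => r1 r2; rewrite bop_mulr.
  by apply: eq_tsum => s1 s2; rewrite !aa.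
rewrite (Rmat_Vmul hR (f := fun a b => mul (act a x) (bop (act b y) z))); last by lin.
by rewrite !a1.
Qed.

Lemma bbr_antisym x y : bbr x y = - \tsum_(r1, r2 <- R) bbr (act r2 y) (act r1 x).
Proof. by rewrite /bbr tsum_sub bop_flip opprB. Qed.

Lemma bop_act k x y :
  act k (bop x y) = \tsum_(k1, k2 <- comul H k) bop (act k1 x) (act k2 y).
Proof.
transitivity (\tsum_(x1, x2 <- comul H k) \tsum_(r1, r2 <- R)
   mul (act (x1 * r2) y) (act (x2 * r1) x)).
  rewrite exchange_tsum (lin_sum _ _ (act_linear am k)); apply: eq_tsum => r1 r2.
  by rewrite aM; apply: eq_tsum => a b; rewrite !aa.
rewrite -(Rmat_comulE hR (f := fun a b => mul (act b y) (act a x))); last by lin.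
rewrite exchange_tsum; do 2!(apply: eq_tsum => ? ?).
by rewrite !aa.
Qed.

Lemma bbr_act k x y :
  act k (bbr x y) = \tsum_(k1, k2 <- comul H k) bbr (act k1 x) (act k2 y).
Proof. by rewrite /bbr (linB (act_linear am k)) tsum_sub aM bop_act. Qed.

(** [bop_mulr], [bop_mull_sum], [bop_flip] and [bop_assoc] absorb every sum over [R]. Six monomials
    are left, and the identity between them is a cancellation in an abelian group. *)
Lemma bbr_jacobi x y z :
  bbr x (bbr y z) = bbr (bbr x y) z
    + \tsum_(r1, r2 <- R) bbr (act r2 y) (bbr (act r1 x) z).
Proof.
rewrite /bbr (linB (proj2 mb _)) (linB (proj2 bb _)) (linB (proj1 mb _)).
rewrite (linB (proj1 bb _)).
have -> : \tsum_(r1, r2 <- R) (mul (act r2 y) (mul (act r1 x) z - bop (act r1 x) z)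
    - bop (act r2 y) (mul (act r1 x) z - bop (act r1 x) z))
  = mul (bop x y) z - bop x (mul y z) - (mul x (bop y z) - bop (mul x y) z).
  transitivity (\tsum_(r1, r2 <- R)
      (mul (act r2 y) (mul (act r1 x) z) - mul (act r2 y) (bop (act r1 x) z)
       - (bop (act r2 y) (mul (act r1 x) z) - bop (act r2 y) (bop (act r1 x) z)))).
    by apply: eq_tsum => r1 r2; rewrite (linB (proj2 mb _)) (linB (proj2 bb _)).
  rewrite !tsum_sub bop_mull_sum -bop_mulr; congr (_ - _ - (_ - _)).
    rewrite [in RHS]/bop (lin_sum _ _ (proj1 mb z)).
    by apply: eq_tsum => r1 r2; rewrite mA.
  rewrite -(bop_flip x y) (lin_sum _ _ (proj1 bb z)).
  by apply: eq_tsum => r1 r2; rewrite bop_assoc.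
rewrite mA bop_assoc.
move: (mul (mul x y) z) (mul x (bop y z)) (bop x (mul y z)) (bop (bop x y) z)
  (mul (bop x y) z) (bop (mul x y) z) => p1 p2 p3 p4 p5 p6.
have -> : p1 - p5 - (p6 - p4) + (p5 - p3 - (p2 - p6)) = p1 - p3 - (p2 - p4).
  rewrite addrACA -opprD; congr (_ + - _); first by rewrite addrA subrK.
  by rewrite [LHS]addrC addrA subrK.
by rewrite !opprB addrACA [RHS]addrACA [- p2 - p3]addrC.
Qed.

End ModuleAlgebra.

(** For an algebra [E] with an algebra map [rho : K -> E] through which [K] acts
    by the adjoint action, [tw x = (g1 ▷ x) rho(g2)], summed over [G]. Both the
    map [D] of the theorem ([G] inverse to the twist) and, up to conjugation,
    the [*]-structure on derivations ([G] inverse to [R]) are of this form. *)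
Section InnerAction.
Variables (C : numClosedFieldType) (K : algType C) (H : hopf_data K).
Variables (E : lmodType C) (act : K -> E -> E) (mul : E -> E -> E) (one : E).
Variable (rho : K -> E).
Implicit Types (G : K ⊗ K).

Definition inner_action := forall k x,
  mul (rho k) x = \tsum_(k1, k2 <- comul H k) mul (act k1 x) (rho k2).

Definition tw G (x : E) : E := \tsum_(g1, g2 <- G) mul (act g1 x) (rho g2).

Hypotheses (hH : hopf_algebra H) (am : is_module act) (mb : bilin mul).
Hypotheses (mA : associative mul) (m1r : right_id one mul).
Hypotheses (rl : linear rho) (rM : forall k l, rho (k * l) = mul (rho k) (rho l)).
Hypotheses (r1 : rho 1 = one).

Let ab : bilin act := module_bilin am.
Let aa k l x : act k (act l x) = act (k * l) x. Proof. by rewrite (act_mul am). Qed.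
Let a1 x : act 1 x = x. Proof. exact: act_one am x. Qed.

Lemma tw_linear G : linear (tw G).
Proof. by rewrite /tw; lin. Qed.

(** Multiplying the hypothesis by ρ(S(k2)) isolates [phi]. Two families satisfying the relation for
    the same [y] are therefore equal; this is how equalities between actions are proved below. *)
Lemma inner_formula (phi : K -> E) y : linear phi ->
  (forall k, mul (rho k) y = \tsum_(k1, k2 <- comul H k) mul (phi k1) (rho k2)) ->
  forall k, phi k
    = \tsum_(k1, k2 <- comul H k) mul (mul (rho k1) y) (rho (antipode H k2)).
Proof.
move=> pl hphi k; have Sl := antipode_linear hH.
transitivity (\tsum_(k1, k2 <- comul H k) \tsum_(a, b <- comul H k1)
    mul (phi a) (rho (b * antipode H k2))).
  rewrite (coassocE hH (f := fun a b c => mul (phi a) (rho (b * antipode H c)))); last by lin.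
  rewrite -[LHS](counitrE hH k pl); apply: eq_tsum => k1 k2.
  rewrite (antipoderE hH (f := fun z => mul (phi k1) (rho z))); last by lin.
  by rewrite r1 m1r.
apply: eq_tsum => k1 k2; rewrite hphi (lin_sum _ _ (proj1 mb _)).
by apply: eq_tsum => a b; rewrite rM mA.
Qed.

(** [tw G] trades the coproduct in the inner relation for any [d] with [G d = Δ(k) G]: the twisted
    coproduct when [G] inverts the twist, the opposite one when [G = R21]. *)
Lemma tw_inner G (d : K ⊗ K) k x : inner_action ->
  G * d = comul H k * G ->
  \tsum_(k1, k2 <- d) mul (tw G (act k1 x)) (rho k2) = mul (rho k) (tw G x).
Proof.
move=> inn Gd; have fb : bilin (fun a b => mul (act a x) (rho b)) by lin.
transitivity (tsum (fun a b => mul (act a x) (rho b)) (G * d)).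
  rewrite (tsum_mul _ _ fb) exchange_tsum; apply: eq_tsum => k1 k2.
  rewrite /tw (lin_sum _ _ (proj1 mb _)); apply: eq_tsum => g1 g2.
  by rewrite aa rM mA.
rewrite Gd (tsum_mul _ _ fb) exchange_tsum /tw (lin_sum _ _ (proj2 mb _)).
apply: eq_tsum => g1 g2; rewrite mA inn (lin_sum _ _ (proj1 mb _)).
by apply: eq_tsum => k1 k2; rewrite aa rM mA.
Qed.

(** On the right, ρ(g2) moves past [act h1 y] at the cost of a coproduct of [g2]; on the left, [aM]
    brings a coproduct of the first leg. The inverse cocycle identity equates the two. *)
Lemma tw_mul G x y : inner_action -> act_multiplicative H act mul ->
  (forall f : K -> K -> K -> E, trilin f ->
     opDl (comul H) G (op12 G f) = opDr (comul H) G (op23 G f)) ->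
  tw G (\tsum_(g1, g2 <- G) mul (act g1 x) (act g2 y)) = mul (tw G x) (tw G y).
Proof.
move=> inn aM coc; pose f a b c := mul (act a x) (mul (act b y) (rho c)).
have fl : trilin f by rewrite /f; lin.
transitivity (opDl (comul H) G (op12 G f) 1 1 1).
  rewrite (lin_sum _ _ (tw_linear G)) /tw /opDl /op12 exchange_tsum.
  apply: eq_tsum => h1 h2; rewrite exchange_tsum; apply: eq_tsum => g1 g2.
  rewrite aM (lin_sum _ _ (proj1 mb _)); apply: eq_tsum => a b.
  by rewrite /f !aa !mul1r -mA.
rewrite coc // /tw /opDr /op23 (lin_sum _ _ (proj1 mb _)).
apply: eq_tsum => g1 g2; rewrite exchange_tsum (lin_sum _ _ (proj2 mb _)).
apply: eq_tsum => h1 h2; rewrite -mA [mul (rho g2) _]mA inn.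
rewrite (lin_sum _ _ (proj1 mb _)) (lin_sum _ _ (proj2 mb _)).
by apply: eq_tsum => a b; rewrite /f !aa !mul1r rM -mA.
Qed.

End InnerAction.

Section TwistInner.
Variables (C : numClosedFieldType) (K : algType C) (H H' : hopf_data K).
Variables (E : lmodType C) (act act' : K -> E -> E) (mul : E -> E -> E) (one : E).
Variables (rho : K -> E) (G G' : K ⊗ K).
Hypotheses (hH : hopf_algebra H) (hH' : hopf_algebra H').
Hypotheses (am : is_module act) (am' : is_module act') (mb : bilin mul).
Hypotheses (mA : associative mul) (m1r : right_id one mul).
Hypotheses (rl : linear rho) (rM : forall k l, rho (k * l) = mul (rho k) (rho l)).
Hypotheses (r1 : rho 1 = one).
Hypotheses (inn : inner_action H act mul rho) (inn' : inner_action H' act' mul rho).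
Hypothesis GD : forall k, G * comul H' k = comul H k * G.
Hypothesis GG' : G * G' = 1.

Let ab : bilin act := module_bilin am.
Let ab' : bilin act' := module_bilin am'.

(** As functions of [k], both sides satisfy the inner relation of the second action for [tw x], so
    [inner_formula] identifies them. *)
Lemma tw_act k x : tw act mul rho G (act k x) = act' k (tw act mul rho G x).
Proof.
have tl : linear (tw act mul rho G) by apply: tw_linear.
have e := inner_formula hH' mb mA m1r rl rM r1.
rewrite (e (fun k => act' k (tw act mul rho G x)) (tw act mul rho G x)).
- apply: (e (fun k => tw act mul rho G (act k x))); first by lin.
  by move=> l; apply/esym; apply: (tw_inner am mb mA rl rM).
- by lin.
by move=> l; apply: inn'.
Qed.

(** The two Hopf structures play symmetric parts, so exchanging them together with [G] and [G']
    yields the other composite. *)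
Lemma twK x : tw act' mul rho G' (tw act mul rho G x) = x.
Proof.
rewrite {1}/tw.
transitivity (\tsum_(g1, g2 <- G) \tsum_(h1, h2 <- G')
    mul (act (g1 * h1) x) (rho (g2 * h2))).
  rewrite exchange_tsum; apply: eq_tsum => h1 h2; rewrite -tw_act /tw.
  rewrite (lin_sum _ _ (proj1 mb _)); apply: eq_tsum => g1 g2.
  by rewrite (act_mul am) rM mA.
have fb : bilin (fun a b => mul (act a x) (rho b)) by lin.
by rewrite -(tsum_mul _ _ fb) GG' (tsum_one fb) r1 m1r (act_one am).
Qed.

End TwistInner.

Section RmatCocycle.
Variables (C : numClosedFieldType) (K : algType C) (H : hopf_data K).
Hypothesis hR : triangular_Rmat H.

(** [R] satisfies the cocycle identity of a twist, with inverse [R21]. After the legs are reversed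
    by [g], each side is by a hexagon a triple product of [R], and Yang-Baxter relates the two. *)
Lemma Rmat_cocycleV_op (U : lmodType C) (f : K -> K -> K -> U) : trilin f ->
  opDl (comul H) (tflip (Rmat H)) (op12 (tflip (Rmat H)) f)
  = opDr (comul H) (tflip (Rmat H)) (op23 (tflip (Rmat H)) f).
Proof.
have Dl := comul_linear (tri_hopf hR).
move=> fl; apply: eq_fun3 => x y z; rewrite /opDl /opDr /op12 /op23.
rewrite !tsum_flip; [|by lin..].
pose g a b c := f (x * c) (y * b) (z * a); have gl : trilin g by rewrite /g; lin.
pose h r a b := \tsum_(s1, s2 <- Rmat H) g r (b * s1) (a * s2).
have hl : trilin h by rewrite /h; lin.
transitivity (\tsum_(r1, r2 <- Rmat H) \tsum_(a, b <- comul H r2) h r1 a b).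
  do 2!(apply: eq_tsum => ? ?); rewrite /h tsum_flip; last by lin.
  by apply: eq_tsum => s1 s2; rewrite /g !mulrA.
rewrite (Rmat_hexrE hR hl) /h (yang_baxterE hR gl).
pose h' a b r := \tsum_(s1, s2 <- Rmat H) g (b * s1) (a * s2) r.
have hl' : trilin h' by rewrite /h'; lin.
transitivity (\tsum_(r1, r2 <- Rmat H) \tsum_(a, b <- comul H r1) h' a b r2).
  rewrite (Rmat_hexlE hR hl') exchange_tsum.
  under eq_tsum => ? ? do rewrite exchange_tsum.
  by rewrite exchange_tsum.
do 2!(apply: eq_tsum => ? ?); rewrite /h' tsum_flip; last by lin.
by apply: eq_tsum => s1 s2; rewrite /g !mulrA.
Qed.

End RmatCocycle.

(** * Braided derivations *)

Section LinearMaps.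
Variables (C : numClosedFieldType) (V W : lmodType C).

Definition lin_pred : {pred V -> W} := fun f => `[< linear f >].

Lemma lin_subsemimod_closed : GRing.subsemimod_closed lin_pred.
Proof.
apply: GRing.submod_closed_semi; split.
  by apply/asboolP => c u v; rewrite scaler0 addr0.
move=> c f h /asboolP fl /asboolP hl; apply/asboolP => d u v.
rewrite -[LHS]/(c *: f (d *: u + v) + h (d *: u + v)) fl hl.
by rewrite !scalerDr !scalerA [c * d]mulrC addrACA.
Qed.

(** Endomorphisms of [A] form a module type of their own, so that the results on associative
    products with an action of [K] apply to composition. *)
Record linmap : Type := MkLinmap { lin_fun :> V -> W; _ : lin_fun \in lin_pred }.
HB.instance Definition _ := [isSub for lin_fun].
HB.instance Definition _ := [Choice of linmap by <:].
HB.instance Definition _ :=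
  GRing.SubChoice_isSubLmodule.Build C (V -> W) lin_pred linmap
    lin_subsemimod_closed.

Lemma linmap_linear (f : linmap) : linear f.
Proof. by case: f => f /= /asboolP. Qed.

Definition to_linmap (f : V -> W) (fl : linear f) : linmap := MkLinmap (asboolT fl).

Lemma linmap_ext (f g : linmap) : (forall v, f v = g v) -> f = g.
Proof. by move=> fg; apply: val_inj; apply: funext. Qed.

Lemma eval_linear (v : V) : linear (fun f : linmap => f v).
Proof. by move=> c f g; rewrite -[LHS]/(val (c *: f + g) v) linearP. Qed.

Lemma linmapP c (f g : linmap) v : (c *: f + g : linmap) v = c *: f v + g v.
Proof. exact: eval_linear. Qed.

End LinearMaps.

#[global] Hint Extern 1 (GRing.linear_for _ (lin_fun _)) => exact (@linmap_linear _ _ _ _) : lin.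
#[global] Hint Extern 1 (GRing.linear_for _ (fun f => lin_fun f _)) => exact (@eval_linear _ _ _ _) : lin.

(** * The action of K on endomorphisms *)

Section HomAction.
Variables (C : numClosedFieldType) (K : algType C) (H : hopf_data K).
Variables (A : lmodType C) (act : K -> A -> A).
Hypotheses (hH : hopf_algebra H) (am : is_module act).
Local Notation E := (linmap A A).

Let ab : bilin act := module_bilin am.

Lemma hom_act_linear (psi : E) k : linear (hom_act H act k psi).
Proof. by have Sl := antipode_linear hH; rewrite /hom_act; lin. Qed.

Definition lact_hom k (psi : E) : E := to_linmap (hom_act_linear psi k).

Definition lcomp (f g : E) : E :=
  to_linmap (lin_comp (linmap_linear f) (linmap_linear g)).

Definition lone : E := to_linmap (@lin_id C A).

Definition lrho k : E := to_linmap (act_linear am k).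

Lemma lcomp_bilin : bilin lcomp.
Proof.
split=> [g|f] c u v; apply: linmap_ext => a.
  exact: (eval_linear (g a)).
rewrite [RHS](eval_linear a); apply: etrans (linmap_linear f _ _ _).
by congr (lin_fun f _); apply: (eval_linear a).
Qed.

Lemma lcompA : associative lcomp.
Proof. by move=> f g h; apply: linmap_ext. Qed.
Lemma lcomp1r : right_id lone lcomp.
Proof. by move=> f; apply: linmap_ext. Qed.

Lemma lrho_linear : linear lrho.
Proof.
move=> c u v; apply: linmap_ext => a; rewrite (eval_linear a) /=.
exact: (act_linearl am).
Qed.
Lemma lrhoM k l : lrho (k * l) = lcomp (lrho k) (lrho l).
Proof. by apply: linmap_ext => a; apply: act_mul. Qed.
Lemma lrho1 : lrho 1 = lone.
Proof. by apply: linmap_ext => a; apply: act_one. Qed.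

Lemma linmap_tsum (X Y : lmodType C) (f : X -> Y -> E) t a :
  (tsum f t : E) a = \tsum_(x, y <- t) f x y a.
Proof. exact: (lin_sum _ _ (@eval_linear _ _ _ a)). Qed.

Lemma lact_hom_module : is_module lact_hom.
Proof.
have Sl := antipode_linear hH.
split=> [k c f g|f c k l|f|k l f]; apply: linmap_ext => a.
- rewrite (eval_linear a) /= /hom_act -tsum_lin; apply: eq_tsum => x y.
  exact: (act_linear am x c (f _) (g _)).
- rewrite (eval_linear a) /= /hom_act.
  have hl : linear (fun k => \tsum_(k1, k2 <- comul H k) act k1 (f (act (antipode H k2) a))).
    by lin.
  exact: hl.
- rewrite /= /hom_act (comul1E hH); last by lin.
  by rewrite (antipode1 hH) !(act_one am).
rewrite /= /hom_act (comulME hH); last by lin.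
apply: eq_tsum => k1 k2; rewrite (lin_sum _ _ (act_linear am k1)).
apply: eq_tsum => l1 l2.
by rewrite (antipodeM hH) !(act_mul am).
Qed.

(** [k ▷ ψ(a) = k1 ▷ ψ(S(k2) k3 ▷ a)]. *)
Lemma lact_hom_inner : inner_action H lact_hom lcomp lrho.
Proof.
have Sl := antipode_linear hH.
move=> k psi; apply: linmap_ext => a; rewrite linmap_tsum /= /hom_act.
transitivity (\tsum_(k1, k2 <- comul H k) \tsum_(x, y <- comul H k2)
   act k1 (psi (act (antipode H x * y) a))).
  rewrite -[LHS](counitrE hH (f := fun k => act k (psi a))); last by lin.
  apply: eq_tsum => k1 k2.
  rewrite (antipodelE hH (f := fun z => act k1 (psi (act z a)))); last by lin.
  by rewrite (act_one am).
rewrite -(coassocE hH (f := fun x y z => act x (psi (act (antipode H y * z) a)))); last by lin.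
by do 2!(apply: eq_tsum => ? ?); rewrite (act_mul am).
Qed.

(** Both sides satisfy the inner relation for the composite of [x] and [y], which by [inner_formula]
    determines them. *)
Lemma lact_hom_mult : act_multiplicative H lact_hom lcomp.
Proof.
have Sl := antipode_linear hH; have lm := lact_hom_module.
have lb := module_bilin lm; have cb := lcomp_bilin; have rl := lrho_linear.
have inn := lact_hom_inner.
move=> k x y.
pose phi k := \tsum_(k1, k2 <- comul H k) lcomp (lact_hom k1 x) (lact_hom k2 y).
have pl : linear phi by rewrite /phi; lin.
have e := inner_formula hH cb lcompA lcomp1r rl lrhoM lrho1.
rewrite -/(phi k) (e phi (lcomp x y) pl); last first.
  move=> l; rewrite lcompA inn (lin_sum _ _ (proj1 cb _)) /phi.
  transitivity (\tsum_(k1, k2 <- comul H l) \tsum_(a, b <- comul H k2)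
     lcomp (lact_hom k1 x) (lcomp (lact_hom a y) (lrho b))).
    apply: eq_tsum => k1 k2; rewrite -lcompA inn (lin_sum _ _ (proj2 cb _)) //.
  rewrite -(coassocE hH (f := fun a b c =>
    lcomp (lact_hom a x) (lcomp (lact_hom b y) (lrho c)))); last by lin.
  apply: eq_tsum => k1 k2; rewrite (lin_sum _ _ (proj1 cb _)).
  by apply: eq_tsum => a b; rewrite lcompA.
apply: (e (fun k => lact_hom k (lcomp x y))); first by lin.
by move=> l; apply: inn.
Qed.

End HomAction.

Lemma mulr_conj_comm (B : nzRingType) (r r' d d' : B) :
  r * r' = 1 -> r' * r = 1 -> d' * r = r * d -> r' * d' = d * r'.
Proof.
move=> rr r'r dr; rewrite -[LHS]mulr1 -rr mulrA -(mulrA _ _ r) dr.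
by rewrite mulrA r'r mul1r.
Qed.

(** * The involution on endomorphisms *)

Section HomStar.
Variables (C : numClosedFieldType) (K : algType C) (H : hopf_data K) (s : K -> K).
Variables (A : lmodType C) (act : K -> A -> A) (star : A -> A).
Hypotheses (hR : triangular_Rmat H) (hs : conj_structure H s).
Hypotheses (am : is_module act).
Hypotheses (sa : antilinear star) (sK : involutive star).
Hypothesis star_act : forall k a, star (act k a) = act (s k) (star a).

Local Notation E := (linmap A A).
Let hH := tri_hopf hR.
Local Notation R := (Rmat H).
Local Notation comp := (@lcomp C A).
Local Notation hact := (lact_hom hH am).
Local Notation rho := (lrho am).
Local Notation D := (tw hact comp rho (tflip R)).

Let lm : is_module hact := lact_hom_module hH am.
Let hb : bilin hact := module_bilin lm.
Let cb : bilin comp := @lcomp_bilin C A.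
Let rl : linear rho := lrho_linear am.
Let inn : inner_action H hact comp rho := lact_hom_inner hH am.
Let Dl : linear D. Proof. exact: tw_linear. Qed.

Lemma dag_linear (f : E) : linear (fun a => star (f (star a))).
Proof. by move=> c u v; rewrite sa linmap_linear sa conjCK. Qed.

Definition dag (f : E) : E := to_linmap (dag_linear f).

Lemma dag_antilinear : antilinear dag.
Proof.
move=> c f g; apply: linmap_ext => a; rewrite linmapP.
by apply: etrans (sa _ _ _); congr star; apply: linmapP.
Qed.

Lemma dag_comp f g : dag (comp f g) = comp (dag f) (dag g).
Proof. by apply: linmap_ext => a /=; rewrite sK. Qed.

Lemma dagK : involutive dag.
Proof. by move=> f; apply: linmap_ext => a /=; rewrite !sK. Qed.

Lemma dag_rho k : dag (rho k) = rho (s k).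
Proof. by apply: linmap_ext => a /=; rewrite star_act sK. Qed.

Definition est (psi : E) : E := - dag (D psi).

Lemma est_antilinear : antilinear est.
Proof. by move=> c f g; rewrite /est Dl dag_antilinear opprD scalerN. Qed.

(** [R21] intertwines the opposite coproduct with [Δ]. The reversal is undone by [s] when [dag] is
    applied. *)
Lemma tw_Rmat_inner m psi :
  \tsum_(k1, k2 <- comul H m) comp (D (hact k2 psi)) (rho k1) = comp (rho m) (D psi).
Proof.
have RD : tflip R * tflip (comul H m) = comul H m * tflip R.
  exact: (mulr_conj_comm (tri_mulV hR) (tri_Vmul hR) (tri_comul hR m)).
have e : \tsum_(k1, k2 <- tflip (comul H m)) comp (D (hact k1 psi)) (rho k2)
    = comp (rho m) (D psi).
  by apply: tw_inner RD => //; [apply: lcompA | apply: lrhoM].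
by apply: etrans e; apply: esym; apply: tsum_flip; lin.
Qed.

(** The family [l ↦ est (s(l) ▷ ψ)] satisfies the inner relation for [est psi]: apply [dag] to
    [tw_Rmat_inner]. *)
Lemma est_act k psi : est (hact k psi) = hact (s k) (est psi).
Proof.
have e := inner_formula hH cb (@lcompA C A) (@lcomp1r C A) rl (lrhoM am) (lrho1 am).
pose phi l := est (hact (s l) psi).
have pl : linear phi.
  move=> c u v; rewrite /phi (conj_antilinear hs) (act_linearl lm).
  by rewrite est_antilinear conjCK.
suff -> : hact (s k) (est psi) = phi (s k) by rewrite /phi (conjK hs).
rewrite (e phi (est psi) pl); first last.
  move=> l; rewrite /est (linN (proj2 cb _)) -{1}[l](conjK hs) -dag_rho -dag_comp.
  rewrite -tw_Rmat_inner (conj_comulE hs (f := fun x y => comp (D (hact y psi)) (rho x))); last by lin.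
  rewrite (antilin_sum _ _ dag_antilinear) -tsum_opp; apply: eq_tsum => k1 k2.
  by rewrite dag_comp dag_rho (conjK hs) /phi /est (linN (proj1 cb _)).
apply: (e (fun l => hact l (est psi))); first by lin.
by move=> l; apply: inn.
Qed.

(** It suffices that [D (est ψ) = - dag ψ]. Pulling [dag] out of the sum puts [s] on both legs of
    [R]; this flips [R], which then cancels against the one inside [D]. *)
Lemma estK : involutive est.
Proof.
move=> psi.
have -> : est (est psi) = dag (dag psi); last exact: dagK.
rewrite {1}/est; have -> : D (est psi) = - dag psi; last first.
  by rewrite (antilinN dag_antilinear) opprK.
rewrite /tw (tsum_flip R); last by lin.
transitivity (- dag (\tsum_(r1, r2 <- R) comp (D (hact (s r2) psi)) (rho (s r1)))).
  rewrite (antilin_sum _ _ dag_antilinear) -tsum_opp; apply: eq_tsum => r1 r2.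
  rewrite dag_comp dag_rho (conjK hs) -(linN (proj1 cb _)) -/(est _) est_act.
  by rewrite (conjK hs).
rewrite (conj_RmatE hs (f := fun x y => comp (D (hact y psi)) (rho x))); last by lin.
congr (- dag _).
transitivity (\tsum_(s1, s2 <- R) \tsum_(r1, r2 <- R)
    comp (hact (s2 * r1) psi) (rho (s1 * r2))).
  rewrite exchange_tsum; apply: eq_tsum => r1 r2; rewrite /tw (tsum_flip R); last by lin.
  rewrite (lin_sum _ _ (proj1 cb _)); apply: eq_tsum => s1 s2.
  by rewrite (act_mul lm) lrhoM lcompA.
rewrite (Rmat_Vmul hR (f := fun a b => comp (hact a psi) (rho b))); last by lin.
by rewrite (act_one lm) lrho1 lcomp1r.
Qed.

Local Notation bbr := (bbr H hact comp).
Local Notation bop := (bop H hact comp).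

(** By [tw_mul] for [R21], [D (bop x y)] is the composite of [D y] and [D x] in this order. The
    reversal, absent from [dag], is the one required of the involution on brackets. *)
Lemma est_bbr psi lam : est (bbr psi lam) = bbr (est lam) (est psi).
Proof.
have aM : act_multiplicative H hact comp := lact_hom_mult hH am.
have Dop x y : D (bop x y) = comp (D y) (D x).
  rewrite -(tw_mul lm cb (@lcompA C A) rl (lrhoM am) _ _ inn aM (@Rmat_cocycleV_op _ _ _ hR _)).
  by congr D; apply: esym; apply: tsum_flip; lin.
have Dmul x y : D (comp x y) = \tsum_(r1, r2 <- R) comp (D (hact r1 x)) (D (hact r2 y)).
  rewrite -(bop_flip hR lm cb) (lin_sum _ _ Dl).
  by apply: eq_tsum => r1 r2; rewrite Dop.
rewrite /bbr {1}/est (linB Dl) Dop Dmul (antilinB dag_antilinear) opprB.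
rewrite (antilin_sum _ _ dag_antilinear) dag_comp; congr (_ - _).
  by rewrite /est (linN (proj1 cb _)) (linN (proj2 cb _)) opprK.
rewrite /bop.
transitivity (\tsum_(r1, r2 <- R) comp (hact (s r1) (est psi)) (hact (s r2) (est lam))).
  apply: eq_tsum => r1 r2; rewrite -!est_act /est dag_comp.
  by rewrite (linN (proj1 cb _)) (linN (proj2 cb _)) opprK.
by rewrite (conj_RmatE hs (f := fun x y => comp (hact x (est psi)) (hact y (est lam)))) //; lin.
Qed.

End HomStar.

(** * Braided derivations inside the algebra of endomorphisms *)

Section Derivations.
Variables (C : numClosedFieldType) (K : algType C) (H : hopf_data K) (s : K -> K).
Variables (A : lmodType C) (act : K -> A -> A) (mul : A -> A -> A) (star : A -> A).
Hypotheses (hR : triangular_Rmat H) (am : is_module act) (mb : bilin mul).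
Hypothesis aM : act_multiplicative H act mul.

Local Notation E := (linmap A A).
Let hH := tri_hopf hR.
Local Notation R := (Rmat H).
Local Notation comp := (@lcomp C A).
Local Notation hact := (lact_hom hH am).
Local Notation rho := (lrho am).
Local Notation bbr := (bbr H hact comp).
Local Notation bop := (bop H hact comp).

Let lm : is_module hact := lact_hom_module hH am.
Let hb : bilin hact := module_bilin lm.
Let cb : bilin comp := @lcomp_bilin C A.
Let rl : linear rho := lrho_linear am.
Let inn : inner_action H hact comp rho := lact_hom_inner hH am.
Let cM : act_multiplicative H hact comp := lact_hom_mult hH am.
Let bb : bilin bbr := bbr_bilin H lm cb.
Let ab : bilin act := module_bilin am.

Definition ell a : E := to_linmap (proj2 mb a).

Lemma ell_linear : linear ell.
Proof.
move=> c u v; apply: linmap_ext => b; rewrite linmapP.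
exact: (proj1 mb b).
Qed.

Let el := ell_linear.

(** For left multiplications the inner relation is the compatibility [aM] of the action with the
    product of [A]. *)
Lemma lact_hom_ell k a : hact k (ell a) = ell (act k a).
Proof.
have e := inner_formula hH cb (@lcompA C A) (@lcomp1r C A) rl (lrhoM am) (lrho1 am).
have pl : linear (fun k => ell (act k a)) by lin.
rewrite (e (fun k => ell (act k a)) (ell a) pl); last first.
  move=> l; apply: linmap_ext => b; rewrite linmap_tsum.
  exact: aM.
apply: (e (fun l => hact l (ell a))); first by lin.
by move=> l; apply: inn.
Qed.

(** The braided Leibniz rule as a bracket with left multiplications, equivalent to the usual form by
    [is_derP]. *)
Definition is_der (psi : E) : Prop := forall a, bbr psi (ell a) = ell (psi a).

Lemma bbr_ell psi a b : (bbr psi (ell a) : E) b =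
  psi (mul a b) - \tsum_(r1, r2 <- R) mul (act r2 a) (hact r1 psi b).
Proof.
rewrite /Defs.hom_act -[RHS]/(psi (mul a b) - _).
have -> : \tsum_(r1, r2 <- R) mul (act r2 a) (hact r1 psi b)
    = (bop psi (ell a) : E) b.
  by rewrite linmap_tsum; apply: eq_tsum => r1 r2; rewrite lact_hom_ell.
by rewrite (linB (@eval_linear _ _ _ b)).
Qed.

Lemma is_derP psi :
  is_der psi <-> forall a a', psi (mul a a')
    = mul (psi a) a' + \tsum_(r1, r2 <- R) mul (act r2 a) (hact r1 psi a').
Proof.
split=> [hpsi a a'|hpsi a].
  have := congr1 (fun f : E => f a') (hpsi a); rewrite bbr_ell => /= <-.
  by rewrite subrK.
by apply: linmap_ext => b; rewrite bbr_ell hpsi addrK.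
Qed.

(** [N(k, a) = N(k1, k2 S(k3) ▷ a)], so [N] can be recovered from its contracted sums. *)
Lemma coaction_vanish (N : K -> A -> E) : bilin N ->
  (forall k b, \tsum_(k1, k2 <- comul H k) N k1 (act k2 b) = 0) ->
  forall k a, N k a = 0.
Proof.
move=> nb N0 k a; have Sl := antipode_linear hH.
transitivity (\tsum_(k1, k2 <- comul H k) \tsum_(x, y <- comul H k2)
    N k1 (act (x * antipode H y) a)).
  rewrite -[LHS](counitrE hH k (proj1 nb a)); apply: eq_tsum => k1 k2.
  by rewrite (antipoderE hH (f := fun z => N k1 (act z a))) ?(act_one am) //; lin.
rewrite -(coassocE hH (f := fun x y z => N x (act (y * antipode H z) a))); last by lin.
transitivity (\tsum_(x, z <- comul H k) (0 : E)); last by rewrite /tsum big1.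
apply: eq_tsum => x z; rewrite -[RHS](N0 x (act (antipode H z) a)).
by apply: eq_tsum => p q; rewrite (act_mul am).
Qed.

(** Acting on the condition for [psi] gives the condition for the translates of [psi] only summed
    over a coproduct; [coaction_vanish] removes the sum. *)
Lemma is_der_act k psi : is_der psi -> is_der (hact k psi).
Proof.
move=> hpsi a; apply/eqP; rewrite -subr_eq0; apply/eqP.
pose N k a := bbr (hact k psi) (ell a) - ell (hact k psi a).
have nb : bilin N.
  by rewrite /N; lin.
apply: (coaction_vanish nb) => l b; rewrite /N tsum_sub.
apply/eqP; rewrite subr_eq0; apply/eqP.
transitivity (hact l (bbr psi (ell b))).
  rewrite (bbr_act hR lm cb cM); apply: eq_tsum => k1 k2.
  by rewrite lact_hom_ell.
rewrite hpsi lact_hom_ell -(lin_sum _ _ el); congr ell.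
have := congr1 (fun f : E => f b) (inn l psi); rewrite linmap_tsum => /= ->.
by [].
Qed.

Lemma is_der_bbr psi lam : is_der psi -> is_der lam -> is_der (bbr psi lam).
Proof.
move=> hpsi hlam a.
transitivity (bbr psi (bbr lam (ell a))
   - \tsum_(r1, r2 <- R) bbr (hact r2 lam) (bbr (hact r1 psi) (ell a))).
  by rewrite (bbr_jacobi hR lm cb (@lcompA C A) cM psi lam (ell a)) addrK.
rewrite hlam hpsi.
have -> : (bbr psi lam : E) a = psi (lam a)
    - \tsum_(r1, r2 <- R) hact r2 lam (hact r1 psi a).
  rewrite (linB (@eval_linear _ _ _ a)) linmap_tsum //.
rewrite (linB el) (lin_sum _ _ el); congr (_ - _); apply: eq_tsum => r1 r2.
by rewrite (is_der_act r1 hpsi) (is_der_act r2 hlam).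
Qed.

Hypotheses (hs : conj_structure H s) (sa : antilinear star) (sK : involutive star).
Hypothesis star_act : forall k a, star (act k a) = act (s k) (star a).
Hypothesis starM : forall a b, star (mul a b) = mul (star b) (star a).

Local Notation D := (tw hact comp rho (tflip R)).
Local Notation est := (est hR am sa).

Lemma tw_RmatE psi a : (D psi : E) a = \tsum_(r1, r2 <- R) hact r2 psi (act r1 a).
Proof.
by rewrite /tw linmap_tsum; apply: tsum_flip; lin.
Qed.

(** The hexagon distributes [R] over the two factors, and in one of the two terms a braiding
    cancels. The resulting Leibniz rule is braided from the right; the antimultiplicative [star]
    turns it into the usual one. *)
Lemma tw_Rmat_leibniz psi x y : is_der psi ->
  D psi (mul x y) = mul x (D psi y)
    + \tsum_(t1, t2 <- R) mul (D (hact t2 psi) x) (act t1 y).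
Proof.
move=> hpsi; have hd k := proj1 (is_derP _) (is_der_act k hpsi).
rewrite tw_RmatE.
transitivity (\tsum_(r1, r2 <- R) \tsum_(a, b <- comul H r1)
   hact r2 psi (mul (act a x) (act b y))).
  by apply: eq_tsum => r1 r2; rewrite aM (lin_sum _ _ (linmap_linear _)).
rewrite (Rmat_hexlE hR (f := fun a b c => hact c psi (mul (act a x) (act b y)))); last by lin.
transitivity (\tsum_(r1, r2 <- R) \tsum_(t1, t2 <- R)
   (mul (hact (r2 * t2) psi (act r1 x)) (act t1 y)
    + \tsum_(q1, q2 <- R) mul (act (q2 * r1) x) (hact (q1 * r2) (hact t2 psi) (act t1 y)))).
  do 2!(apply: eq_tsum => ? ?); rewrite hd; congr (_ + _).
  by apply: eq_tsum => q1 q2; rewrite -!(act_mul am) -!(act_mul lm) mulrA.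
rewrite (eq_tsum _ (fun _ _ => tsum_addf _ _ _)) tsum_addf addrC; congr (_ + _).
  rewrite exchange_tsum tw_RmatE (lin_sum _ _ (proj2 mb x)).
  apply: eq_tsum => t1 t2; rewrite exchange_tsum.
  rewrite (Rmat_Vmul hR (f := fun a b => mul (act a x) (hact b (hact t2 psi) (act t1 y)))).
    by rewrite (act_one am) (act_one lm).
  by lin.
rewrite exchange_tsum; apply: eq_tsum => t1 t2; rewrite tw_RmatE (lin_sum _ _ (proj1 mb _)).
by apply: eq_tsum => r1 r2; rewrite -(act_mul lm).
Qed.

Lemma is_der_est psi : is_der psi -> is_der (est psi).
Proof.
move=> hpsi; apply/is_derP => a a'.
have estE f b : est f b = - star (D f (star b)) by [].
rewrite [LHS]estE starM (tw_Rmat_leibniz _ _ hpsi) (antilinD sa) opprD; congr (_ + _).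
  by rewrite starM sK estE (linN (proj1 mb _)).
rewrite (antilin_sum _ _ sa) -tsum_opp.
transitivity (\tsum_(t1, t2 <- R) mul (act (s t1) a) (hact (s t2) (est psi) a')).
  apply: eq_tsum => t1 t2; rewrite starM star_act sK.
  rewrite -(est_act hR hs am sa sK star_act) estE.
  by rewrite (linN (proj2 mb _)).
rewrite (conj_RmatE hs (f := fun x y => mul (act x a) (hact y (est psi) a'))) //.
by lin.
Qed.

End Derivations.

(** * The braided Lie *-algebra of derivations *)

Section DerStructure.
Variables (C : numClosedFieldType) (K : algType C) (H : hopf_data K).
Variables (A : lmodType C) (act : K -> {linear A -> A}) (mul : {bilinear A -> A -> A}).
Variables (one : A) (star : A -> A).
Hypotheses (hT : triangular_hopf_star_algebra H).
Hypothesis hA : module_star_algebra H act mul one star.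

Let hR := triangular_star_Rmat hT.
Let hs := hconj_structure hT.
Let hH := tri_hopf hR.
Let am : is_module (fun k => act k : A -> A) := msa_module hA.
Let mb : bilin (fun a b => mul a b) := conj (msa_linearl hA) (msa_linearr hA).
Let aM : act_multiplicative H (fun k => act k : A -> A) (fun a b => mul a b) :=
  msa_act_mul hA.
Let sa := star_antilinear (msa_star hA).
Let sK := star_involutive (msa_star hA).
Let starM := star_mul (msa_star hA).

Lemma hconj_star_act k a : star (act k a) = act (hconj H k) (star a).
Proof. by rewrite (msa_compat hA) (antipodeV_star hT). Qed.

Local Notation E := (linmap A A).
Local Notation comp := (@lcomp C A).
Local Notation hact := (lact_hom hH am).
Local Notation isder := (is_der hR am mb).
Local Notation DerA := (Der H act mul).

Lemma der_lin (psi : DerA) : linear psi.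
Proof. by case: psi => f /= /asboolP []. Qed.

Definition der_linmap (psi : DerA) : E := to_linmap (der_lin psi).

Lemma der_linmapP psi : isder (der_linmap psi).
Proof. by apply/is_derP => //; case: psi => f /= /asboolP []. Qed.

Lemma to_der_subproof (f : E) : isder f -> (f : A -> A) \in der_pred H act mul.
Proof.
move=> /(is_derP _ _ _ aM) hf; apply/asboolP; split; first exact: linmap_linear.
exact: hf.
Qed.

Definition to_der (f : E) (fd : isder f) : DerA := MkDer (to_der_subproof fd).

Lemma der_linmap_inj : injective der_linmap.
Proof.
move=> f g fg; apply: val_inj; apply: funext => a.
exact: (congr1 (fun h : E => h a) fg).
Qed.

Lemma der_linmap_linear : linear der_linmap.
Proof. by move=> c f g; apply: linmap_ext => a; rewrite linmapP. Qed.

Lemma to_derK (f : E) (fd : isder f) : der_linmap (to_der fd) = f.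
Proof. by apply: linmap_ext. Qed.

Definition der_blie : blie_data K DerA := {|
  lact := fun k psi => to_der (is_der_act aM k (der_linmapP psi));
  lbr := fun psi lam => to_der (is_der_bbr aM (der_linmapP psi) (der_linmapP lam));
  lstar := fun psi =>
    to_der (is_der_est aM hs sa sK hconj_star_act starM (der_linmapP psi))
|}.

Lemma der_linmap_act k psi : der_linmap (lact der_blie k psi) = hact k (der_linmap psi).
Proof. exact: to_derK. Qed.
Lemma der_linmap_br psi lam :
  der_linmap (lbr der_blie psi lam) = bbr H hact comp (der_linmap psi) (der_linmap lam).
Proof. exact: to_derK. Qed.
Lemma der_linmap_star psi :
  der_linmap (lstar der_blie psi) = est hR am sa (der_linmap psi).
Proof. exact: to_derK. Qed.

Lemma der_blie_structure : der_structure star der_blie.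
Proof.
have Re : Rinv H = tflip (Rmat H).
  by apply: inv_elt_eq; split; [apply: tri_mulV hR | apply: tri_Vmul hR].
split=> [k psi a|psi lam a|psi a]; first by [].
  rewrite -[LHS]/(bbr H hact comp (der_linmap psi) (der_linmap lam) a).
  by rewrite (linB (@eval_linear _ _ _ a)) linmap_tsum.
rewrite -[LHS]/(est hR am sa (der_linmap psi) a) Re.
rewrite -[LHS]/(- star (tw hact comp (lrho am) (tflip (Rmat H)) (der_linmap psi) (star a))).
by rewrite linmap_tsum.
Qed.

(** Every axiom is carried along the injection [der_linmap] into endomorphisms, where it holds for
    the braided commutator and [est]. *)
Lemma der_blie_star_algebra : braided_lie_star_algebra H der_blie.
Proof.
have lm := lact_hom_module hH am; have cb := @lcomp_bilin C A.
have cA := @lcompA C A; have cM := lact_hom_mult hH am.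
have bb := bbr_bilin H lm cb.
have jl := der_linmap_linear.
have jI := der_linmap_inj.
split; first exact: hT.
- split=> [k c f g|f c k l|f|k l f]; apply: jI; rewrite ?jl !der_linmap_act ?jl.
  + exact: act_linear lm k c _ _.
  + exact: act_linearl lm _ c k l.
  + exact: act_one lm _.
  + exact: act_mul lm k l _.
- by move=> v c f g; apply: jI; rewrite jl !der_linmap_br jl (proj1 bb).
- by move=> v c f g; apply: jI; rewrite jl !der_linmap_br jl (proj2 bb).
- move=> k u v; apply: jI; rewrite (lin_sum _ _ jl) der_linmap_act der_linmap_br.
  rewrite (bbr_act hR lm cb cM); apply: eq_tsum => x y.
  by rewrite der_linmap_br !der_linmap_act.
- move=> u v; apply: jI; rewrite (linN jl) (lin_sum _ _ jl) der_linmap_br.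
  rewrite (bbr_antisym hR lm cb); congr (- _); apply: eq_tsum => x y.
  by rewrite der_linmap_br !der_linmap_act.
- move=> u v w; apply: jI; rewrite (linD jl) (lin_sum _ _ jl) !der_linmap_br.
  rewrite (bbr_jacobi hR lm cb cA cM); congr (_ + _); apply: eq_tsum => x y.
  by rewrite !der_linmap_br !der_linmap_act.
- by move=> c u v; apply: jI; rewrite jl !der_linmap_star jl est_antilinear.
- by move=> u; apply: jI; rewrite !der_linmap_star (estK hR hs am sa sK hconj_star_act).
- move=> k u; apply: jI; rewrite der_linmap_star !der_linmap_act der_linmap_star.
  by rewrite (est_act hR hs am sa sK hconj_star_act) (antipodeV_star hT).
- move=> u v; apply: jI; rewrite der_linmap_star !der_linmap_br !der_linmap_star.
  exact: est_bbr hR hs am sa sK hconj_star_act _ _.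
Qed.

End DerStructure.

(** * Twisting the derivations *)

Lemma mulr_twistK (B : nzRingType) (g f d : B) : g * f = 1 -> g * (f * d * g) = d * g.
Proof. by move=> gf; rewrite !mulrA gf mul1r. Qed.

Section Transport.
Variables (C : numClosedFieldType) (K : algType C) (H : hopf_data K).
Variables (g g' : lmodType C) (d : blie_data K g) (d' : blie_data K g') (f : g -> g').
Hypotheses (hd' : braided_lie_star_algebra H d') (fl : linear f) (fI : injective f).
Hypotheses (f_act : forall k u, f (lact d k u) = lact d' k (f u)).
Hypotheses (f_br : forall u v, f (lbr d u v) = lbr d' (f u) (f v)).
Hypotheses (f_star : forall u, f (lstar d u) = lstar d' (f u)).

Lemma braided_lie_transport : braided_lie_star_algebra H d.
Proof.
have m' := blie_module hd'.
have f_sum := lin_sum _ _ fl.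
split; first exact: blie_hopf hd'.
- split=> [k c u v|u c k l|u|k l u]; apply: fI; rewrite ?fl !f_act ?fl.
  + exact: act_linear m' k c _ _.
  + exact: act_linearl m' _ c k l.
  + exact: act_one m' _.
  + exact: act_mul m' k l _.
- by move=> v c u w; apply: fI; rewrite fl !f_br fl (blie_linearl hd').
- by move=> v c u w; apply: fI; rewrite fl !f_br fl (blie_linearr hd').
- move=> k u v; apply: fI; rewrite f_sum f_act f_br (blie_equivariant hd').
  by apply: eq_tsum => x y; rewrite f_br !f_act.
- move=> u v; apply: fI; rewrite (linN fl) f_sum f_br (blie_antisymmetric hd').
  by congr (- _); apply: eq_tsum => x y; rewrite f_br !f_act.
- move=> u v w; apply: fI; rewrite (linD fl) f_sum !f_br (blie_jacobi hd').
  by congr (_ + _); apply: eq_tsum => x y; rewrite !f_br !f_act.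
- by move=> c u v; apply: fI; rewrite fl !f_star fl (blie_star_antilinear hd').
- by move=> u; apply: fI; rewrite !f_star (blie_star_involutive hd').
- by move=> k u; apply: fI; rewrite f_star !f_act f_star (blie_star_compat hd').
- by move=> u v; apply: fI; rewrite f_star !f_br !f_star (blie_star_br hd').
Qed.

End Transport.

(** * The twisted module algebra *)

Section TwistedAlgebra.
Variables (C : numClosedFieldType) (K : algType C) (H : hopf_data K) (F : K ⊗ K).
Variables (A : lmodType C) (act : K -> A -> A) (mul : A -> A -> A).
Variables (one : A) (star : A -> A).
Hypotheses (hT : triangular_hopf_star_algebra H) (hF : is_twist H F).
Hypothesis hA : module_star_algebra H act mul one star.

Local Notation G := (Finv F).
Local Notation HF := (twist_hopf H F).
Local Notation s := (hconj H).

(** [twist_mul] for unbundled [act] and [mul], convertible to it. *)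
Definition twisted_mul a b := \tsum_(f1, f2 <- G) mul (act f1 a) (act f2 b).
Local Notation mulF := twisted_mul.

Let hR := triangular_star_Rmat hT.
Let hs := hconj_structure hT.
Let hH := tri_hopf hR.
Let hTF := twist_triangular_star hT hF.
Let am := msa_module hA.
Let ab := module_bilin am.
Let mb : bilin mul := conj (msa_linearl hA) (msa_linearr hA).
Let aM := msa_act_mul hA.
Let sa := star_antilinear (msa_star hA).

(** The left side is [S_F(s(S_F(k)))], and [conj_antipode] in the twisted Hopf algebra evaluates it
    to [s(k)]. *)
Lemma hconj_twist k : hconj HF k = s k.
Proof.
rewrite /hconj (twist_hconj F hT) -{1}[k](conjK hs).
apply: (conj_antipode (twist_conj_structure hT hF)).
exact: (twist_is_hopf hR hF).
Qed.

Lemma twist_comul_commute k : G * comul HF k = comul H k * G.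
Proof. exact: mulr_twistK (twist_Vmul hF). Qed.

Lemma star_act_hconj k a : star (act k a) = act (s k) (star a).
Proof. by rewrite (msa_compat hA) (antipodeV_star hT). Qed.

Lemma twist_mul_bilin : bilin mulF.
Proof. by rewrite /twisted_mul; lin. Qed.

(** Associativity is the inverse cocycle identity, and antimultiplicativity of [star] is
    [(s ⊗ s)G = G21]. Compatibility of [star] with the action carries over because [s] is the same
    for both Hopf algebras. *)
Lemma twist_module_star_algebra : module_star_algebra HF act mulF one star.
Proof.
have fb a b : bilin (fun x y => mul (act x a) (act y b)) by lin.
have mE a b : mulF a b = \tsum_(f1, f2 <- G) mul (act f1 a) (act f2 b) by [].
split.
- exact: (proj1 twist_mul_bilin).
- exact: (proj2 twist_mul_bilin).
- move=> a b c; pose f x y z := mul (mul (act x a) (act y b)) (act z c).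
  have fl : trilin f by rewrite /f; lin.
  transitivity (opDr (comul H) G (op23 G f) 1 1 1).
    rewrite mE /opDr /op23; apply: eq_tsum => h1 h2.
    rewrite mE exchange_tsum (lin_sum _ _ (act_linear am h2)) (lin_sum _ _ (proj2 mb _)).
    apply: eq_tsum => g1 g2; rewrite aM (lin_sum _ _ (proj2 mb _)).
    apply: eq_tsum => x y.
    by rewrite /f !mul1r !(act_mul am) (msa_assoc hA).
  rewrite -(twist_cocycleV_op hR hF fl) mE /opDl /op12; apply: eq_tsum => h1 h2.
  rewrite mE exchange_tsum (lin_sum _ _ (act_linear am h1)) (lin_sum _ _ (proj1 mb _)).
  apply: eq_tsum => g1 g2; rewrite aM (lin_sum _ _ (proj1 mb _)).
  by apply: eq_tsum => x y; rewrite /f !mul1r !(act_mul am).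
- move=> a; rewrite mE.
  transitivity (\tsum_(g1, g2 <- G) counit H g1 *: act g2 a).
    apply: eq_tsum => g1 g2; rewrite (msa_act_one hA) (linZ (proj1 mb _)).
    by rewrite (msa_one_l hA).
  by rewrite (twist_counitl_inv hR hF (f := fun g => act g a)) ?(act_one am) //; lin.
- move=> a; rewrite mE.
  transitivity (\tsum_(g1, g2 <- G) counit H g2 *: act g1 a).
    apply: eq_tsum => g1 g2; rewrite (msa_act_one hA) (linZ (proj2 mb _)).
    by rewrite (msa_one_r hA).
  by rewrite (twist_counitr_inv hR hF (f := fun g => act g a)) ?(act_one am) //; lin.
- exact: am.
- move=> k a b; rewrite mE (lin_sum _ _ (act_linear am k)).
  transitivity (tsum (fun x y => mul (act x a) (act y b)) (comul H k * G)).
    rewrite (tsum_mul _ _ (fb a b)) exchange_tsum; apply: eq_tsum => g1 g2.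
    by rewrite aM; apply: eq_tsum => x y; rewrite !(act_mul am).
  rewrite -twist_comul_commute (tsum_mul _ _ (fb a b)) exchange_tsum.
  apply: eq_tsum => x y; rewrite mE; apply: eq_tsum => g1 g2.
  by rewrite !(act_mul am).
- exact: msa_act_one hA.
- split; [exact: sa | exact: star_involutive (msa_star hA) | move=> a b].
  rewrite mE (antilin_sum _ _ sa).
  transitivity (\tsum_(g1, g2 <- G) mul (act (s g2) (star b)) (act (s g1) (star a))).
    apply: eq_tsum => g1 g2; rewrite (star_mul (msa_star hA)).
    by rewrite !star_act_hconj.
  by rewrite (twist_conj_invE hT hF (f := fun x y => mul (act y (star b)) (act x (star a)))) //; lin.
move=> k a; rewrite (antipodeV_star hTF) hconj_twist.
exact: star_act_hconj.
Qed.

End TwistedAlgebra.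

Lemma mulr_flip_twist (B : nzRingType) (g' f' r g : B) : g' * f' = 1 -> g' * (f' * r * g) = r * g.
Proof. by move=> gf; rewrite !mulrA gf mul1r. Qed.

(** * The map D on endomorphisms and on derivations *)

Section TwistDerivations.
Variables (C : numClosedFieldType) (K : algType C) (H : hopf_data K) (F : K ⊗ K).
Variables (A : lmodType C) (act : K -> A -> A) (mul : A -> A -> A).
Variables (one : A) (star : A -> A).
Hypotheses (hT : triangular_hopf_star_algebra H) (hF : is_twist H F).
Hypothesis hA : module_star_algebra H act mul one star.

Local Notation G := (Finv F).
Local Notation HF := (twist_hopf H F).
Local Notation s := (hconj H).
Local Notation mulF := (twisted_mul F act mul).
Local Notation R := (Rmat H).

Let hR := triangular_star_Rmat hT.
Let hs := hconj_structure hT.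
Let hH := tri_hopf hR.
Let hTF := twist_triangular_star hT hF.
Let hRF := triangular_star_Rmat hTF.
Let hHF := tri_hopf hRF.
Let hAF := twist_module_star_algebra hT hF hA.
Let sa := star_antilinear (msa_star hA).
Let sK := star_involutive (msa_star hA).
Let star_act := star_act_hconj hT hA.

Variables (am : is_module act) (mb : bilin mul) (mbF : bilin mulF).
Let ab := module_bilin am.
Let aM := msa_act_mul hA.
Let aMF := msa_act_mul hAF.

Local Notation E := (linmap A A).
Local Notation comp := (@lcomp C A).
Local Notation hact := (lact_hom hH am).
Local Notation hactF := (lact_hom hHF am).
Local Notation rho := (lrho am).
Local Notation bbrF := (bbr HF hactF comp).
Local Notation bopF := (bop HF hactF comp).
Local Notation bbr := (bbr H hact comp).
Local Notation bop := (bop H hact comp).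
Local Notation D := (tw hact comp rho G).
Local Notation D' := (tw hactF comp rho F).

Let lm : is_module hact := lact_hom_module hH am.
Let lmF : is_module hactF := lact_hom_module hHF am.
Let hb : bilin hact := module_bilin lm.
Let cb : bilin comp := @lcomp_bilin C A.
Let cA := @lcompA C A.
Let c1 := @lcomp1r C A.
Let rl : linear rho := lrho_linear am.
Let rM := lrhoM am.
Let r1 := lrho1 am.
Let inn : inner_action H hact comp rho := lact_hom_inner hH am.
Let innF : inner_action HF hactF comp rho := lact_hom_inner hHF am.
Let cM : act_multiplicative H hact comp := lact_hom_mult hH am.
Let FG := twist_mulV hF.
Let GF := twist_Vmul hF.
Let GD k : G * comul HF k = comul H k * G. Proof. exact: twist_comul_commute. Qed.
Let el := ell_linear mb.
Let Dl : linear D. Proof. exact: tw_linear. Qed.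
Let bb : bilin bbr := bbr_bilin H lm cb.

Lemma twist_comul_commuteV k : F * comul H k = comul HF k * F.
Proof. by rewrite -[comul HF k]/(F * comul H k * G) -mulrA GF mulr1. Qed.

Lemma twD_act k x : D (hact k x) = hactF k (D x).
Proof. exact: (tw_act hHF lm lmF cb cA c1 rl rM r1 inn innF GD). Qed.

Lemma twDK x : D' (D x) = x.
Proof. exact: (twK hHF lm lmF cb cA c1 rl rM r1 inn innF GD GF). Qed.

Lemma twDK' y : D (D' y) = y.
Proof.
exact: (twK hH lmF lm cb cA c1 rl rM r1 innF inn twist_comul_commuteV FG).
Qed.

Lemma twD_eval x a : (D x : E) a = \tsum_(g1, g2 <- G) hact g1 x (act g2 a).
Proof. by rewrite /tw linmap_tsum. Qed.

Lemma twD_ell a : D (ell mb a) = ell mbF a.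
Proof.
apply: linmap_ext => b; rewrite twD_eval; apply: eq_tsum => g1 g2.
by rewrite (lact_hom_ell hR am mb aM).
Qed.

Lemma twD_mul x y :
  D (\tsum_(g1, g2 <- G) comp (hact g1 x) (hact g2 y)) = comp (D x) (D y).
Proof.
apply: (tw_mul lm cb cA rl rM _ _ inn cM) => f fl.
exact: (twist_cocycleV_op hR hF fl).
Qed.

(** The uncommuted terms are [twD_mul]. In the braided ones the twisted R-matrix enters through
    [G21 R_F = R G]. *)
Lemma twD_bbr x y :
  D (\tsum_(g1, g2 <- G) bbr (hact g1 x) (hact g2 y)) = bbrF (D x) (D y).
Proof.
have GRF : tflip G * Rmat HF = R * G.
  by apply: mulr_flip_twist; rewrite -tflipM GF tflip1.
have fb : bilin (fun a b => comp (hact b y) (hact a x)) by lin.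
rewrite /bbr tsum_sub (linB Dl) twD_mul; congr (_ - _).
transitivity (D (tsum (fun a b => comp (hact b y) (hact a x)) (R * G))).
  congr D; rewrite (tsum_mul _ _ fb) exchange_tsum.
  apply: eq_tsum => g1 g2; apply: eq_tsum => p q.
  by rewrite !(act_mul lm).
rewrite -GRF (tsum_mul _ _ fb) exchange_tsum (lin_sum _ _ Dl).
apply: eq_tsum => p q; rewrite -!twD_act -twD_mul; congr D.
rewrite tsum_flip; last by lin.
by apply: eq_tsum => g1 g2; rewrite !(act_mul lm).
Qed.

Local Notation estF := (est hRF am sa).
Local Notation est := (est hR am sa).

(** Both sides are [- dag] of the sum built on [R21 G21]: the left one because [(s ⊗ s)G = G21], the
    right one because [G] times the flip of [R_F] is [R21 G21]. *)
Lemma twD_est x : D (est x) = estF (D x).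
Proof.
have GRF : G * tflip (Rmat HF) = tflip R * tflip G.
  by rewrite twist_Rmat_flip; apply: mulr_flip_twist GF.
have da := dag_antilinear sa.
have fb : bilin (fun a b => comp (hact a x) (rho b)) by lin.
transitivity (- dag sa (tsum (fun a b => comp (hact a x) (rho b)) (tflip R * tflip G))).
  transitivity (- dag sa (\tsum_(g1, g2 <- G)
      comp (tw hact comp rho (tflip R) (hact (s g1) x)) (rho (s g2)))).
    rewrite /tw (antilin_sum _ _ da) -tsum_opp; apply: eq_tsum => g1 g2.
    rewrite (dag_comp sa sK) (dag_rho am sa sK star_act) (conjK hs).
    rewrite -(linN (proj1 cb _)) -/(est _) (est_act hR hs am sa sK star_act).
    by rewrite (conjK hs).
  have tl : linear (tw hact comp rho (tflip R)) by exact: tw_linear.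
  rewrite (twist_conj_invE hT hF (f := fun a b =>
    comp (tw hact comp rho (tflip R) (hact a x)) (rho b))); last by lin.
  congr (- dag sa _); rewrite (tsum_mul _ _ fb) exchange_tsum.
  rewrite (tsum_flip G); last by lin.
  apply: eq_tsum => g1 g2; rewrite /tw (lin_sum _ _ (proj1 cb _)).
  by apply: eq_tsum => p q; rewrite (act_mul lm) rM cA.
rewrite /est; congr (- dag sa _); rewrite -GRF (tsum_mul _ _ fb) exchange_tsum.
apply: eq_tsum => p q; rewrite -twD_act /tw (lin_sum _ _ (proj1 cb _)).
by apply: eq_tsum => g1 g2; rewrite (act_mul lm) rM cA.
Qed.

Local Notation isder := (is_der hR am mb).
Local Notation isderF := (is_der hRF am mbF).

Lemma twD_is_der x : isder x -> isderF (D x).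
Proof.
move=> hx a; rewrite -twD_ell -twD_bbr -twD_ell; congr D.
rewrite twD_eval (lin_sum _ _ el); apply: eq_tsum => g1 g2.
rewrite (lact_hom_ell hR am mb aM).
exact: (is_der_act aM g1 hx).
Qed.

(** Injectivity of D yields in [T] the derivation condition for [x] summed over [G]. Used for the
    translates [f1 ▷ x] and [f2 ▷ a], summed over [F], it loses the sum because [G F = 1]. *)
Lemma twDV_is_der y : isderF y -> isder (D' y).
Proof.
have D_inj : injective D by apply: can_inj twDK.
have T x a : isderF (D x) ->
    \tsum_(g1, g2 <- G) bbr (hact g1 x) (ell mb (act g2 a)) = ell mb (D x a).
  move=> hx; apply: D_inj; rewrite twD_ell -hx -twD_ell -twD_bbr; congr D.
  by apply: eq_tsum => g1 g2; rewrite (lact_hom_ell hR am mb aM).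
move=> hy a; set x := D' y; have Dx : D x = y by apply: twDK'.
transitivity (\tsum_(g1, g2 <- G) \tsum_(f1, f2 <- F)
    bbr (hact (g1 * f1) x) (ell mb (act (g2 * f2) a))).
  rewrite (twist_VmulE hF (f := fun p q => bbr (hact p x) (ell mb (act q a)))); last by lin.
  by rewrite (act_one am) (act_one lm).
transitivity (\tsum_(f1, f2 <- F) ell mb (D (hact f1 x) (act f2 a))).
  rewrite exchange_tsum; apply: eq_tsum => f1 f2.
  rewrite -T; last by rewrite twD_act Dx; apply: (is_der_act aMF f1 hy).
  by apply: eq_tsum => g1 g2; rewrite (act_mul am) (act_mul lm).
rewrite -(lin_sum _ _ el); congr ell.
transitivity (\tsum_(g1, g2 <- G) \tsum_(f1, f2 <- F)
    hact (g1 * f1) x (act (g2 * f2) a)).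
  rewrite exchange_tsum; apply: eq_tsum => f1 f2; rewrite twD_eval.
  by apply: eq_tsum => g1 g2; rewrite (act_mul am) (act_mul lm).
rewrite (twist_VmulE hF (f := fun p q => hact p x (act q a))); last by lin.
by rewrite (act_one am) (act_one lm).
Qed.

End TwistDerivations.

Section DerTwist.
Variables (C : numClosedFieldType) (K : algType C) (H : hopf_data K) (F : K ⊗ K).
Variables (A : lmodType C) (act : K -> {linear A -> A}) (mul : {bilinear A -> A -> A}).
Variables (one : A) (star : A -> A).
Hypotheses (hT : triangular_hopf_star_algebra H) (hF : is_twist H F).
Hypothesis hA : module_star_algebra H act mul one star.

Local Notation HF := (twist_hopf H F).
Local Notation mulF := (twist_mul F act mul).

Lemma twist_bilinear_module_star_algebra : module_star_algebra HF act mulF one star.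
Proof. exact: twist_module_star_algebra hT hF hA. Qed.

Let hAF := twist_bilinear_module_star_algebra.
Let hTF := twist_triangular_star hT hF.
Let d := der_blie hT hA.
Let dF := der_blie hTF hAF.
Let am : is_module (fun k => act k : A -> A) := msa_module hA.
Let amF : is_module (fun k => act k : A -> A) := msa_module hAF.
Let hR := triangular_star_Rmat hT.
Let hRF := triangular_star_Rmat hTF.
Let hH := tri_hopf hR.
Let hHF := tri_hopf hRF.

Local Notation E := (linmap A A).
Local Notation D := (tw (lact_hom hH am) (@lcomp C A) (lrho am) (Finv F)).
Local Notation D' := (tw (lact_hom hHF am) (@lcomp C A) (lrho am) F).
Local Notation j := (@der_linmap C K H A act mul).
Local Notation jF := (@der_linmap C K HF A act mulF).

Lemma twD_der psi :
  is_der hRF amF (conj (msa_linearl hAF) (msa_linearr hAF)) (D (j psi)).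
Proof.
(* [is_module] involves only the algebra [K], not its coproduct, so the two proofs have one type and
   can be identified. *)
rewrite (Prop_irrelevance amF am).
exact: (twD_is_der hF hA _ (der_linmapP hT hA psi)).
Qed.

Lemma twDV_der chi :
  is_der hR am (conj (msa_linearl hA) (msa_linearr hA)) (D' (jF chi)).
Proof.
have := der_linmapP hTF hAF chi; rewrite -/amF (Prop_irrelevance amF am) => h.
exact: (twDV_is_der hA _ h).
Qed.

Definition der_twist (psi : Der H act mul) : Der HF act mulF :=
  to_der (twD_der psi).

Lemma der_twist_linmap psi : jF (der_twist psi) = D (j psi).
Proof. exact: to_derK. Qed.

Lemma der_twistE psi a : der_twist psi a
  = \tsum_(f1, f2 <- Finv F) hom_act H act f1 psi (act f2 a).
Proof. exact: (twD_eval F hT am (j psi) a). Qed.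

Lemma der_twist_iso : braided_lie_star_iso HF (twist_blie F d) dF der_twist.
Proof.
have jI := @der_linmap_inj C K H A act mul.
have jFI := @der_linmap_inj C K HF A act mulF.
have jl := @der_linmap_linear C K H A act mul.
have jFl := @der_linmap_linear C K HF A act mulF.
have Dl : linear D.
  have lb := module_bilin (lact_hom_module hH am); have cb := @lcomp_bilin C A.
  by rewrite /tw; lin.
have twl : linear der_twist.
  by move=> c u v; apply: jFI; rewrite jFl !der_twist_linmap jl Dl.
have twb : bijective der_twist.
  exists (fun chi => to_der (twDV_der chi)) => [psi|chi].
    by apply: jI; rewrite to_derK der_twist_linmap (twDK hT hF).
  by apply: jFI; rewrite der_twist_linmap to_derK (twDK' hT hF).
have eact : lact_hom hHF am = lact_hom hHF amF by rewrite (Prop_irrelevance amF am).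
have tw_act k u : der_twist (lact d k u) = lact dF k (der_twist u).
  apply: jFI; rewrite (der_linmap_act hTF hAF) !der_twist_linmap (der_linmap_act hT hA).
  by rewrite (twD_act hT hF) -eact.
have tw_br u v : der_twist (lbr (twist_blie F d) u v) = lbr dF (der_twist u) (der_twist v).
  apply: jFI; rewrite (der_linmap_br hTF hAF) !der_twist_linmap.
  rewrite /= (lin_sum _ _ jl) -[lact_hom _ (msa_module hAF)]eact -(twD_bbr hT hF).
  congr D; apply: eq_tsum => g1 g2.
  by rewrite (der_linmap_br hT hA) !(der_linmap_act hT hA).
have tw_star u : der_twist (lstar d u) = lstar dF (der_twist u).
  apply: jFI; rewrite (der_linmap_star hTF hAF) !der_twist_linmap (der_linmap_star hT hA).
  rewrite (twD_est hT hF hA) -/amF (Prop_irrelevance amF am).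
  by rewrite (Prop_irrelevance (star_antilinear (msa_star hAF)) (star_antilinear (msa_star hA))).
have hdF : braided_lie_star_algebra HF dF by exact: der_blie_star_algebra.
split; [|exact: hdF|exact: twl|exact: twb|exact: tw_act|exact: tw_br|exact: tw_star].
exact: (@braided_lie_transport _ _ _ _ _ (twist_blie F d) _ _ hdF twl (bij_inj twb) tw_act tw_br tw_star).
Qed.

End DerTwist.

(** * Universal enveloping algebras *)

Lemma mul1_mul1 (B : nzRingType) (x : B) : x = 1 * x * 1.
Proof. by rewrite mul1r mulr1. Qed.

Lemma sub_shift (V : zmodType) (p q r p' q' : V) :
  p - q = r -> p = p' -> q = q' -> p' = q' + r.
Proof. by move=> <- <- <-; rewrite addrC subrK. Qed.

Lemma alg_mulDl (C : comNzRingType) (X : algType C) c (x y z : X) :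
  (c *: x + y) * z = c *: (x * z) + y * z.
Proof. by rewrite mulrDl scalerAl. Qed.

Lemma alg_mulDr (C : comNzRingType) (X : algType C) c (x y z : X) :
  z * (c *: x + y) = c *: (z * x) + z * y.
Proof. by rewrite mulrDr scalerAr. Qed.

(** A map out of [U(g)] is obtained as [x => ρ x b0], where [ρ] is an action of
    [U(g)], semilinear along [σ], that extends given operators on generators.
    Taking for [B] the space of linear maps [K -> U(g)] gives the action of [K],
    [B = U(g) ⊗ U(g)] the coproduct, and [B = U(g)] the antipode and, with [σ] the
    conjugation, the involution. *)
Record representation (C : numClosedFieldType) (X : lmodType C) (mul : X -> X -> X)
    (one : X) (σ : C -> C) (B : lmodType C) (ρ : X -> B -> B) : Prop := {
  rep_semilinear : forall c x y b, ρ (c *: x + y) b = σ c *: ρ x b + ρ y b;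
  rep_linear : forall x, linear (ρ x);
  repM : forall x y b, ρ (mul x y) b = ρ x (ρ y b);
  rep1 : forall b, ρ one b = b
}.

Section FreeRepresentation.
Variables (C : numClosedFieldType) (σ : {rmorphism C -> C}) (g B : lmodType C).

Lemma free_expand (P : free_alg g -> Prop) :
  (forall c x y, P x -> P y -> P (c *: x + y)) ->
  (forall w, P (<< w >> : {malg C[{fmonom g}]})) -> forall x, P x.
Proof.
move=> Pl Pw x.
have P0 : P 0.
  have := Pl (-1) _ _ (Pw (@mone {fmonom g})) (Pw (@mone {fmonom g})).
  by rewrite scaleN1r addNr.
rewrite [x](monalgE (x : {malg C[{fmonom g}]})).
elim: (msupp _ : seq _) => [|w r IH]; first by rewrite big_nil.
rewrite big_cons; have -> : << mcoeff w x *g w >> = mcoeff w x *: << w >> :> {malg C[{fmonom g}]}.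
  by apply/malgP=> k; rewrite mcoeffZ !mcoeffU mulr_natr.
exact: Pl.
Qed.

Section Exists.
Variable f : g -> B -> B.
Hypothesis fl : forall u, linear (f u).

Let word (w : {fmonom g}) (b : B) : B := foldr f b (fmonom_val w).
Let ev (x : free_alg g) (b : B) : B :=
  \sum_(w <- msupp (x : {malg C[{fmonom g}]})) σ (mcoeff w x) *: word w b.

Let word_linear w : linear (word w).
Proof.
rewrite /word; elim: (fmonom_val w) => [|u r IH] c a b //=.
by rewrite IH fl.
Qed.

Let ev_w (d : {fset {fmonom g}}) (x : free_alg g) b :
  (msupp (x : {malg C[{fmonom g}]}) `<=` d)%fset ->
  ev x b = \sum_(w <- d) σ (mcoeff w x) *: word w b.
Proof.
move=> le; rewrite /ev (big_fset_incl _ le) => //= w wd /mcoeff_outdom ->.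
by rewrite rmorph0 scale0r.
Qed.

Let ev_semilinear c (x y : free_alg g) b : ev (c *: x + y) b = σ c *: ev x b + ev y b.
Proof.
pose d := (msupp (x : {malg C[{fmonom g}]}) `|` msupp (y : {malg C[{fmonom g}]})
  `|` msupp ((c *: x + y : free_alg g) : {malg C[{fmonom g}]}))%fset.
rewrite !(@ev_w d); last 3 first.
- exact: fsubset_trans (fsubsetUr _ _) (fsubsetUl _ _).
- exact: fsubset_trans (fsubsetUl _ _) (fsubsetUl _ _).
- exact: fsubsetUr.
rewrite scaler_sumr -big_split; apply: eq_bigr => w _ /=.
have -> : mcoeff w (c *: x + y) = c * mcoeff w x + mcoeff w y.
  by rewrite -mcoeffZ -mcoeffD.
by rewrite rmorphD rmorphM scalerDl scalerA.
Qed.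

Let ev_U w b : ev (<< w >> : {malg C[{fmonom g}]}) b = word w b.
Proof.
rewrite (@ev_w [fset w]%fset) ?big_seq_fset1; last exact: msuppU_le.
by rewrite mcoeffUU rmorph1 scale1r.
Qed.

Let ev_linear x : linear (ev x).
Proof.
move=> c a b; rewrite /ev scaler_sumr -big_split; apply: eq_bigr => w _ /=.
by rewrite word_linear scalerDr !scalerA mulrC.
Qed.

Let ev_M x y b : ev (x * y) b = ev x (ev y b).
Proof.
move: x; apply: free_expand => [c x x' IH IH'|w].
  have -> : (c *: x + x') * y = c *: (x * y) + x' * y by exact: alg_mulDl.
  apply: etrans (ev_semilinear c (x * y) (x' * y) b) _.
  apply: etrans (esym (ev_semilinear c x x' (ev y b))).
  by congr (_ *: _ + _); [exact: IH | exact: IH'].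
rewrite ev_U; move: y; apply: free_expand => [c y y' IH IH'|w'].
  set z : free_alg g := << w >>.
  have -> : z * (c *: y + y') = c *: (z * y) + z * y' by exact: alg_mulDr.
  apply: etrans (ev_semilinear c (z * y) (z * y') b) _.
  apply: etrans (esym (congr1 (word w) (ev_semilinear c y y' b))).
  apply: etrans (esym (word_linear w _ _ _)).
  by congr (_ *: _ + _); [exact: IH | exact: IH'].
have -> : (<< w >> : {malg C[{fmonom g}]}) * << w' >> = << mmul w w' >>.
  by rewrite malgM_def fgmulUU mulr1.
by rewrite !ev_U /word fmM foldr_cat.
Qed.

Lemma free_representation : exists ρ : free_alg g -> B -> B,
  representation *%R 1 σ ρ /\ forall u b, ρ (fgen u) b = f u b.
Proof.
exists ev; split; last by move=> u b; rewrite ev_U /word fmU.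
split.
- exact: ev_semilinear.
- exact: ev_linear.
- exact: ev_M.
by move=> b; rewrite -[1]/(<< @mone {fmonom g} >> : {malg C[{fmonom g}]}) ev_U /word fm1.
Qed.

End Exists.

Lemma free_alg_ind (P : free_alg g -> Prop) :
  P 1 -> (forall c x y, P x -> P y -> P (c *: x + y)) ->
  (forall u x, P x -> P (fgen u * x)) -> forall x, P x.
Proof.
move=> P1 Pl Pg; apply: (free_expand Pl) => w.
have -> : w = FMonom (fmonom_val w) by case: w.
elim: (fmonom_val w) => [|u r IH].
  rewrite -[<< _ >>]/(<< FMonom [::] >> : {malg C[{fmonom g}]}) -fmoneE.
  exact: P1.
have -> : << FMonom (u :: r) >> = fgen u * << FMonom r >> :> {malg C[{fmonom g}]}.
  rewrite [RHS]malgM_def fgmulUU mulr1; congr << _ >>.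
  have e : u :: r = fmonom_val (mmul (fmu u) (FMonom r)) by rewrite fmM fmU.
  by rewrite e fmK.
exact: Pg.
Qed.

End FreeRepresentation.

Section QuotientRepresentation.
Variables (C : numClosedFieldType) (σ : {rmorphism C -> C}) (X : algType C).
Variables (Z : set X) (B : lmodType C) (ρ : X -> B -> B).
Hypotheses (hρ : representation *%R 1 σ ρ) (Z0 : forall x b, Z x -> ρ x b = 0).

Lemma representation0 b : ρ 0 b = 0.
Proof.
have := rep_semilinear hρ (-1) 0 0 b; rewrite scaler0 addr0 => e.
by rewrite e rmorphN rmorph1 scaleN1r addNr.
Qed.

Lemma representationB x y b : ρ (x - y) b = ρ x b - ρ y b.
Proof.
have := rep_semilinear hρ (-1) y x b.
by rewrite rmorphN rmorph1 !scaleN1r addrC => ->; rewrite addrC.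
Qed.

(** [ρ z] vanishes on all of [B] for [z] in [Z], hence so does [ρ (a z b)]: [b] only changes the
    vector and [ρ a] is linear. The choice of representatives in [ρ'] is therefore harmless. *)
Lemma quotient_representation : exists ρ' : aquot Z -> B -> B,
  [/\ forall c x y b, ρ' (c *: x + y) b = σ c *: ρ' x b + ρ' y b,
      forall x, linear (ρ' x),
      forall x y b, ρ' (x * y) b = ρ' x (ρ' y b)
    & forall x b, ρ' (api Z x) b = ρ x b].
Proof.
pose ρ' (q : aquot Z) b := ρ (repr (q : lquot (ideal_gens Z))) b.
have Z0' z b : Defs.span (ideal_gens Z) z -> ρ z b = 0.
  move=> sz; move: b; elim: sz => [b|c _ v [x [y [w [Zy ->]]]] _ IH b]; first exact: representation0.
  rewrite (rep_semilinear hρ) IH addr0 !(repM hρ) (Z0 _ Zy).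
  by rewrite (lin0 (rep_linear hρ x)) scaler0.
have ρ'E x b : ρ' (api Z x) b = ρ x b.
  apply/eqP; rewrite -subr_eq0 -representationB; apply/eqP/Z0'.
  exact: lpi_repr.
exists ρ'; split=> //.
- move=> c x y b; rewrite -[x]apiK -[y]apiK -apiZ -apiD !ρ'E.
  exact: rep_semilinear hρ _ _ _ _.
- by move=> x; apply: rep_linear hρ _.
by move=> x y b; rewrite -[x]apiK -[y]apiK -apiM !ρ'E; apply: repM hρ _ _ _.
Qed.

End QuotientRepresentation.

Section EnvRepresentation.
Variables (C : numClosedFieldType) (K : algType C) (g : lmodType C).
Variables (R : K ⊗ K) (act : K -> g -> g) (br : g -> g -> g).
Local Notation env := (env R act br).
Local Notation egen := (egen R act br).

(** A representation of the free algebra descends twice: [fs] kills the linearity relations of the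
    tensor algebra, [frel] the defining relations of [U(g)]. *)
Lemma env_representation (σ : {rmorphism C -> C}) (B : lmodType C) (f : g -> B -> B) :
  (forall u, linear (f u)) ->
  (forall c u v b, f (c *: u + v) b = σ c *: f u b + f v b) ->
  (forall u v b, f u (f v b)
     = \tsum_(r1, r2 <- R) f (act r2 v) (f (act r1 u) b) + f (br u v) b) ->
  exists ρ : env -> B -> B,
    representation *%R 1 σ ρ /\ forall u b, ρ (egen u) b = f u b.
Proof.
move=> fl fs frel.
have [ρ0 [h0 ρ0g]] := free_representation σ fl.
have Z0 x b : free_lin_rel x -> ρ0 x b = 0.
  case=> c u v; rewrite (representationB h0) (rep_semilinear h0) !ρ0g fs subrr //.
have [ρ1 [h1s h1l h1M h1E]] := quotient_representation h0 Z0.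
have h1 : representation ( *%R : tensor_alg g -> _) 1 σ ρ1.
  split=> // b; rewrite -[1]/(api (@free_lin_rel C g) 1) h1E; exact: rep1 h0 b.
have ρ1g u b : ρ1 (tgen u) b = f u b by rewrite h1E ρ0g.
have Z1 x b : env_rel R act br x -> ρ1 x b = 0.
  case=> u v; rewrite !(representationB h1) (repM h1) !ρ1g frel.
  have -> : ρ1 (\tsum_(r1, r2 <- R) tgen (act r2 v) * tgen (act r1 u)) b
      = \tsum_(r1, r2 <- R) f (act r2 v) (f (act r1 u) b).
    have h10 := representation0 h1 b.
    have h1D : {morph ρ1^~ b : x y / x + y}.
      by move=> p q; have := h1s 1 p q b; rewrite rmorph1 !scale1r.
    rewrite [LHS](big_morph _ h1D h10); apply: eq_bigr => p _.
    by rewrite (repM h1) !ρ1g.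
  by rewrite addrAC addrK subrr.
have [ρ2 [h2s h2l h2M h2E]] := quotient_representation h1 Z1.
exists (ρ2 : env -> B -> B); split; last by move=> u b; rewrite h2E ρ1g.
split=> // b; rewrite -[1]/(api (@env_rel C K g R act br) 1) h2E; exact: rep1 h1 b.
Qed.

Lemma env_ind (P : env -> Prop) :
  P 1 -> (forall c x y, P x -> P y -> P (c *: x + y)) ->
  (forall u x, P x -> P (egen u * x)) -> forall x, P x.
Proof.
move=> P1 Pl Pg x; rewrite -[x]apiK; set t : tensor_alg g := repr _.
rewrite -[t]apiK; move: (repr _) => z {x t}.
elim/free_alg_ind: z => [||u z IH].
- exact: P1.
- by move=> c z z' IH IH'; rewrite apiD apiZ apiD apiZ; apply: Pl.
by rewrite apiM apiM; apply: Pg.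
Qed.

Lemma egen_linear : linear egen.
Proof. by move=> c u v; rewrite /egen tgen_linear apiD apiZ. Qed.

Lemma egen_rel u v : egen u * egen v
  = \tsum_(r1, r2 <- R) egen (act r2 v) * egen (act r1 u) + egen (br u v).
Proof.
have e : api (env_rel R act br)
    (tgen u * tgen v - (\tsum_(r1, r2 <- R) tgen (act r2 v) * tgen (act r1 u)))
    = api (env_rel R act br) (tgen (br u v)).
  apply/apiP/span_gen; exists 1, (tgen u * tgen v
     - (\tsum_(r1, r2 <- R) tgen (act r2 v) * tgen (act r1 u)) - tgen (br u v)), 1.
  by split; [exact: Env_rel | exact: mul1_mul1].
have {}e : api (env_rel R act br) (tgen u * tgen v)
    - api (env_rel R act br) (\tsum_(r1, r2 <- R) tgen (act r2 v) * tgen (act r1 u))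
    = egen (br u v) by rewrite -[RHS]e [RHS]raddfB.
have eS : api (env_rel R act br) (\tsum_(r1, r2 <- R) tgen (act r2 v) * tgen (act r1 u))
    = \tsum_(r1, r2 <- R) egen (act r2 v) * egen (act r1 u).
  by rewrite [LHS]raddf_sum; apply: eq_bigr => p _; exact: apiM.
have eA : api (env_rel R act br) (tgen u * tgen v) = egen u * egen v by exact: apiM.
exact: (sub_shift e eA eS).
Qed.

End EnvRepresentation.

(** Abstracting the properties of [e : g -> U(g)] keeps the quotient construction
    of [U(g)] out of the computations. *)
Record enveloping (C : numClosedFieldType) (K : algType C) (g : lmodType C)
    (R : K ⊗ K) (act : K -> g -> g) (br : g -> g -> g) (L : lmodType C)
    (mul : L -> L -> L) (one : L) (e : g -> L) : Prop := {
  env_mul : bilin mul;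
  env_mulA : associative mul;
  env_mul1l : left_id one mul;
  env_mul1r : right_id one mul;
  env_linear : linear e;
  env_relation : forall u v, mul (e u) (e v)
    = \tsum_(r1, r2 <- R) mul (e (act r2 v)) (e (act r1 u)) + e (br u v);
  env_induction : forall P : L -> Prop, P one ->
    (forall c x y, P x -> P y -> P (c *: x + y)) ->
    (forall u x, P x -> P (mul (e u) x)) -> forall x, P x;
  env_rep : forall (σ : {rmorphism C -> C}) (B : lmodType C) (f : g -> B -> B),
    (forall u, linear (f u)) ->
    (forall c u v b, f (c *: u + v) b = σ c *: f u b + f v b) ->
    (forall u v b, f u (f v b)
       = \tsum_(r1, r2 <- R) f (act r2 v) (f (act r1 u) b) + f (br u v) b) ->
    exists ρ : L -> B -> B, representation mul one σ ρ /\ forall u b, ρ (e u) b = f u b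
}.

Lemma uenv_enveloping (C : numClosedFieldType) (K : algType C) (H : hopf_data K)
    (g : lmodType C) (d : blie_data K g) :
  enveloping (Rmat H) (lact d) (lbr d) *%R 1 (ugen H d).
Proof.
split.
- by split=> [w|v] c x y; [exact: alg_mulDl | exact: alg_mulDr].
- exact: mulrA.
- exact: mul1r.
- exact: mulr1.
- exact: egen_linear.
- exact: egen_rel.
- exact: env_ind.
exact: env_representation.
Qed.

(** * The action of K on U(g) *)

Section EnvAction.
Variables (C : numClosedFieldType) (K : algType C) (H : hopf_data K).
Variables (g : lmodType C) (d : blie_data K g) (L : lmodType C).
Variables (mul : L -> L -> L) (one : L) (e : g -> L).
Hypotheses (hR : triangular_Rmat H) (hL : enveloping (Rmat H) (lact d) (lbr d) mul one e).
Hypothesis gm : is_module (lact d).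
Hypothesis gM : act_multiplicative H (lact d) (lbr d).

Let hH := tri_hopf hR.
Local Notation R := (Rmat H).
Local Notation act := (lact d).
Let ab : bilin act := module_bilin gm.
Let el := env_linear hL.
Let mb := env_mul hL.
Let mA := env_mulA hL.
Let Δl := comul_linear hH.
Local Notation B := (linmap K L).

(** This is how [u] acts on maps from [K] to [L]: it must send [k ↦ k ▷ x] to [k ↦ k ▷ (u x)]. *)
Lemma act_op_linear u (h : B) :
  linear (fun k => \tsum_(k1, k2 <- comul H k) mul (e (act k1 u)) (h k2)).
Proof. by lin. Qed.

Let f u (h : B) : B := to_linmap (act_op_linear u h).

Let f_linear u : linear (f u).
Proof.
move=> c h h'; apply: linmap_ext => k; rewrite linmapP /=.
rewrite -tsum_lin; apply: eq_tsum => k1 k2.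
exact: (proj2 mb _ c (h k2) (h' k2)).
Qed.

Let f_lin c u v (h : B) : f (c *: u + v) h = c *: f u h + f v h.
Proof.
apply: linmap_ext => k; rewrite linmapP /= -tsum_lin; apply: eq_tsum => k1 k2.
by rewrite (act_linear gm) el (proj1 mb).
Qed.

(** Coassociativity reduces the claim to [core], the defining relation acted on by [k]. That one
    follows from equivariance of the bracket and quasi-cocommutativity. *)
Let f_rel u v (h : B) : f u (f v h)
  = \tsum_(r1, r2 <- R) f (act r2 v) (f (act r1 u) h) + f (lbr d u v) h.
Proof.
have ff p q k : f p (f q h) k
    = \tsum_(k1, k2 <- comul H k) \tsum_(a, b <- comul H k1) mul (mul (e (act a p)) (e (act b q))) (h k2).
  rewrite (coassocE hH (f := fun a b c => mul (mul (e (act a p)) (e (act b q))) (h c))); last by lin.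
  rewrite /=; apply: eq_tsum => k1 k2.
  rewrite (lin_sum (h := fun z => mul (e (act k1 p)) z)); last by lin.
  by apply: eq_tsum => a b; rewrite mA.
have core k : \tsum_(a, b <- comul H k) mul (e (act a u)) (e (act b v))
    = \tsum_(r1, r2 <- R) \tsum_(a, b <- comul H k)
        mul (e (act a (act r2 v))) (e (act b (act r1 u))) + e (act k (lbr d u v)).
  rewrite gM (lin_sum _ _ el).
  have -> : \tsum_(r1, r2 <- R) \tsum_(a, b <- comul H k)
        mul (e (act a (act r2 v))) (e (act b (act r1 u)))
     = \tsum_(a, b <- comul H k) \tsum_(r1, r2 <- R)
        mul (e (act r2 (act b v))) (e (act r1 (act a u))).
    rewrite exchange_tsum.
    transitivity (\tsum_(a, b <- comul H k) \tsum_(r1, r2 <- R)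
       mul (e (act (a * r2) v)) (e (act (b * r1) u))).
      by do 2!(apply: eq_tsum => ? ?); rewrite !(act_mul gm).
    rewrite -(Rmat_comulE hR (f := fun p q => mul (e (act q v)) (e (act p u)))); last by lin.
    by rewrite exchange_tsum; do 2!(apply: eq_tsum => ? ?); rewrite !(act_mul gm).
  by rewrite -tsum_addf; apply: eq_tsum => a b; apply: env_relation hL _ _.
apply: linmap_ext => k; rewrite ff.
rewrite [RHS](linD (@eval_linear _ _ _ k)) (lin_sum _ _ (@eval_linear _ _ _ k)).
have -> : \tsum_(r1, r2 <- R) f (act r2 v) (f (act r1 u) h) k
  = \tsum_(k1, k2 <- comul H k) \tsum_(r1, r2 <- R) \tsum_(a, b <- comul H k1)
       mul (mul (e (act a (act r2 v))) (e (act b (act r1 u)))) (h k2).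
  rewrite exchange_tsum; apply: eq_tsum => r1 r2; exact: ff.
rewrite /= -tsum_addf; apply: eq_tsum => k1 k2.
rewrite -(lin_sum (h := fun z => mul z (h k2))); last by lin.
rewrite core (linD (proj1 mb _)); congr (_ + _).
rewrite (lin_sum (h := fun z => mul z (h k2))); last by lin.
by apply: eq_tsum => r1 r2; rewrite (lin_sum (h := fun z => mul z (h k2))) //; lin.
Qed.

Lemma env_action : exists bact : K -> L -> L,
  [/\ is_module bact, forall k, bact k one = counit H k *: one,
      act_multiplicative H bact mul & forall k u, bact k (e u) = e (act k u)].
Proof.
have [ρ [hρ ρe]] := env_rep hL (σ := idfun) f_linear f_lin f_rel.
have e0l : linear (fun k => counit H k *: one).
  by apply: lin_scalar; apply: counit_linear hH.
(* The family [k ↦ k ▷ 1], so that [ρ x h0] is [k ↦ k ▷ x]. *)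
pose h0 : B := to_linmap e0l.
pose bact k x := ρ x h0 k.
(* For [h] the family [k ↦ k ▷ y] this is multiplicativity of the action; the induction needs every
   [h]. *)
have ρl x h k : ρ x h k = \tsum_(k1, k2 <- comul H k) mul (bact k1 x) (h k2).
  have bl y : linear (fun k => bact k y) by exact: linmap_linear.
  move: x h k; apply: (env_induction hL) => [h k|c x y IHx IHy h k|u x IH h k].
  - rewrite (rep1 hρ) /bact (rep1 hρ) /=.
    rewrite -[LHS](counitlE hH k (linmap_linear h)); apply: eq_tsum => k1 k2.
    by rewrite (linZ (proj1 mb _)) (env_mul1l hL).
  - rewrite (rep_semilinear hρ) linmapP IHx IHy -tsum_lin; apply: eq_tsum => k1 k2.
    by rewrite /bact (rep_semilinear hρ) linmapP (proj1 mb).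
  rewrite (repM hρ) ρe /=.
  have bE k1 : bact k1 (mul (e u) x) = \tsum_(a, b <- comul H k1) mul (e (act a u)) (bact b x).
    by rewrite /bact (repM hρ) ρe.
  transitivity (\tsum_(k1, k2 <- comul H k) \tsum_(a, b <- comul H k2)
      mul (e (act k1 u)) (mul (bact a x) (h b))).
    apply: eq_tsum => k1 k2; rewrite IH (lin_sum (h := fun z => mul _ z)) //; lin.
  rewrite -(coassocE hH (f := fun a b c => mul (e (act a u)) (mul (bact b x) (h c)))); last by lin.
  apply: eq_tsum => k1 k2; rewrite bE (lin_sum (h := fun z => mul z _)); last by lin.
  by apply: eq_tsum => a b; rewrite mA.
have bl y : linear (fun k => bact k y) by exact: linmap_linear.
have blr k : linear (bact k).
  by move=> c x y; rewrite /bact (rep_semilinear hρ) linmapP.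
have b1 k : bact k one = counit H k *: one by rewrite /bact (rep1 hρ).
have be k u : bact k (e u) = e (act k u).
  rewrite /bact ρe /=.
  transitivity (\tsum_(k1, k2 <- comul H k) counit H k2 *: e (act k1 u)).
    by apply: eq_tsum => k1 k2; rewrite (linZ (proj2 mb _)) (env_mul1r hL).
  by rewrite (counitrE hH (f := fun k => e (act k u))) //; lin.
have bM : act_multiplicative H bact mul.
  by move=> k x y; rewrite /bact (repM hρ) ρl.
have bb : bilin bact by split.
exists bact; split=> //; split=> //.
  apply: (env_induction hL) => [|c x y IHx IHy|u x IH].
  - by rewrite b1 (counit_one hH) scale1r.
  - by rewrite blr IHx IHy.
  by rewrite bM (comul1E hH) ?be ?(act_one gm) ?IH //; lin.
move=> k l x; move: x k l.
apply: (env_induction hL) => [k l|c x y IHx IHy k l|u x IH k l].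
- by rewrite !b1 (counit_mul hH) (linZ (blr k)) b1 scalerA mulrC.
- by rewrite !blr IHx IHy.
rewrite bM (comulME hH); last by lin.
rewrite bM (lin_sum _ _ (blr k)) exchange_tsum; apply: eq_tsum => l1 l2.
rewrite bM; apply: eq_tsum => k1 k2.
by rewrite !be IH (act_mul gm).
Qed.

End EnvAction.

(** * The braided tensor square *)

Section BraidedTensor.
Variables (C : numClosedFieldType) (K : algType C) (H : hopf_data K).
Variables (L : lmodType C) (act : K -> L -> L) (mul : L -> L -> L) (one : L).
Hypotheses (hR : triangular_Rmat H) (am : is_module act) (mb : bilin mul).
Hypotheses (mA : associative mul) (m1l : left_id one mul) (m1r : right_id one mul).
Hypotheses (act1 : forall k, act k one = counit H k *: one).
Hypothesis aM : act_multiplicative H act mul.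

Let hH := tri_hopf hR.
Let ab : bilin act := module_bilin am.
Let aa k l x : act k (act l x) = act (k * l) x. Proof. by rewrite (act_mul am). Qed.
Let a1 x : act 1 x = x. Proof. exact: act_one am x. Qed.
Let Δl := comul_linear hH.
Local Notation R := (Rmat H).

Definition braided_mul (s t : L ⊗ L) : L ⊗ L :=
  \tsum_(x, y <- s) \tsum_(x', y' <- t) \tsum_(r1, r2 <- R)
    mul x (act r2 x') ⊗ mul (act r1 y) y'.

Lemma braided_mul_bilin : bilin braided_mul.
Proof. by rewrite /braided_mul; lin. Qed.

Let bb := braided_mul_bilin.

Lemma braided_mulE x y x' y' : braided_mul (x ⊗ y) (x' ⊗ y')
  = \tsum_(r1, r2 <- R) mul x (act r2 x') ⊗ mul (act r1 y) y'.
Proof.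
rewrite /braided_mul tsumE; last by lin.
by rewrite tsumE //; lin.
Qed.

(** Both bracketings reduce to one triple sum, the left by the hexagon for [id ⊗ Δ] and the right by
    that for [Δ ⊗ id]. *)
Lemma braided_mulA : associative braided_mul.
Proof.
move=> s t w.
apply: (tensor_lin_ext (f := fun s => braided_mul s _)
  (g := fun s => braided_mul (braided_mul s t) w)) s => [||x y]; [by lin | by lin |].
apply: (tensor_lin_ext (f := fun t => braided_mul _ (braided_mul t w))
  (g := fun t => braided_mul (braided_mul _ t) w)) t => [||x' y']; [by lin | by lin |].
apply: (tensor_lin_ext (f := fun w => braided_mul _ (braided_mul _ w))
  (g := fun w => braided_mul _ w)) w => [||z z']; [by lin | by lin |].
rewrite !braided_mulE (lin_sum _ _ (proj2 bb _)) (lin_sum _ _ (proj1 bb _)).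
transitivity (\tsum_(r1, r2 <- R) \tsum_(s1, s2 <- R) \tsum_(t1, t2 <- R)
   mul x (mul (act r2 x') (act (t2 * s2) z))
   ⊗ mul (act (t1 * r1) y) (mul (act s1 y') z')).
  rewrite [RHS]exchange_tsum; apply: eq_tsum => s1 s2; rewrite braided_mulE.
  transitivity (\tsum_(t1, t2 <- R) \tsum_(a, b <- comul H t2)
     mul x (mul (act a x') (act (b * s2) z)) ⊗ mul (act t1 y) (mul (act s1 y') z')).
    apply: eq_tsum => t1 t2.
    rewrite aM (lin_sum (h := fun v => mul x v ⊗ _)); last by lin.
    by apply: eq_tsum => a b; rewrite aa.
  rewrite (Rmat_hexrE hR (f := fun t a b =>
    mul x (mul (act a x') (act (b * s2) z)) ⊗ mul (act t y) (mul (act s1 y') z'))); last by lin.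
  by rewrite exchange_tsum.
apply: eq_tsum => r1 r2; rewrite braided_mulE.
transitivity (\tsum_(t1, t2 <- R) \tsum_(a, b <- comul H t1)
   mul (mul x (act r2 x')) (act t2 z) ⊗ mul (mul (act (a * r1) y) (act b y')) z'); last first.
  apply: eq_tsum => t1 t2.
  rewrite aM (lin_sum (h := fun v => _ ⊗ mul v _)); last by lin.
  by apply: eq_tsum => a b; rewrite aa.
rewrite (Rmat_hexlE hR (f := fun a b t =>
   mul (mul x (act r2 x')) (act t z) ⊗ mul (mul (act (a * r1) y) (act b y')) z')); last by lin.
rewrite exchange_tsum; apply: eq_tsum => t1 t2; apply: eq_tsum => s1 s2.
by rewrite !mA.
Qed.

Lemma braided_mul1l s : braided_mul (one ⊗ one) s = s.
Proof.
apply: (tensor_lin_ext (f := fun s => braided_mul _ s) (g := id)) s => [||x y]; [by lin | by lin |].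
rewrite braided_mulE.
transitivity (\tsum_(r1, r2 <- R) counit H r1 *: (act r2 x ⊗ y)).
  by apply: eq_tsum => r1 r2; rewrite act1 m1l (linZ (proj1 mb _)) m1l tpureZr.
by rewrite (Rmat_counitl hR (f := fun r => act r x ⊗ y)) ?a1 //; lin.
Qed.

Lemma braided_mul1r s : braided_mul s (one ⊗ one) = s.
Proof.
apply: (tensor_lin_ext (f := fun s => braided_mul s _) (g := id)) s => [||x y]; [by lin | by lin |].
rewrite braided_mulE.
transitivity (\tsum_(r1, r2 <- R) counit H r2 *: (x ⊗ act r1 y)).
  by apply: eq_tsum => r1 r2; rewrite act1 m1r (linZ (proj2 mb _)) m1r tpureZl.
by rewrite (Rmat_counitr hR (f := fun r => x ⊗ act r y)) ?a1 //; lin.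
Qed.

Definition tensor_act k (t : L ⊗ L) : L ⊗ L :=
  \tsum_(k1, k2 <- comul H k) tmap (act k1) (act k2) t.

Lemma tensor_act_bilin : bilin tensor_act.
Proof. by rewrite /tensor_act /tmap; lin. Qed.

Let tb := tensor_act_bilin.

Lemma tensor_actE k x y :
  tensor_act k (x ⊗ y) = \tsum_(k1, k2 <- comul H k) act k1 x ⊗ act k2 y.
Proof. by apply: eq_tsum => a b; rewrite /tmap tsumE //; lin. Qed.

(** On pure tensors an iterated coproduct with four legs appears. Coassociativity isolates its two
    middle legs, which sit next to [R], and quasi-cocommutativity exchanges them. *)
Lemma tensor_act_mul : act_multiplicative H tensor_act braided_mul.
Proof.
move=> k s t.
apply: (tensor_lin_ext (f := fun s => tensor_act k (braided_mul s t)) (g := fun s =>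
  \tsum_(a, b <- comul H k) braided_mul (tensor_act a s) (tensor_act b t))) s
  => [||x y]; [by lin | by lin |].
apply: (tensor_lin_ext (f := fun t => tensor_act k (braided_mul _ t)) (g := fun t =>
  \tsum_(a, b <- comul H k) braided_mul (tensor_act a _) (tensor_act b t))) t
  => [||x' y']; [by lin | by lin |].
transitivity (\tsum_(k1, k2 <- comul H k) \tsum_(a, b <- comul H k2)
   \tsum_(c, d <- comul H a) \tsum_(r1, r2 <- R)
   mul (act k1 x) (act (c * r2) x') ⊗ mul (act (d * r1) y) (act b y')).
  rewrite braided_mulE (lin_sum _ _ (proj2 tb _)).
  transitivity (\tsum_(r1, r2 <- R) \tsum_(k1, k2 <- comul H k)
     \tsum_(a, b <- comul H k1) \tsum_(c, d <- comul H k2)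
     mul (act a x) (act (b * r2) x') ⊗ mul (act (c * r1) y) (act d y')).
    apply: eq_tsum => r1 r2; rewrite tensor_actE; apply: eq_tsum => k1 k2.
    rewrite aM (lin_sum (h := fun v => v ⊗ _)); last by lin.
    apply: eq_tsum => a b; rewrite aM (lin_sum (h := fun v => _ ⊗ v)); last by lin.
    by apply: eq_tsum => c d; rewrite !aa.
  rewrite exchange_tsum.
  transitivity (\tsum_(k1, k2 <- comul H k) \tsum_(a, b <- comul H k1)
     \tsum_(c, d <- comul H k2) \tsum_(r1, r2 <- R)
     mul (act a x) (act (b * r2) x') ⊗ mul (act (c * r1) y) (act d y')).
    apply: eq_tsum => k1 k2; rewrite exchange_tsum; apply: eq_tsum => a b.
    by rewrite exchange_tsum.
  rewrite (coassocE hH (f := fun a b e => \tsum_(c, d <- comul H e) \tsum_(r1, r2 <- R)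
     mul (act a x) (act (b * r2) x') ⊗ mul (act (c * r1) y) (act d y'))); last by lin.
  apply: eq_tsum => k1 k2.
  by rewrite -(coassocE hH (f := fun b c d => \tsum_(r1, r2 <- R)
     mul (act k1 x) (act (b * r2) x') ⊗ mul (act (c * r1) y) (act d y'))) //; lin.
transitivity (\tsum_(k1, k2 <- comul H k) \tsum_(a, b <- comul H k2)
   \tsum_(c, d <- comul H a) \tsum_(r1, r2 <- R)
   mul (act k1 x) (act (r2 * d) x') ⊗ mul (act (r1 * c) y) (act b y')).
  apply: eq_tsum => k1 k2; apply: eq_tsum => a b.
  rewrite -(Rmat_comulE hR (f := fun p q =>
    mul (act k1 x) (act q x') ⊗ mul (act p y) (act b y'))); last by lin.
  by rewrite exchange_tsum.
transitivity (\tsum_(k1, k2 <- comul H k) \tsum_(c, e <- comul H k2)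
   \tsum_(d, b <- comul H e) \tsum_(r1, r2 <- R)
   mul (act k1 x) (act (r2 * d) x') ⊗ mul (act (r1 * c) y) (act b y')).
  apply: eq_tsum => k1 k2.
  by rewrite -(coassocE hH (f := fun c d b => \tsum_(r1, r2 <- R)
     mul (act k1 x) (act (r2 * d) x') ⊗ mul (act (r1 * c) y) (act b y'))) //; lin.
rewrite -(coassocE hH (f := fun k1 c e => \tsum_(d, b <- comul H e) \tsum_(r1, r2 <- R)
   mul (act k1 x) (act (r2 * d) x') ⊗ mul (act (r1 * c) y) (act b y'))); last by lin.
apply: eq_tsum => k1 k2; rewrite !tensor_actE.
rewrite (lin_sum _ _ (proj1 bb _)); apply: eq_tsum => a b.
rewrite (lin_sum _ _ (proj2 bb _)); apply: eq_tsum => c d.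
by rewrite braided_mulE; apply: eq_tsum => r1 r2; rewrite !aa.
Qed.

Section Star.
Variables (s : K -> K) (star : L -> L).
Hypotheses (hs : conj_structure H s) (sa : antilinear star).
Hypothesis sM : forall x y, star (mul x y) = mul (star y) (star x).
Hypothesis s_act : forall k x, star (act k x) = act (s k) (star x).

Definition tensor_star (t : L ⊗ L) : L ⊗ L :=
  \tsum_(x, y <- t) \tsum_(r1, r2 <- R) act r2 (star x) ⊗ act r1 (star y).

Let star_form (x y : L) : L ⊗ L := \tsum_(r1, r2 <- R) act r2 x ⊗ act r1 y.
Let sf : bilin star_form. Proof. by rewrite /star_form; lin. Qed.
Let sfb : balanced (fun x y => star_form (star x) (star y)).
Proof. exact: balanced_antilin. Qed.

Lemma tensor_starE x y :
  tensor_star (x ⊗ y) = \tsum_(r1, r2 <- R) act r2 (star x) ⊗ act r1 (star y).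
Proof. exact: (tsum_pure sfb). Qed.

Lemma tensor_star_antilinear : antilinear tensor_star.
Proof.
apply: (balanced_antilinear sfb) => c x y.
by rewrite (antilinZ sa); exact: (linZ (proj1 sf _)).
Qed.

Lemma tensor_star_sum (V W : lmodType C) (f : V -> W -> L ⊗ L) (t : V ⊗ W) :
  tensor_star (tsum f t) = \tsum_(x, y <- t) tensor_star (f x y).
Proof. exact: (balanced_tsum _ _ sfb). Qed.

Lemma tensor_star_mul t t' :
  tensor_star (braided_mul t t') = braided_mul (tensor_star t') (tensor_star t).
Proof.
elim/tensor_ind: t => [x y|t1 t2 IH1 IH2]; last first.
  by rewrite (linD (proj1 bb _)) !(antilinD tensor_star_antilinear) (linD (proj2 bb _)) IH1 IH2.
elim/tensor_ind: t' => [x' y'|t1 t2 IH1 IH2]; last first.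
  by rewrite (linD (proj2 bb _)) !(antilinD tensor_star_antilinear) (linD (proj1 bb _)) IH1 IH2.
(* The hexagon splits off an [R] that cancels against the flipped one coming from the braided
   product. *)
have inner (g : L -> L -> L ⊗ L) X' Y Y' : bilin g ->
    \tsum_(r1, r2 <- R) \tsum_(t1, t2 <- R)
      g (act t1 (mul Y' (act r2 Y))) (act t2 (act r1 X'))
    = \tsum_(p1, p2 <- R) g (mul (act p1 Y') Y) (act p2 X').
  move=> gb.
  transitivity (\tsum_(r1, r2 <- R) \tsum_(p1, p2 <- R) \tsum_(q1, q2 <- R)
      g (mul (act p1 Y') (act (q1 * r2) Y)) (act p2 (act (q2 * r1) X'))).
    apply: eq_tsum => r1 r2.
    transitivity (\tsum_(t1, t2 <- R) \tsum_(a, b <- comul H t1)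
      g (mul (act a Y') (act (b * r2) Y)) (act (t2 * r1) X')).
      apply: eq_tsum => t1 t2; rewrite aM (lin_sum (h := fun v => g v _)); last by lin.
      by apply: eq_tsum => a b; rewrite !aa.
    rewrite (Rmat_hexlE hR (f := fun a b t =>
      g (mul (act a Y') (act (b * r2) Y)) (act (t * r1) X'))); last by lin.
    by do 2!(apply: eq_tsum => ? ?); rewrite aa mulrA.
  rewrite exchange_tsum; apply: eq_tsum => p1 p2; rewrite exchange_tsum.
  rewrite (Rmat_mulV hR (f := fun u v =>
    g (mul (act p1 Y') (act u Y)) (act p2 (act v X')))); last by lin.
  by rewrite !a1.
set X := star x; set Y := star y; set X' := star x'; set Y' := star y'.
transitivity (\tsum_(r1, r2 <- R) \tsum_(t1, t2 <- R)
   act t2 (mul (act r1 X') X) ⊗ act t1 (mul Y' (act r2 Y))).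
  rewrite braided_mulE tensor_star_sum.
  rewrite -(conj_RmatE hs (f := fun u v => \tsum_(t1, t2 <- R)
     act t2 (mul (act v X') X) ⊗ act t1 (mul Y' (act u Y)))); last by lin.
  by apply: eq_tsum => r1 r2; rewrite tensor_starE !sM !s_act.
transitivity (\tsum_(r1, r2 <- R) \tsum_(p1, p2 <- R) \tsum_(t1, t2 <- R)
   mul (act t2 (act r1 X')) (act p2 X) ⊗ act p1 (act t1 (mul Y' (act r2 Y)))).
  apply: eq_tsum => r1 r2.
  transitivity (\tsum_(t1, t2 <- R) \tsum_(a, b <- comul H t2)
     mul (act a (act r1 X')) (act b X) ⊗ act t1 (mul Y' (act r2 Y))).
    by apply: eq_tsum => t1 t2; rewrite aM (lin_sum (h := fun v => v ⊗ _)) //; lin.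
  rewrite (Rmat_hexrE hR (f := fun t a b =>
     mul (act a (act r1 X')) (act b X) ⊗ act t (mul Y' (act r2 Y)))); last by lin.
  by do 2!(apply: eq_tsum => ? ?); rewrite (act_mul am).
rewrite exchange_tsum.
transitivity (\tsum_(t1, t2 <- R) \tsum_(p1, p2 <- R)
   mul (act p2 X') (act t2 X) ⊗ act t1 (mul (act p1 Y') Y)).
  apply: eq_tsum => t1 t2.
  by rewrite (inner (fun u v => mul v (act t2 X) ⊗ act t1 u)) //; lin.
rewrite exchange_tsum !tensor_starE (lin_sum _ _ (proj1 bb _)).
apply: eq_tsum => p1 p2; rewrite (lin_sum _ _ (proj2 bb _)).
transitivity (\tsum_(t1, t2 <- R) \tsum_(a, b <- comul H t1)
   mul (act p2 X') (act t2 X) ⊗ mul (act a (act p1 Y')) (act b Y)).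
  by apply: eq_tsum => t1 t2; rewrite aM (lin_sum (h := fun v => _ ⊗ v)) //; lin.
rewrite (Rmat_hexlE hR (f := fun a b t =>
   mul (act p2 X') (act t X) ⊗ mul (act a (act p1 Y')) (act b Y))); last by lin.
rewrite exchange_tsum; apply: eq_tsum => q1 q2; rewrite braided_mulE.
by apply: eq_tsum => r1 r2; rewrite (act_mul am).
Qed.

End Star.

End BraidedTensor.

Lemma braided_mul_map (C : numClosedFieldType) (K : algType C) (H : hopf_data K)
    (L L' : lmodType C) (act : K -> L -> L) (act' : K -> L' -> L')
    (mul : L -> L -> L) (mul' : L' -> L' -> L') (h : L -> L') :
  is_module act -> is_module act' -> bilin mul -> bilin mul' -> linear h ->
  (forall x y, h (mul x y) = mul' (h x) (h y)) ->
  (forall k x, h (act k x) = act' k (h x)) -> forall s t,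
  tmap h h (braided_mul H act mul s t)
  = braided_mul H act' mul' (tmap h h s) (tmap h h t).
Proof.
move=> am am' mb mb' hl hM ha s t.
have ab := module_bilin am; have ab' := module_bilin am'.
have bb := braided_mul_bilin H am mb; have bb' := braided_mul_bilin H am' mb'.
have tl : linear (tmap h h : L ⊗ L -> L' ⊗ L') by rewrite /tmap; lin.
have tE x y : tmap h h (x ⊗ y) = h x ⊗ h y by rewrite /tmap tsumE //; lin.
apply: (tensor_lin_ext (f := fun s => tmap h h (braided_mul H act mul s t))
  (g := fun s => braided_mul H act' mul' (tmap h h s) (tmap h h t))) s
  => [||x y]; [by lin | by lin |].
apply: (tensor_lin_ext (f := fun t => tmap h h (braided_mul H act mul _ t))
  (g := fun t => braided_mul H act' mul' (tmap h h _) (tmap h h t))) t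
  => [||x' y']; [by lin | by lin |].
rewrite (braided_mulE H am mb) !tE (braided_mulE H am' mb') (lin_sum _ _ tl).
by apply: eq_tsum => r1 r2; rewrite tE !hM !ha.
Qed.

Lemma addrACA_eq (V : zmodType) (a b c d a' b' c' d' : V) :
  a = a' -> b = b' -> c = c' -> d = d' -> a + b + (c + d) = a' + c' + (b' + d').
Proof. by move=> -> -> -> ->; rewrite addrACA. Qed.

Lemma addr_pairs (V : zmodType) (p q x b c y : V) :
  p + b + x + (y + (q + c)) = p + y + (x + q) + (b + c).
Proof. by rewrite [RHS](AC (2*2*2) (1*5*3*(2*(4*6)))). Qed.

(** * The structure maps of U(g) *)

Section EnvMaps.
Variables (C : numClosedFieldType) (K : algType C) (H : hopf_data K).
Variables (g : lmodType C) (d : blie_data K g) (L : lmodType C).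
Variables (mul : L -> L -> L) (one : L) (e : g -> L) (act : K -> L -> L).
Hypotheses (hR : triangular_Rmat H).
Hypothesis hL : enveloping (Rmat H) (lact d) (lbr d) mul one e.
Hypotheses (am : is_module act) (act1 : forall k, act k one = counit H k *: one).
Hypotheses (aM : act_multiplicative H act mul).
Hypothesis act_e : forall k u, act k (e u) = e (lact d k u).

Let hH := tri_hopf hR.
Let mb := env_mul hL.
Let mA := env_mulA hL.
Let m1l := env_mul1l hL.
Let m1r := env_mul1r hL.
Let el := env_linear hL.
Let ab : bilin act := module_bilin am.
Let aa k l x : act k (act l x) = act (k * l) x. Proof. by rewrite (act_mul am). Qed.
Let a1 x : act 1 x = x. Proof. exact: act_one am x. Qed.
Local Notation R := (Rmat H).
Local Notation Δ := (comul H).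
Local Notation bop := (bop H act mul).
Local Notation bm := (braided_mul H act mul).
Local Notation "x · y" := (mul x y) (at level 40, left associativity).

Lemma env_act_gen k u x :
  act k (e u · x) = \tsum_(k1, k2 <- Δ k) e (lact d k1 u) · act k2 x.
Proof. by rewrite aM; apply: eq_tsum => k1 k2; rewrite act_e. Qed.

Lemma env_bracket u v : e u · e v = bop (e u) (e v) + e (lbr d u v).
Proof.
rewrite (env_relation hL); congr (_ + _).
by apply: eq_tsum => r1 r2; rewrite !act_e.
Qed.

(** Let every generator act on the scalars by zero. *)
Lemma env_counit : exists ce : L -> C,
  [/\ scalar ce, forall x y, ce (x · y) = ce x * ce y, ce one = 1,
      forall u, ce (e u) = 0 & forall k x, ce (act k x) = counit H k * ce x].
Proof.
have [] := env_rep hL (σ := idfun) (B := C^o) (f := fun u b => 0).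
- by move=> u c x y; rewrite scaler0 addr0.
- by move=> c u v b; rewrite scaler0 addr0.
- by move=> u v b; rewrite addr0 /tsum big1.
move=> ρ [hρ ρe]; pose ce x : C := ρ x 1.
have ρE x b : ρ x b = b * ce x.
  by rewrite -[b in LHS]mulr1; exact: (linZ (rep_linear hρ x)).
have sc : scalar ce by move=> c x y; rewrite /ce (rep_semilinear hρ).
have scl : linear (ce : L -> C^o) := sc.
have cM x y : ce (x · y) = ce x * ce y by rewrite /ce (repM hρ) [LHS]ρE mulrC.
have c1 : ce one = 1 by rewrite /ce (rep1 hρ).
have c0 u : ce (e u) = 0 by rewrite /ce ρe.
exists ce; split=> // k; apply: (env_induction hL) => [|c x y IHx IHy|u x IH].
- by rewrite act1 (linZ scl) c1.
- rewrite (act_linear am) !sc IHx IHy mulrDr; congr (_ + _).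
  by rewrite !mulrA [c * _]mulrC.
rewrite env_act_gen (lin_sum _ _ scl) cM c0 mul0r mulr0.
by rewrite /tsum big1 // => p _; rewrite cM c0 mul0r.
Qed.

Section Star.
Variable s : K -> K.
Hypotheses (hs : conj_structure H s) (sa : antilinear (lstar d)).
Hypotheses (sK : involutive (lstar d)).
Hypothesis s_br : forall u v, lstar d (lbr d u v) = lbr d (lstar d v) (lstar d u).
Hypothesis s_act : forall k u, lstar d (lact d k u) = lact d (s k) (lstar d u).

(** [u] acts by right multiplication by its conjugate [lstar d u]. The defining relation is
    respected since [s] on both legs of [R] gives its flip. *)
Lemma env_star : exists bs : L -> L,
  [/\ star_structure mul bs, forall u, bs (e u) = e (lstar d u)
    & forall k x, bs (act k x) = act (s k) (bs x)].
Proof.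
have [] := env_rep hL (σ := Num.conj) (B := L) (f := fun u b => b · e (lstar d u)).
- by move=> u; lin.
- by move=> c u v b; rewrite sa el (proj2 mb).
- move=> u v b; rewrite -mA env_bracket s_br (linD (proj2 mb _)); congr (_ + _).
  rewrite /bop (lin_sum _ _ (proj2 mb _)).
  rewrite -(conj_RmatE hs (f := fun p q => b · (act p (e (lstar d u)) · act q (e (lstar d v))))); last by lin.
  by apply: eq_tsum => r1 r2; rewrite !act_e !s_act mA.
move=> ρ [hρ ρe]; pose bs x := ρ x one.
have al : antilinear bs by move=> c x y; rewrite /bs (rep_semilinear hρ).
have ρE : forall x b, ρ x b = b · bs x.
  apply: (env_induction hL) => [b|c x y IHx IHy b|u x IH b].
  - by rewrite /bs !(rep1 hρ) m1r.
  - by rewrite al (rep_semilinear hρ) IHx IHy (proj2 mb).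
  by rewrite /bs !(repM hρ) !ρe (IH b) mA.
have sM x y : bs (x · y) = bs y · bs x by rewrite {1}/bs (repM hρ) ρE.
have se u : bs (e u) = e (lstar d u) by rewrite /bs ρe m1l.
have s1 : bs one = one by rewrite /bs (rep1 hρ).
exists bs; split=> //.
  split=> //; apply: (env_induction hL) => [|c x y IHx IHy|u x IH].
  - by rewrite !s1.
  - by rewrite !al conjCK IHx IHy.
  by rewrite !sM !se sK IH.
move=> k x; move: x k; apply: (env_induction hL) => [k|c x y IHx IHy k|u x IH k].
- by rewrite s1 !act1 (antilinZ al) s1 (conj_counit hs).
- by rewrite (act_linear am) !al IHx IHy (act_linear am).
rewrite env_act_gen (antilin_sum _ _ al) sM aM.
rewrite (conj_comulE hs (f := fun p q => act p (bs x) · act q (bs (e u)))); last by lin.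
by apply: eq_tsum => k1 k2; rewrite sM IH !se act_e s_act.
Qed.

End Star.

(** [u] acts by [b ↦ - bop u b], which encodes [S(u) = -u] and braided antimultiplicativity. As
    [bop] is associative, the defining relation amounts to [bop u v = u v - [u, v]] with [u v]
    written through [bop_flip]. *)
Lemma env_antipode : exists S : L -> L,
  [/\ linear S, S one = one, forall u x, S (e u · x) = - bop (e u) (S x)
    & forall k x, S (act k x) = act k (S x)].
Proof.
have bb : bilin bop by apply: bop_bilin.
have [] := env_rep hL (σ := idfun) (B := L) (f := fun u b => - bop (e u) b).
- by move=> u; lin.
- by move=> c u v b; rewrite el (proj1 bb) opprD scalerN.
- move=> u v b.
  rewrite (linN (proj2 bb _)) opprK (bop_assoc hR am mb mA aM).
  have -> : bop (e u) (e v) = e u · e v - e (lbr d u v) by rewrite env_bracket addrK.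
  rewrite (linB (proj1 bb _)) -(bop_flip hR am mb) (lin_sum _ _ (proj1 bb _)).
  congr (_ - _); apply: eq_tsum => r1 r2.
  by rewrite !act_e (linN (proj2 bb _)) opprK (bop_assoc hR am mb mA aM).
move=> ρ [hρ ρe]; pose S x := ρ x one.
have Sl : linear S by move=> c x y; rewrite /S (rep_semilinear hρ).
have S1 : S one = one by rewrite /S (rep1 hρ).
have Se u x : S (e u · x) = - bop (e u) (S x) by rewrite /S (repM hρ) ρe.
exists S; split=> // k x; move: x k.
apply: (env_induction hL) => [k|c x y IHx IHy k|u x IH k].
- by rewrite act1 (linZ Sl) S1 act1.
- by rewrite (act_linear am) !Sl IHx IHy (act_linear am).
rewrite env_act_gen (lin_sum _ _ Sl) Se (linN (act_linear am k)) (bop_act hR am mb aM).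
by rewrite -tsum_opp; apply: eq_tsum => k1 k2; rewrite Se IH act_e.
Qed.

Lemma primitive_linear : linear (fun u => e u ⊗ one + one ⊗ e u).
Proof. by lin. Qed.

Lemma braided_mul_primitive u x y :
  bm (e u ⊗ one + one ⊗ e u) (x ⊗ y)
  = (e u · x) ⊗ y + \tsum_(r1, r2 <- R) act r2 x ⊗ (e (lact d r1 u) · y).
Proof.
rewrite (linD (proj1 (braided_mul_bilin _ am mb) _)).
rewrite (braided_mulE H am mb) (braided_mulE H am mb); congr (_ + _).
  transitivity (\tsum_(r1, r2 <- R) counit H r1 *: ((e u · act r2 x) ⊗ y)).
    by apply: eq_tsum => r1 r2; rewrite act1 (linZ (proj1 mb _)) m1l tpureZr.
  by rewrite (Rmat_counitl hR (f := fun r => (e u · act r x) ⊗ y)) ?a1 //; lin.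
by apply: eq_tsum => r1 r2; rewrite m1l act_e.
Qed.

(** The mixed terms, [u ⊗ v] and its image under the braiding, are exchanged by the braiding, an
    involution, and so match on both sides. What is left is the relation of [U(g)] in each leg. *)
Lemma primitive_relation u v :
  bm (e u ⊗ one + one ⊗ e u) (e v ⊗ one + one ⊗ e v)
  = \tsum_(r1, r2 <- R) bm (e (lact d r2 v) ⊗ one + one ⊗ e (lact d r2 v))
        (e (lact d r1 u) ⊗ one + one ⊗ e (lact d r1 u))
    + (e (lbr d u v) ⊗ one + one ⊗ e (lbr d u v)).
Proof.
have E p q : bm (e p ⊗ one + one ⊗ e p) (e q ⊗ one + one ⊗ e q)
    = (e p · e q) ⊗ one + e p ⊗ e q
      + (\tsum_(r1, r2 <- R) act r2 (e q) ⊗ act r1 (e p) + one ⊗ (e p · e q)).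
  rewrite (linD (proj2 (braided_mul_bilin _ am mb) _)) !braided_mul_primitive.
  apply: addrACA_eq; first by [].
  - by apply: eq_tsum => r1 r2; rewrite m1r !act_e.
  - by rewrite m1r.
  transitivity (\tsum_(r1, r2 <- R) counit H r2 *: (one ⊗ (act r1 (e p) · e q))).
    by apply: eq_tsum => r1 r2; rewrite act1 tpureZl !act_e.
  by rewrite (Rmat_counitr hR (f := fun r => one ⊗ (act r (e p) · e q))) ?a1 //; lin.
rewrite E env_bracket tpureDl tpureDr.
have -> : \tsum_(r1, r2 <- R) bm (e (lact d r2 v) ⊗ one + one ⊗ e (lact d r2 v))
        (e (lact d r1 u) ⊗ one + one ⊗ e (lact d r1 u))
   = bop (e u) (e v) ⊗ one + \tsum_(r1, r2 <- R) act r2 (e v) ⊗ act r1 (e u)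
     + (e u ⊗ e v + one ⊗ bop (e u) (e v)).
  rewrite (lin_sum (h := fun z => z ⊗ one)); last by lin.
  rewrite (lin_sum (h := fun z => one ⊗ z)); last by lin.
  have -> : e u ⊗ e v = \tsum_(r1, r2 <- R) \tsum_(s1, s2 <- R)
      act s2 (act r1 (e u)) ⊗ act s1 (act r2 (e v)).
    rewrite -{1}[e u]a1 -{1}[e v]a1.
    rewrite -(Rmat_Vmul hR (f := fun x y => act x (e u) ⊗ act y (e v))); last by lin.
    by rewrite exchange_tsum; do 2!(apply: eq_tsum => ? ?); rewrite !aa.
  rewrite -!tsum_addf; apply: eq_tsum => r1 r2.
  by rewrite E !act_e.
exact: addr_pairs.
Qed.

(** [u] acts on the braided square by left multiplication by its primitive element. *)
Lemma env_comul : exists D : L -> L ⊗ L,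
  [/\ linear D, D one = one ⊗ one, forall u, D (e u) = e u ⊗ one + one ⊗ e u,
      forall x y, D (x · y) = bm (D x) (D y)
    & forall k x, D (act k x) = tensor_act H act k (D x)].
Proof.
have bb : bilin bm by exact: braided_mul_bilin.
have bA : associative bm by exact: braided_mulA.
have b1l s : bm (one ⊗ one) s = s by exact: braided_mul1l.
have b1r s : bm s (one ⊗ one) = s by exact: braided_mul1r.
have tb : bilin (tensor_act H act) by exact: tensor_act_bilin.
have tM : act_multiplicative H (tensor_act H act) bm by exact: tensor_act_mul.
have pl := primitive_linear.
have [] := env_rep hL (σ := idfun) (B := (L ⊗ L)%type)
  (f := fun u t => bm (e u ⊗ one + one ⊗ e u) t).
- by move=> u; lin.
- by move=> c u v b; rewrite pl (proj1 bb).
- move=> u v b; apply: etrans (bA _ _ _) _.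
  apply: etrans (congr1 (fun z => bm z b) (primitive_relation u v)) _.
  apply: etrans (linD (proj1 bb b) _ _) _; congr (_ + _).
  by rewrite (lin_sum _ _ (proj1 bb _)); apply: eq_tsum => r1 r2; rewrite bA.
move=> ρ [hρ ρe]; pose D x := ρ x (one ⊗ one).
have Dl : linear D by move=> c x y; rewrite /D (rep_semilinear hρ).
have D1 : D one = one ⊗ one by rewrite /D (rep1 hρ).
have De u : D (e u) = e u ⊗ one + one ⊗ e u by rewrite /D ρe b1r.
have ρE : forall x t, ρ x t = bm (D x) t.
  apply: (env_induction hL) => [t|c x y IHx IHy t|u x IH t].
  - by rewrite (rep1 hρ) D1 b1l.
  - by rewrite (rep_semilinear hρ) Dl (proj1 bb) IHx IHy.
  by rewrite /D !(repM hρ) !ρe (IH t) bA.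
have DM x y : D (x · y) = bm (D x) (D y) by rewrite {1}/D (repM hρ) ρE.
exists D; split=> // k x; move: x k.
apply: (env_induction hL) => [k|c x y IHx IHy k|u x IH k].
- rewrite act1 (linZ Dl) D1 tensor_actE // -tpureZr -act1.
  rewrite -(counitlE hH (f := fun k => one ⊗ act k one)); last by lin.
  by apply: eq_tsum => k1 k2; rewrite (act1 k1) tpureZl.
- by rewrite (act_linear am) !Dl IHx IHy (proj2 tb).
rewrite env_act_gen (lin_sum _ _ Dl) DM tM; apply: eq_tsum => k1 k2.
rewrite DM IH; congr (bm _ _).
rewrite !De (linD (proj2 tb _)) !tensor_actE // -!act_e; congr (_ + _).
  rewrite -(counitrE hH (f := fun k => act k (e u) ⊗ one)); last by lin.
  by apply: eq_tsum => a b; rewrite act1 tpureZr.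
rewrite -(counitlE hH (f := fun k => one ⊗ act k (e u))); last by lin.
by apply: eq_tsum => a b; rewrite act1 tpureZl.
Qed.

End EnvMaps.

Lemma map_leftE (C : numClosedFieldType) (V W : lmodType C) (f : V -> V ⊗ V)
    (t : V ⊗ W) :
  map_left f t = \tsum_(x, y <- t) \tsum_(a, b <- f x) (a ⊗ b) ⊗ y.
Proof.
apply: eq_tsum => x y; rewrite -[f x in LHS]tsum_tpure.
by rewrite (lin_sum (h := fun z => z ⊗ y)) //; lin.
Qed.

(** * The braided Hopf *-algebra axioms of U(g) *)

Section EnvHopf.
Variables (C : numClosedFieldType) (K : algType C) (H : hopf_data K).
Variables (g : lmodType C) (d : blie_data K g) (L : lmodType C).
Variables (mul : L -> L -> L) (one : L) (e : g -> L) (act : K -> L -> L).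
Hypotheses (hR : triangular_Rmat H).
Hypothesis hL : enveloping (Rmat H) (lact d) (lbr d) mul one e.
Hypotheses (am : is_module act) (act1 : forall k, act k one = counit H k *: one).
Hypotheses (aM : act_multiplicative H act mul).
Hypothesis act_e : forall k u, act k (e u) = e (lact d k u).
Local Notation bop := (bop H act mul).
Local Notation bm := (braided_mul H act mul).
Local Notation "x · y" := (mul x y) (at level 40, left associativity).

Variable D : L -> L ⊗ L.
Hypotheses (Dl : linear D) (D1 : D one = one ⊗ one).
Hypothesis De : forall u, D (e u) = e u ⊗ one + one ⊗ e u.
Hypothesis DM : forall x y, D (x · y) = bm (D x) (D y).
Hypothesis Dact : forall k x, D (act k x) = tensor_act H act k (D x).
Variables (ce : L -> C) (S : L -> L).
Hypotheses (cel : scalar ce) (ceM : forall x y, ce (x · y) = ce x * ce y).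
Hypotheses (ce1 : ce one = 1) (cee : forall u, ce (e u) = 0).
Hypothesis ceact : forall k x, ce (act k x) = counit H k * ce x.
Hypotheses (Sl : linear S) (S1 : S one = one).
Hypothesis Se : forall u x, S (e u · x) = - bop (e u) (S x).
Hypothesis Sact : forall k x, S (act k x) = act k (S x).

Let hH := tri_hopf hR.
Let mb := env_mul hL.
Let mA := env_mulA hL.
Let m1l := env_mul1l hL.
Let m1r := env_mul1r hL.
Let el := env_linear hL.
Let ab : bilin act := module_bilin am.
Let aa k l x : act k (act l x) = act (k * l) x. Proof. by rewrite (act_mul am). Qed.
Let a1 x : act 1 x = x. Proof. exact: act_one am x. Qed.
Local Notation R := (Rmat H).
Local Notation Δ := (comul H).

(** The recursion for the coproduct of [u x] in terms of that of [x], along which the axioms below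
    are verified. *)
Lemma comul_genE (U : lmodType C) (f : L -> L -> U) u x : bilin f ->
  \tsum_(a, b <- D (e u · x)) f a b
  = \tsum_(a, b <- D x) (f (e u · a) b
      + \tsum_(r1, r2 <- R) f (act r2 a) (e (lact d r1 u) · b)).
Proof.
move=> fb; have bb := braided_mul_bilin H am mb.
rewrite DM De -{1}[D x]tsum_tpure (lin_sum _ _ (proj2 bb _)) (tsum_tsum _ _ fb).
apply: eq_tsum => a b; rewrite (braided_mul_primitive hR hL am act1 act_e).
rewrite (linD (bilin_linear fb)) tsumE // (lin_sum _ _ (bilin_linear fb)).
by congr (_ + _); apply: eq_tsum => r1 r2; rewrite tsumE.
Qed.

Lemma comul_actE (U : lmodType C) (f : L -> L -> U) k x : bilin f ->
  \tsum_(a, b <- D (act k x)) f a b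
  = \tsum_(a, b <- D x) \tsum_(k1, k2 <- Δ k) f (act k1 a) (act k2 b).
Proof.
move=> fb; rewrite Dact /tensor_act (tsum_tsum _ _ fb) exchange_tsum.
by apply: eq_tsum => k1 k2; rewrite tsum_tmap.
Qed.

Lemma comul_oneE (U : lmodType C) (f : L -> L -> U) : bilin f ->
  \tsum_(a, b <- D one) f a b = f one one.
Proof. by move=> fb; rewrite D1 tsumE. Qed.

Lemma env_coassocE (U : lmodType C) (f : L -> L -> L -> U) x : trilin f ->
  \tsum_(x1, x2 <- D x) \tsum_(a, b <- D x1) f a b x2
  = \tsum_(x1, x2 <- D x) \tsum_(a, b <- D x2) f x1 a b.
Proof.
(* [f] is generalised because the induction hypothesis is applied to three functions built from it,
   one for each leg that [u] can enter. For the last leg the hexagon for [id ⊗ Δ] splits the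
   braiding. *)
move: x U f; apply: (env_induction hL) => [U f ft|c x y IHx IHy U f ft|u x IH U f ft].
- rewrite comul_oneE; last by lin.
  by rewrite comul_oneE ?comul_oneE //; lin.
- have b1 : bilin (fun x1 x2 => \tsum_(a, b <- D x1) f a b x2) by lin.
  have b2 : bilin (fun x1 x2 => \tsum_(a, b <- D x2) f x1 a b) by lin.
  by rewrite Dl (bilin_linear b1) (bilin_linear b2) IHx // IHy.
rewrite comul_genE; last by lin.
rewrite comul_genE; last by lin.
rewrite !tsum_addf.
have -> : \tsum_(p, q <- D x) \tsum_(a, b <- D (e u · p)) f a b q
  = \tsum_(p, q <- D x) \tsum_(a, b <- D p) f (e u · a) b q
    + \tsum_(p, q <- D x) \tsum_(a, b <- D p) \tsum_(r1, r2 <- R)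
        f (act r2 a) (e (lact d r1 u) · b) q.
  rewrite -tsum_addf; apply: eq_tsum => p q.
  by rewrite comul_genE ?tsum_addf //; lin.
rewrite (IH _ (fun a b q => f (e u · a) b q)); last by lin.
rewrite -addrA; congr (_ + _).
rewrite (IH _ (fun a b q => \tsum_(r1, r2 <- R)
  f (act r2 a) (e (lact d r1 u) · b) q)); last by lin.
have -> : \tsum_(p, q <- D x) \tsum_(r1, r2 <- R) \tsum_(a, b <- D (act r2 p))
    f a b (e (lact d r1 u) · q)
  = \tsum_(p, q <- D x) \tsum_(a, b <- D p) \tsum_(r1, r2 <- R) \tsum_(s1, s2 <- R)
      f (act s2 a) (act r2 b) (e (lact d (r1 * s1) u) · q).
  apply: eq_tsum => p q.
  transitivity (\tsum_(r1, r2 <- R) \tsum_(a, b <- D p) \tsum_(k1, k2 <- Δ r2)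
      f (act k1 a) (act k2 b) (e (lact d r1 u) · q)).
    by apply: eq_tsum => r1 r2; rewrite comul_actE //; lin.
  rewrite exchange_tsum; apply: eq_tsum => a b.
  transitivity (\tsum_(r1, r2 <- R) \tsum_(k1, k2 <- Δ r2)
      f (act k1 a) (act k2 b) (act r1 (e u) · q)).
    by apply: eq_tsum => r1 r2; rewrite act_e.
  rewrite (Rmat_hexrE hR (f := fun r k l => f (act k a) (act l b) (act r (e u) · q))); last by lin.
  by do 2!(apply: eq_tsum => ? ?); rewrite act_e.
have -> : \tsum_(p, q <- D x) \tsum_(a, b <- D p) \tsum_(r1, r2 <- R) \tsum_(s1, s2 <- R)
      f (act s2 a) (act r2 b) (e (lact d (r1 * s1) u) · q)
  = \tsum_(p, q <- D x) \tsum_(a, b <- D p) \tsum_(r1, r2 <- R) \tsum_(s1, s2 <- R)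
      f (act s2 a) (act r2 b) (act (r1 * s1) (e u) · q).
  by do 4!(apply: eq_tsum => ? ?); rewrite act_e.
rewrite (IH _ (fun a b q => \tsum_(r1, r2 <- R) \tsum_(s1, s2 <- R)
   f (act s2 a) (act r2 b) (act (r1 * s1) (e u) · q))); last by lin.
rewrite -tsum_addf; apply: eq_tsum => p q; rewrite -tsum_addf.
transitivity (\tsum_(r1, r2 <- R) \tsum_(a, b <- D q)
  (f (act r2 p) (e (lact d r1 u) · a) b
   + \tsum_(t1, t2 <- R) f (act r2 p) (act t2 a) (e (lact d t1 (lact d r1 u)) · b))); last first.
  by apply: eq_tsum => r1 r2; rewrite comul_genE //; lin.
rewrite [RHS]exchange_tsum; apply: eq_tsum => a b; rewrite tsum_addf; congr (_ + _).
rewrite exchange_tsum; do 2!(apply: eq_tsum => ? ?).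
by rewrite -!act_e aa.
Qed.

Lemma env_coassoc x : map_left D (D x) = map_right D (D x).
Proof.
rewrite map_leftE (env_coassocE (f := fun a b c => (a ⊗ b) ⊗ c)) //; lin.
Qed.

Lemma env_counitl x : \tsum_(a, b <- D x) ce a *: b = x.
Proof.
have fb : bilin (fun a b : L => ce a *: b).
  by split=> [w|v]; [apply: lin_scalar | lin].
move: x; apply: (env_induction hL) => [|c x y IHx IHy|u x IH].
- by rewrite comul_oneE // ce1 scale1r.
- by rewrite Dl (bilin_linear fb) IHx IHy.
rewrite comul_genE //.
transitivity (\tsum_(a, b <- D x) e u · (ce a *: b)); last first.
  by rewrite -(lin_sum _ _ (proj2 mb _)) IH.
apply: eq_tsum => a b; rewrite ceM cee mul0r scale0r add0r.
transitivity (\tsum_(r1, r2 <- R) counit H r2 *: (e (lact d r1 u) · (ce a *: b))).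
  by apply: eq_tsum => r1 r2; rewrite ceact -scalerA (linZ (proj2 mb _)).
transitivity (\tsum_(r1, r2 <- R) counit H r2 *: (act r1 (e u) · (ce a *: b))).
  by apply: eq_tsum => r1 r2; rewrite act_e.
by rewrite (Rmat_counitr hR (f := fun r => act r (e u) · (ce a *: b))) ?a1 //; lin.
Qed.

Lemma env_counitr x : \tsum_(a, b <- D x) ce b *: a = x.
Proof.
have fb : bilin (fun a b : L => ce b *: a).
  by split=> [w|v]; [lin | apply: lin_scalar].
move: x; apply: (env_induction hL) => [|c x y IHx IHy|u x IH].
- by rewrite comul_oneE // ce1 scale1r.
- by rewrite Dl (bilin_linear fb) IHx IHy.
rewrite comul_genE // -[in RHS]IH (lin_sum _ _ (proj2 mb _)).
apply: eq_tsum => a b; rewrite (linZ (proj2 mb _)) /tsum big1 ?addr0 //.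
by move=> p _; rewrite ceM cee mul0r scale0r.
Qed.

(** The two terms of [comul_genE] cancel for each pair [a], [b]: [S(u a) b] is minus the braided
    term, by the recursion for [S]. *)
Lemma env_antipodel x : \tsum_(a, b <- D x) S a · b = ce x *: one.
Proof.
have fb : bilin (fun a b => S a · b) by lin.
move: x; apply: (env_induction hL) => [|c x y IHx IHy|u x _].
- by rewrite comul_oneE // S1 m1l ce1 scale1r.
- by rewrite Dl (bilin_linear fb) IHx IHy cel scalerDl scalerA.
rewrite comul_genE // ceM cee mul0r scale0r.
transitivity (\tsum_(a, b <- D x) (0 : L)); last by rewrite /tsum big1.
apply: eq_tsum => a b; rewrite Se (linN (proj1 mb _)) /bop (lin_sum _ _ (proj1 mb _)) addrC.
apply/eqP; rewrite subr_eq0; apply/eqP; apply: eq_tsum => r1 r2.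
by rewrite Sact mA act_e.
Qed.

(** Unlike on the other side, the cancellation occurs only after summation. The induction hypothesis
    turns the first term into [ε(x) u] and, through [bop_mulr], the braided one into its
    negative. *)
Lemma env_antipoder x : \tsum_(a, b <- D x) a · S b = ce x *: one.
Proof.
have fb : bilin (fun a b => a · S b) by lin.
have bb : bilin bop by exact: bop_bilin.
move: x; apply: (env_induction hL) => [|c x y IHx IHy|u x IH].
- by rewrite comul_oneE // S1 m1r ce1 scale1r.
- by rewrite Dl (bilin_linear fb) IHx IHy cel scalerDl scalerA.
rewrite comul_genE // ceM cee mul0r scale0r tsum_addf.
have -> : \tsum_(a, b <- D x) (e u · a) · S b = ce x *: e u.
  transitivity (e u · \tsum_(a, b <- D x) a · S b).
    by rewrite (lin_sum _ _ (proj2 mb _)); apply: eq_tsum => a b; rewrite mA.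
  by rewrite IH (linZ (proj2 mb _)) m1r.
suff -> : \tsum_(a, b <- D x) \tsum_(r1, r2 <- R) act r2 a · S (e (lact d r1 u) · b)
    = - (ce x *: e u) by rewrite subrr.
rewrite exchange_tsum.
transitivity (- bop (e u) (\tsum_(a, b <- D x) a · S b)); last first.
  rewrite IH (linZ (proj2 bb _)); congr (- (_ *: _)).
  transitivity (\tsum_(r1, r2 <- R) counit H r2 *: act r1 (e u)).
    by apply: eq_tsum => r1 r2; rewrite act1 (linZ (proj1 mb _)) m1l.
  by rewrite (Rmat_counitr hR (f := fun r => act r (e u))) ?a1 //; lin.
rewrite (lin_sum _ _ (proj2 bb _)) -tsum_opp exchange_tsum; apply: eq_tsum => a b.
rewrite (bop_mulr hR am mb mA aM) -tsum_opp; apply: eq_tsum => r1 r2.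
by rewrite Se (linN (proj2 mb _)) act_e.
Qed.

Section Star.
Variables (s : K -> K) (bs : L -> L).
Hypotheses (hs : conj_structure H s) (sS : star_structure mul bs).
Hypothesis (s_e : forall u, bs (e u) = e (lstar d u)).
Hypothesis s_act : forall k x, bs (act k x) = act (s k) (bs x).

(** By [tensor_star_mul] both sides reverse products, so generators suffice; there [ε] applied to
    one leg of [R] removes the braiding. *)
Lemma env_comul_star x : D (bs x) = tensor_star H act bs (D x).
Proof.
have sa := star_antilinear sS; have sM := star_mul sS.
have s1 : bs one = one.
  by rewrite -[LHS]m1r -[X in _ · X](star_involutive sS) -sM m1r (star_involutive sS).
move: x; apply: (env_induction hL) => [|c x y IHx IHy|u x IH].
- rewrite s1 D1 (tensor_starE H am sa) s1.
  transitivity (\tsum_(r1, r2 <- R) counit H r1 *: (act r2 one ⊗ one)).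
    rewrite (Rmat_counitl hR (f := fun r => act r one ⊗ one)) ?a1 //; lin.
  by apply: eq_tsum => r1 r2; rewrite (act1 r1) tpureZr.
- by rewrite sa !Dl IHx IHy (tensor_star_antilinear H am sa).
rewrite sM !DM IH (tensor_star_mul hR am mb aM hs sa sM s_act) // s_e; congr (bm _ _).
rewrite !De (antilinD (tensor_star_antilinear H am sa)) !(tensor_starE H am sa) s1 s_e.
congr (_ + _).
  transitivity (\tsum_(r1, r2 <- R) counit H r1 *: (act r2 (e (lstar d u)) ⊗ one)).
    by rewrite (Rmat_counitl hR (f := fun r => act r (e (lstar d u)) ⊗ one)) ?a1 //; lin.
  by apply: eq_tsum => r1 r2; rewrite (act1 r1) tpureZr.
transitivity (\tsum_(r1, r2 <- R) counit H r2 *: (one ⊗ act r1 (e (lstar d u)))).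
  by rewrite (Rmat_counitr hR (f := fun r => one ⊗ act r (e (lstar d u)))) ?a1 //; lin.
by apply: eq_tsum => r1 r2; rewrite (act1 r2) tpureZl.
Qed.

End Star.

End EnvHopf.

(** * Existence and functoriality of the structure on U(g) *)

Section BraidedHopfEnv.
Variables (C : numClosedFieldType) (K : algType C) (H : hopf_data K).
Variables (g : lmodType C) (d : blie_data K g) (L : algType C) (e : g -> L).
Hypothesis hd : braided_lie_star_algebra H d.
Hypothesis hL : enveloping (Rmat H) (lact d) (lbr d) *%R 1 e.

(** The values of counit and antipode on generators are recorded as well, so that an isomorphism can
    be compared with them by induction. *)
Record env_structure (b : bhopf_data K L) : Prop := {
  env_structure_bhopf : braided_hopf_star_algebra H b;
  env_structure_act : forall k u, bact b k (e u) = e (lact d k u);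
  env_structure_comul : forall u, bcomul b (e u) = e u ⊗ 1 + 1 ⊗ e u;
  env_structure_star : forall u, bstar b (e u) = e (lstar d u);
  env_structure_counit : forall u, bcounit b (e u) = 0;
  env_structure_antipode1 : bantipode b 1 = 1;
  env_structure_antipode : forall u x,
    bantipode b (e u * x) = - bop H (bact b) *%R (e u) (bantipode b x)
}.

Lemma env_structure_exists : exists b, env_structure b.
Proof.
have hT := blie_hopf hd.
have hR := triangular_star_Rmat hT.
have hs := hconj_structure hT.
have mb := env_mul hL; have mA := env_mulA hL.
have gm := blie_module hd.
have [act [am act1 aM ae]] := env_action hR hL gm (blie_equivariant hd).
have [ce [cel ceM ce1 cee ceact]] := env_counit hL am act1 aM ae.
have sact k u : lstar d (lact d k u) = lact d (hconj H k) (lstar d u).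
  by rewrite (blie_star_compat hd) (antipodeV_star hT).
have [bs [sS s_e s_act]] := env_star hL am act1 aM ae hs
  (blie_star_antilinear hd) (blie_star_involutive hd) (blie_star_br hd) sact.
have [S [Sl S1 Se Sact]] := env_antipode hR hL am act1 aM ae.
have [D [Dl D1 De DM Dact]] := env_comul hR hL am act1 aM ae.
exists {| bact := act; bcomul := D; bcounit := ce; bantipode := S; bstar := bs |}.
split; [split | exact: ae | exact: De | exact: s_e | exact: cee | exact: S1 | exact: Se].
- exact: hT.
- split.
  + exact: (proj1 mb).
  + exact: (proj2 mb).
  + exact: mA.
  + exact: env_mul1l hL.
  + exact: env_mul1r hL.
  + exact: am.
  + exact: aM.
  + exact: act1.
  + exact: sS.
  move=> k x; rewrite (antipodeV_star hT); exact: s_act.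
- exact: Dl.
- exact: DM.
- exact: D1.
- exact: Dact.
- exact: cel.
- exact: ceM.
- exact: ce1.
- exact: ceact.
- exact: (env_coassoc hR hL am act1 ae Dl D1 De DM Dact).
- exact: (env_counitl hR hL am act1 ae Dl D1 De DM cel ceM ce1 cee ceact).
- exact: (env_counitr hR hL am act1 ae Dl D1 De DM cel ceM ce1 cee).
- exact: Sl.
- move=> k x; exact: Sact.
- exact: (env_antipodel hR hL am act1 ae Dl D1 De DM cel ceM ce1 cee Sl S1 Se Sact).
- exact: (env_antipoder hR hL am act1 aM ae Dl D1 De DM cel ceM ce1 cee Sl S1 Se).
exact: (env_comul_star hR hL am act1 aM Dl D1 De DM hs sS s_e s_act).
Qed.

End BraidedHopfEnv.

Section EnvLift.
Variables (C : numClosedFieldType) (K : algType C) (H : hopf_data K).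
Variables (g g' : lmodType C) (d : blie_data K g) (d' : blie_data K g').

(** [u] acts on [L'] by left multiplication by [e' (f u)]. *)
Lemma env_lift (L L' : lmodType C) (mul : L -> L -> L) (mul' : L' -> L' -> L')
    (one : L) (one' : L') (e : g -> L) (e' : g' -> L') (f : g -> g') :
  enveloping (Rmat H) (lact d) (lbr d) mul one e ->
  enveloping (Rmat H) (lact d') (lbr d') mul' one' e' ->
  linear f -> (forall k u, f (lact d k u) = lact d' k (f u)) ->
  (forall u v, f (lbr d u v) = lbr d' (f u) (f v)) ->
  exists h : L -> L',
    [/\ linear h, forall x y, h (mul x y) = mul' (h x) (h y), h one = one'
      & forall u, h (e u) = e' (f u)].
Proof.
move=> hL hL' fl fact fbr; have mb := env_mul hL'; have el := env_linear hL'.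
have [] := env_rep hL (σ := idfun) (B := L') (f := fun u b => mul' (e' (f u)) b).
- by move=> u; lin.
- by move=> c u v b; rewrite fl el (proj1 mb).
- move=> u v b; rewrite (env_mulA hL') (env_relation hL') (linD (proj1 mb _)) fbr.
  congr (_ + _); rewrite (lin_sum _ _ (proj1 mb _)); apply: eq_tsum => r1 r2.
  by rewrite !fact (env_mulA hL').
move=> ρ [hρ ρe]; pose h x := ρ x one'.
have hl : linear h by move=> c x y; rewrite /h (rep_semilinear hρ).
have ρE : forall x b, ρ x b = mul' (h x) b.
  apply: (env_induction hL) => [b|c x y IHx IHy b|u x IH b].
  - by rewrite /h !(rep1 hρ) (env_mul1l hL').
  - by rewrite hl (rep_semilinear hρ) IHx IHy (proj1 mb).
  by rewrite /h !(repM hρ) !ρe (IH b) (env_mulA hL').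
exists h; split=> // [x y||u]; rewrite /h.
- by rewrite (repM hρ) ρE.
- by rewrite (rep1 hρ).
by rewrite ρe (env_mul1r hL').
Qed.

End EnvLift.

Section EnvIso.
Variables (C : numClosedFieldType) (K : algType C) (H : hopf_data K).
Variables (g g' : lmodType C) (d : blie_data K g) (d' : blie_data K g').
Variable f : g -> g'.
Hypothesis fiso : braided_lie_star_iso H d d' f.
Variables (L L' : algType C) (e : g -> L) (e' : g' -> L').
Hypothesis hL : enveloping (Rmat H) (lact d) (lbr d) *%R 1 e.
Hypothesis hL' : enveloping (Rmat H) (lact d') (lbr d') *%R 1 e'.

(** The inverse of [f] is again a morphism and lifts; the composites of the two lifts fix the
    generators. The action is compared first, being part of the braided product and of the recursion
    for the antipode. *)
Lemma env_iso b b' : env_structure H d e b -> env_structure H d' e' b' ->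
  exists h : L -> L', braided_hopf_star_iso H b b' h /\ forall u, h (e u) = e' (f u).
Proof.
move=> hb hb'.
have [bh ae De se ce0 S1 Se] := hb; have [bh' ae' De' se' ce0' S1' Se'] := hb'.
have fl := bliso_linear fiso.
have fact := bliso_act fiso; have fbr := bliso_br fiso; have fstar := bliso_star fiso.
have [fi fK fiK] := bliso_bijective fiso.
have fil : linear fi by move=> c u v; apply: (can_inj fK); rewrite fl !fiK.
have fiact k u : fi (lact d' k u) = lact d k (fi u).
  by apply: (can_inj fK); rewrite fact !fiK.
have fibr u v : fi (lbr d' u v) = lbr d (fi u) (fi v).
  by apply: (can_inj fK); rewrite fbr !fiK.
have [h [hl hM h1 he]] := env_lift hL hL' fl fact fbr.
have [hi [hil hiM hi1 hie]] := env_lift hL' hL fil fiact fibr.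
have hK : cancel h hi.
  apply: (env_induction hL) => [|c x y IHx IHy|u x IH]; first by rewrite h1 hi1.
    by rewrite hl hil IHx IHy.
  by rewrite hM hiM he hie fK IH.
have hiK : cancel hi h.
  apply: (env_induction hL') => [|c x y IHx IHy|u x IH]; first by rewrite hi1 h1.
    by rewrite hil hl IHx IHy.
  by rewrite hiM hM hie he fiK IH.
have hA := bhopf_module_algebra bh; have hA' := bhopf_module_algebra bh'.
have am := msa_module hA; have am' := msa_module hA'.
have aM := msa_act_mul hA; have aM' := msa_act_mul hA'.
have hR := triangular_star_Rmat (bhopf_hopf bh).
have mb := env_mul hL; have mb' := env_mul hL'.
have ha k x : h (bact b k x) = bact b' k (h x).
  move: x k; apply: (env_induction hL) => [k|c x y IHx IHy k|u x IH k].
  - by rewrite (msa_act_one hA) (linZ hl) h1 (msa_act_one hA').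
  - by rewrite (act_linear am) !hl IHx IHy (act_linear am').
  rewrite hM he (env_act_gen aM ae) (env_act_gen aM' ae') (lin_sum _ _ hl).
  by apply: eq_tsum => k1 k2; rewrite hM he fact IH.
have sl := bcomul_linear bh; have sl' := bcomul_linear bh'.
exists h; split=> //; split.
- exact: bh.
- exact: bh'.
- exact: hl.
- exact: hM.
- exact: h1.
- by exists hi.
- exact: ha.
- have tl : linear (tmap h h : L ⊗ L -> L' ⊗ L') by rewrite /tmap; lin.
  have tE x y : tmap h h (x ⊗ y) = h x ⊗ h y by rewrite /tmap tsumE //; lin.
  have tM s t : tmap h h (bmul H b s t) = bmul H b' (tmap h h s) (tmap h h t).
    exact: (braided_mul_map H am am' mb mb' hl hM ha).
  apply: (env_induction hL) => [|c x y IHx IHy|u x IH].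
  + by rewrite h1 (bcomul_one bh) (bcomul_one bh') tE h1.
  + by rewrite hl sl' sl tl IHx IHy.
  rewrite hM (bcomul_mul bh') (bcomul_mul bh) tM IH he De De' (linD tl) !tE he h1.
  by [].
- apply: (env_induction hL) => [|c x y IHx IHy|u x IH].
  + by rewrite h1 (bcounit_one bh) (bcounit_one bh').
  + by rewrite hl (bcounit_linear bh') IHx IHy (bcounit_linear bh).
  by rewrite hM (bcounit_mul bh') (bcounit_mul bh) he ce0 ce0' !mul0r.
- have Sl := bantipode_linear bh; have Sl' := bantipode_linear bh'.
  apply: (env_induction hL) => [|c x y IHx IHy|u x IH].
  + by rewrite h1 S1 S1' h1.
  + by rewrite Sl !hl IHx IHy Sl'.
  rewrite Se hM he Se' (linN hl) -IH; congr (- _).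
  rewrite /bop (lin_sum _ _ hl); apply: eq_tsum => r1 r2.
  by rewrite hM !ha he.
have sS := msa_star hA; have sS' := msa_star hA'.
have sa := star_antilinear sS; have sa' := star_antilinear sS'.
have star1 (X : algType C) (t : X -> X) : star_structure *%R t -> t 1 = 1.
  by case=> _ tK tM; rewrite -[LHS]mulr1 -[X in _ * X]tK -tM mulr1 tK.
apply: (env_induction hL) => [|c x y IHx IHy|u x IH].
- by rewrite (star1 _ _ sS) h1 (star1 _ _ sS').
- by rewrite sa !hl IHx IHy sa'.
by rewrite (star_mul sS) !hM (star_mul sS') IH he se he se' fstar.
Qed.

End EnvIso.

Lemma uenv_iso (C : numClosedFieldType) (K : algType C) (H : hopf_data K)
    (g g' : lmodType C) (d : blie_data K g) (d' : blie_data K g') (f : g -> g') :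
  braided_lie_star_iso H d d' f ->
  exists (b : bhopf_data K (uenv H d)) (b' : bhopf_data K (uenv H d'))
         (h : uenv H d -> uenv H d'),
    [/\ uenv_structure b, uenv_structure b',
        forall u, h (ugen H d u) = ugen H d' (f u)
      & braided_hopf_star_iso H b b' h].
Proof.
move=> iso; have e := uenv_enveloping H d; have e' := uenv_enveloping H d'.
have [b sb] := env_structure_exists (bliso_source iso) e.
have [b' sb'] := env_structure_exists (bliso_target iso) e'.
have [h [hiso hgen]] := env_iso iso e e' sb sb'.
exists b, b', h; split=> //.
- by case: sb.
by case: sb'.
Qed.

Theorem proposition3p10 (R : realType) (K : algType R[i]) (H : hopf_data K)
    (F : K ⊗ K) (A : lmodType R[i]) (act : K -> {linear A -> A})
    (mul : {bilinear A -> A -> A}) (one : A) (star : A -> A) :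
  triangular_hopf_star_algebra H ->
  is_twist H F ->
  module_star_algebra H act mul one star ->
  let HF := twist_hopf H F in
  exists (d : blie_data K (Der H act mul))
         (dF : blie_data K (Der HF act (twist_mul F act mul)))
         (D : Der H act mul -> Der HF act (twist_mul F act mul)),
    [/\ der_structure star d,
        der_structure star dF,
        forall psi a,
          D psi a = \tsum_(f1, f2 <- Finv F) hom_act H act f1 psi (act f2 a),
        braided_lie_star_iso HF (twist_blie F d) dF D
      & exists (b : bhopf_data K (uenv HF (twist_blie F d)))
               (bF : bhopf_data K (uenv HF dF))
               (DU : uenv HF (twist_blie F d) -> uenv HF dF),
          [/\ uenv_structure b,
              uenv_structure bF,
              forall psi, DU (ugen HF (twist_blie F d) psi)
                          = ugen HF dF (D psi)
            & braided_hopf_star_iso HF b bF DU]].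
Proof.
move=> hT hF hA HF; have iso := der_twist_iso hT hF hA.
exists (der_blie hT hA), (der_blie (twist_triangular_star hT hF)
  (twist_bilinear_module_star_algebra hT hF hA)), (der_twist hT hF hA).
split; [exact: der_blie_structure | exact: der_blie_structure | exact: der_twistE
       | exact: iso | exact: uenv_iso iso].
Qed.
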